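(* Let $\alpha\geq 0$, let $g\in\mathcal{C}(\overline{\mathbb{D}})$ and $f^{\ast}\in\mathcal{C}(\mathbb{T})$ be complex-valued, and suppose that $f\in\mathcal{C}^{2}(\mathbb{D})$ satisfies the Dirichlet boundary value problem $\Delta_{\alpha}(f)=g$ in $\mathbb{D}$, $f=f^{\ast}$ on $\mathbb{T}$. Then for all $z\in\mathbb{D}$, $$\|D_{f}(z)\|\leq(\alpha+1)2^{\alpha+1}\|f^{\ast}\|_{\infty}\frac{1}{1-|z|^2}+\Big(\alpha+\frac{4}{3}\Big)2^{\alpha+1}\|g\|_{\infty}.$$ In particular, if $f$ maps $\mathbb{D}$ into $\mathbb{D}$ and $g\equiv0$, then for all $z\in\mathbb{D}$, $$\|D_{f}(z)\|\leq(\alpha+1)2^{\alpha+1}\frac{1}{1-|z|^2}.$$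
   Context: $\mathbb{D}=\{z\in\mathbb{C}:|z|<1\}$, $\mathbb{T}=\partial\mathbb{D}$, $\overline{\mathbb{D}}=\mathbb{D}\cup\mathbb{T}$. $\mathcal{C}^m(\Omega)$ denotes the complex-valued $m$-times continuously differentiable functions on $\Omega$, and $\mathcal{C}=\mathcal{C}^0$. With $\partial_z=\frac12(\partial_x-i\partial_y)$ and $\overline{\partial}_z=\frac12(\partial_x+i\partial_y)$, the weighted Laplacian is $$\Delta_{\alpha}(f)(z)=\partial_z\big[(1-|z|^2)^{-\alpha}\,\overline{\partial}_z f\big](z),\quad z\in\mathbb{D},\ \alpha>-1.$$ The boundary condition $f=f^{\ast}$ on $\mathbb{T}$ means $f_r\to f^{\ast}$ in the space of distributions $\mathcal{D}'(\mathbb{T})$ as $r\to1^-$, where $f_r(e^{i\theta})=f(re^{i\theta})$. $D_f(z)$ is the (real $2\times 2$) Jacobian matrix of $f$ at $z$, and $\|D_f(z)\|=\sup\{|D_f(z)\varsigma|:|\varsigma|=1\}=|f_z(z)|+|f_{\overline z}(z)|$. $\|f^{\ast}\|_{\infty}=\sup_{z\in\mathbb{T}}|f^{\ast}(z)|$ and $\|g\|_{\infty}=\sup_{z\in\mathbb{D}}|g(z)|$. *)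

(* Defs.v *)
From Stdlib Require Import Reals Lra.
From Coquelicot Require Import Coquelicot.

Open Scope R_scope.

(* Functions on the disk or on the circle are total functions [C -> C]; only
   their values on the sets below are ever constrained or used. *)

Definition disk (z : C) : Prop := Cmod z < 1.
Definition circle (z : C) : Prop := Cmod z = 1.
Definition closed_disk (z : C) : Prop := Cmod z <= 1.

Definition circle_pt (t : R) : C := (cos t, sin t).

(* At every point of the open set [Om], the partial derivatives of the real and
   imaginary parts exist and are continuous up to order [m]. *)
Definition Cm (m : nat) (Om : C -> Prop) (f : C -> C) : Prop :=
  forall x y : R, Om (x, y) ->
    ex_diff_n (fun u v => Re (f (u, v))) m x y /\
    ex_diff_n (fun u v => Im (f (u, v))) m x y.

Definition Dx (f : C -> C) (z : C) : C :=
  (Derive (fun u => Re (f (u, Im z))) (Re z),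
   Derive (fun u => Im (f (u, Im z))) (Re z)).

Definition Dy (f : C -> C) (z : C) : C :=
  (Derive (fun v => Re (f (Re z, v))) (Im z),
   Derive (fun v => Im (f (Re z, v))) (Im z)).

Definition Dz (f : C -> C) (z : C) : C := (/ 2 * (Dx f z - Ci * Dy f z))%C.
Definition Dzbar (f : C -> C) (z : C) : C := (/ 2 * (Dx f z + Ci * Dy f z))%C.

Definition weighted_laplacian (alpha : R) (f : C -> C) (z : C) : C :=
  Dz (fun w => (RtoC (Rpower (1 - Cmod w ^ 2) (- alpha)) * Dzbar f w)%C) z.

(* The real Jacobian matrix of [f] at [z], acting on [s] in C = R^2. *)
Definition jacobian (f : C -> C) (z s : C) : C :=
  (Re (Dx f z) * Re s + Re (Dy f z) * Im s,
   Im (Dx f z) * Re s + Im (Dy f z) * Im s).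

(* [real] sends an infinite supremum to 0; this does not occur for functions
   that are bounded on the nonempty set [A]. *)
Definition sup_norm (A : C -> Prop) (u : C -> C) : R :=
  real (Lub_Rbar (fun r => exists z : C, A z /\ r = Cmod (u z))).

Definition jacobian_norm (f : C -> C) (z : C) : R :=
  sup_norm circle (jacobian f z).

(* Test functions: complex-valued and smooth along the circle. *)
Definition smooth_circle (phi : C -> C) : Prop :=
  forall (n : nat) (t : R),
    ex_derive_n (fun s => Re (phi (circle_pt s))) n t /\
    ex_derive_n (fun s => Im (phi (circle_pt s))) n t.

Definition circle_pairing (u phi : C -> C) : C :=
  (RtoC (/ (2 * PI)) *
   RInt (V := C_R_CompleteNormedModule)
     (fun t => (u (circle_pt t) * phi (circle_pt t))%C) 0 (2 * PI))%C.

Definition dilate (f : C -> C) (r : R) (w : C) : C := f (RtoC r * w)%C.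

(* [f = fstar] on the circle: the dilations [f_r] converge to [fstar] in the
   space of distributions (weak-* convergence) as [r] tends to 1 from below. *)
Definition boundary_value (f fstar : C -> C) : Prop :=
  forall phi : C -> C, smooth_circle phi ->
    filterlim (fun r : R => circle_pairing (dilate f r) phi)
      (at_left 1) (locally (circle_pairing fstar phi)).

(* Main.v *)
Require Import Defs.
From Stdlib Require Import Reals Lra Lia Classical IndefiniteDescription ZArith.
From Coquelicot Require Import Coquelicot.

(** The equation is a first-order system: for [h = (1 - |z|^2)^(- alpha) f_zbar]
    one has [f_zbar = (1 - |z|^2)^alpha h] and [h_z = g] ([Cm_2_system]).

    At the origin, the derivatives of [f] are read off from its Fourier
    coefficients of order [1] and [-1] on the circles [|z| = r], and its value
    from the coefficient of order [0]. As functions of [r] these satisfy ordinary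
    differential equations that involve one coefficient of [h] and one of [g]
    each. Integration up to [r = 1] bounds [f(0)], [f_z(0)] and [f_zbar(0)] by a
    bound [M] for [f] near the circle and by an integral of the circular means of
    [|g|] ([origin_value], [origin_dz], [origin_dzbar]).

    The Moebius map [phi(z) = (z + a) / (1 + conj a z)] brings any point [a] to
    the origin: [F = (1 + conj a z)^alpha f(phi)] solves a problem of the same form, with
    [|F| <= 2^alpha M] near the circle and with a source bounded by
    [2^alpha (1 - |a|^2)^2 sup|g| (1 - |z|^2)^(- alpha) / |1 + conj a z|^4]
    ([transport_system], [transport_source_bound]). The circular means of
    [1 / |1 + conj a z|^4] are explicit ([mean_inv_one_plus_4]), and their
    integrals in the three estimates are at most [1], [4/3] and [4/3] times
    [1 / (1 - |a|^2)]. Since [F_z(0) = alpha conj a f(a) + (1 - |a|^2) f_z(a)] and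
    [F_zbar(0) = (1 - |a|^2) f_zbar(a)], the data contribute
    [alpha + 1 + (alpha + 1)] times [2^alpha M] to
    [(1 - |a|^2) (|f_z(a)| + |f_zbar(a)|)], and the source at most
    [alpha + 4/3 + 4/3] times [2^alpha (1 - |a|^2) sup|g|]; both fit under the
    constants of the theorem ([gradient_estimate]).

    This argument needs [f] to be bounded by [M] up to the circle, whereas the
    boundary values are only attained as distributions. A map into the disk is
    bounded by [1]. In general [f] is first averaged over rotations with the
    weight [(1 + cos t)^n]. The operator commutes with rotations, so the average
    solves the problem for averaged data ([weighted_system_rot_avg]); the weight
    is a trigonometric polynomial, so only finitely many Fourier coefficients are
    involved and the average attains its boundary values uniformly
    ([boundary_bound_smoothed]). As [n] grows the weights concentrate at [t = 0]
    and the estimate passes to [f] itself ([gradient_bound_of_smoothed]). *)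

Open Scope R_scope.

(** * Complex numbers *)

Lemma Cconj_RtoC (r : R) : Cconj (RtoC r) = RtoC r.
Proof. apply injective_projections; simpl; ring. Qed.

Lemma Cconj_Ci : Cconj Ci = (- Ci)%C.
Proof. apply injective_projections; simpl; ring. Qed.

Lemma Cmod_RtoC_pos (r : R) : 0 <= r -> Cmod (RtoC r) = r.
Proof. intros; rewrite Cmod_R; apply Rabs_pos_eq; assumption. Qed.

Lemma RtoC_neq_0 (r : R) : r <> 0 -> RtoC r <> 0.
Proof. intros Hr K; apply Hr, RtoC_inj, K. Qed.

Lemma Ci_sqr (a : C) : (Ci * (Ci * a))%C = (- a)%C.
Proof. destruct a; apply injective_projections; simpl; ring. Qed.

Lemma Cnorm2_neq_0 (z : C) : z <> 0 -> (fst z ^ 2 + snd z ^ 2 <> 0)%R.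
Proof.
intros Hz H; apply Hz; apply Cmod_eq_0; unfold Cmod; rewrite H; apply sqrt_0.
Qed.

Lemma Cmod_sqr (z : C) : Cmod z ^ 2 = fst z ^ 2 + snd z ^ 2.
Proof. apply Cmod2_alt. Qed.

Lemma Re_le_Cmod (z : C) : Re z <= Cmod z.
Proof. generalize (re_le_Cmod z) (Rle_abs (Re z)); lra. Qed.

(** Moduli are read off from real parts: every complex number is rotated onto
    the positive axis by some unimodular factor. *)
Lemma Cmod_dual (z : C) : exists w, Cmod w = 1 /\ Cmod z = Re (w * z)%C.
Proof.
destruct (Ceq_dec z 0) as [->|Hz].
- exists 1; rewrite Cmod_1, Cmod_0, Cmult_0_r; split; reflexivity.
- exists (Cconj z / Cmod z)%C.
  assert (Hm : Cmod z <> 0) by (intro K; apply Hz, Cmod_eq_0, K).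
  split.
  + rewrite Cmod_div, Cmod_conj, Cmod_R, Rabs_pos_eq by
      (try apply Cmod_ge_0; intro K; apply Hm; apply RtoC_inj; exact K).
    field; exact Hm.
  + replace (Cconj z / Cmod z * z)%C with (RtoC (Cmod z)); [reflexivity|].
    replace (Cconj z / Cmod z * z)%C with (z * Cconj z / Cmod z)%C by (unfold Cdiv; ring).
    rewrite <- Cmod2_conj, <- RtoC_div by exact Hm; apply (f_equal RtoC); field; exact Hm.
Qed.

(** * Continuity of complex-valued functions *)

Notation ccontinuous := (continuous (U := C_UniformSpace)).
Notation ccont_at F z := (continuous (T := C_UniformSpace) (U := C_UniformSpace) F z).

(** [C] carries the product uniform structure, so continuity is checked on real
    and imaginary parts. *)
Lemma continuous_pair_C {U : UniformSpace} (F : U -> C) (x : U) :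
  continuous (fun t => Re (F t)) x -> continuous (fun t => Im (F t)) x ->
  ccontinuous F x.
Proof.
intros HR HI.
apply (continuous_ext (fun t => (Re (F t), Im (F t)))).
  intro t; destruct (F t); reflexivity.
intros P [eps HP].
generalize (HR _ (locally_ball _ eps)) (HI _ (locally_ball _ eps)).
unfold filtermap; intros H1 H2.
generalize (filter_and _ _ H1 H2); apply filter_imp; intros t [K1 K2].
apply HP; split; assumption.
Qed.

Lemma continuous_Re {U : UniformSpace} (F : U -> C) (x : U) :
  ccontinuous F x -> continuous (fun t => Re (F t)) x.
Proof.
intro H; apply (continuous_comp F Re); [exact H|].
destruct (F x); apply continuous_fst.
Qed.

Lemma continuous_Im {U : UniformSpace} (F : U -> C) (x : U) :
  ccontinuous F x -> continuous (fun t => Im (F t)) x.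
Proof.
intro H; apply (continuous_comp F Im); [exact H|].
destruct (F x); apply continuous_snd.
Qed.

Lemma continuous_Cplus {U : UniformSpace} (F G : U -> C) (x : U) :
  ccontinuous F x -> ccontinuous G x -> ccontinuous (fun t => (F t + G t)%C) x.
Proof. intros; apply (continuous_plus (V := C_R_NormedModule)); assumption. Qed.

Lemma continuous_Cminus {U : UniformSpace} (F G : U -> C) (x : U) :
  ccontinuous F x -> ccontinuous G x -> ccontinuous (fun t => (F t - G t)%C) x.
Proof. intros; apply (continuous_minus (V := C_R_NormedModule)); assumption. Qed.

Lemma continuous_Copp {U : UniformSpace} (F : U -> C) (x : U) :
  ccontinuous F x -> ccontinuous (fun t => (- F t)%C) x.
Proof. intros; apply (continuous_opp (V := C_R_NormedModule)); assumption. Qed.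

Lemma continuous_Cmult {U : UniformSpace} (F G : U -> C) (x : U) :
  ccontinuous F x -> ccontinuous G x -> ccontinuous (fun t => (F t * G t)%C) x.
Proof.
intros HF HG.
pose proof (continuous_Re _ _ HF); pose proof (continuous_Im _ _ HF).
pose proof (continuous_Re _ _ HG); pose proof (continuous_Im _ _ HG).
apply continuous_pair_C; simpl.
- apply (continuous_minus (V := R_NormedModule));
    apply (continuous_mult (K := R_AbsRing)); assumption.
- apply (continuous_plus (V := R_NormedModule));
    apply (continuous_mult (K := R_AbsRing)); assumption.
Qed.

Lemma continuous_Cconj {U : UniformSpace} (F : U -> C) (x : U) :
  ccontinuous F x -> ccontinuous (fun t => Cconj (F t)) x.
Proof.
intros HF; apply continuous_pair_C; simpl.
- apply continuous_Re; assumption.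
- apply (continuous_opp (V := R_NormedModule)), continuous_Im; assumption.
Qed.

Lemma continuous_RtoC {U : UniformSpace} (u : U -> R) (x : U) :
  continuous u x -> ccontinuous (fun t => RtoC (u t)) x.
Proof.
intros Hu; apply continuous_pair_C; simpl; [exact Hu | apply continuous_const].
Qed.

Lemma continuous_Cinv {U : UniformSpace} (F : U -> C) (x : U) :
  ccontinuous F x -> F x <> 0 -> ccontinuous (fun t => (/ F t)%C) x.
Proof.
intros HF H0.
pose proof (continuous_Re _ _ HF) as HR; pose proof (continuous_Im _ _ HF) as HI.
assert (HD : continuous (fun t => / (fst (F t) ^ 2 + snd (F t) ^ 2)) x).
{ apply (continuous_comp (fun t => fst (F t) ^ 2 + snd (F t) ^ 2) Rinv).
  - apply (continuous_plus (V := R_NormedModule)).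
    + apply (continuous_ext (fun t => Re (F t) * Re (F t))); [intro; unfold Re; simpl; ring|].
      apply (continuous_mult (K := R_AbsRing)); assumption.
    + apply (continuous_ext (fun t => Im (F t) * Im (F t))); [intro; unfold Im; simpl; ring|].
      apply (continuous_mult (K := R_AbsRing)); assumption.
  - apply continuity_pt_filterlim, continuity_pt_inv.
    + apply continuity_pt_id.
    + apply Cnorm2_neq_0, H0. }
apply continuous_pair_C; simpl; unfold Rdiv;
  apply (continuous_mult (K := R_AbsRing)); try assumption.
apply (continuous_opp (V := R_NormedModule)); assumption.
Qed.

Lemma continuous_Cmod {U : UniformSpace} (F : U -> C) (x : U) :
  ccontinuous F x -> continuous (fun t => Cmod (F t)) x.
Proof.
intro HF; apply (continuous_comp F Cmod); [exact HF|].
apply (continuous_ext (fun z : C => norm (z : C_R_NormedModule))).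
  intro z; symmetry; apply Cmod_norm.
apply (filterlim_norm (V := C_R_NormedModule)).
Qed.

(** The metric form of continuity, with the modulus in place of the product
    uniform structure of [C]. *)
Lemma continuous_Cmod_iff {U : UniformSpace} (F : U -> C) (x : U) :
  ccontinuous F x <->
  forall eps, 0 < eps -> locally x (fun t => Cmod (F t - F x)%C < eps).
Proof.
split.
- intros H eps He.
  assert (H0 : continuous (fun t => Cmod (F t - F x)%C) x).
  { apply continuous_Cmod, continuous_Cminus; [exact H | apply continuous_const]. }
  generalize (H0 _ (locally_ball _ (mkposreal _ He))); unfold filtermap.
  apply filter_imp; intros t Ht.
  unfold ball in Ht; simpl in Ht; unfold AbsRing_ball, abs, minus, plus, opp in Ht; simpl in Ht.
  replace (F x - F x)%C with (RtoC 0) in Ht by ring; rewrite Cmod_0 in Ht.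
  apply Rabs_def2 in Ht; lra.
- intros H.
  apply filterlim_locally; intros eps.
  generalize (H eps (cond_pos eps)); apply filter_imp; intros t Ht.
  apply (C_NormedModule_mixin_compat1 (F x) (F t) eps Ht).
Qed.

Lemma locally_C_iff (z : C) (P : C -> Prop) :
  locally (T := C_UniformSpace) z P <->
  exists d, 0 < d /\ forall w, Cmod (w - z)%C < d -> P w.
Proof.
split.
- intros [d Hd]; exists d; split; [apply cond_pos|].
  intros w Hw; apply Hd; apply (C_NormedModule_mixin_compat1 z w d Hw).
- intros [d [Hd H]].
  assert (Hd2 : 0 < d / sqrt 2).
  { apply Rdiv_lt_0_compat; [exact Hd | apply sqrt_lt_R0; lra]. }
  exists (mkposreal _ Hd2); intros w Hw; apply H.
  generalize (C_NormedModule_mixin_compat2 z w (mkposreal _ Hd2) Hw); simpl.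
  replace (sqrt 2 * (d / sqrt 2)) with d; [intro K; exact K|].
  field; apply Rgt_not_eq, sqrt_lt_R0; lra.
Qed.

Lemma continuous_C_metric (F : C -> C) (z : C) :
  ccont_at F z <->
  forall eps, 0 < eps -> exists d, 0 < d /\
    forall w, Cmod (w - z)%C < d -> Cmod (F w - F z)%C < eps.
Proof.
rewrite continuous_Cmod_iff; split; intros H eps He.
- apply locally_C_iff, H, He.
- apply locally_C_iff, H, He.
Qed.

Lemma continuous_R_metric (F : R -> C) (t : R) :
  ccontinuous F t <->
  forall eps, 0 < eps -> exists d, 0 < d /\
    forall s, Rabs (s - t) < d -> Cmod (F s - F t)%C < eps.
Proof.
rewrite continuous_Cmod_iff; split; intros H eps He.
- destruct (H eps He) as [d Hd]; exists d; split; [apply cond_pos|].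
  intros s Hs; apply Hd; exact Hs.
- destruct (H eps He) as [d [Hd K]]; exists (mkposreal d Hd).
  intros s Hs; apply K; exact Hs.
Qed.

Lemma ccontinuous_comp {U : UniformSpace} (F : U -> C) (G : C -> C) (x : U) :
  ccontinuous F x -> ccont_at G (F x) ->
  ccontinuous (fun t => G (F t)) x.
Proof. intros; apply (continuous_comp F G); assumption. Qed.

(** * Unimodular numbers *)

Notation cis := circle_pt.

Lemma Cmod_cis (t : R) : Cmod (cis t) = 1.
Proof.
unfold Cmod, cis; simpl.
replace (_ + _) with 1; [apply sqrt_1|].
generalize (sin2_cos2 t); unfold Rsqr; intro; lra.
Qed.

Lemma cis_plus (s t : R) : cis (s + t) = (cis s * cis t)%C.
Proof.
unfold cis, Cmult; simpl; rewrite cos_plus, sin_plus; f_equal; ring.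
Qed.

Lemma cis_opp (t : R) : cis (- t) = Cconj (cis t).
Proof. unfold cis, Cconj; simpl; rewrite cos_neg, sin_neg; reflexivity. Qed.

Lemma cis_0 : cis 0 = 1.
Proof. unfold cis; rewrite cos_0, sin_0; reflexivity. Qed.

Lemma continuous_cis (t : R) : ccontinuous cis t.
Proof.
apply continuous_pair_C; simpl; [apply continuous_cos | apply continuous_sin].
Qed.

(** The combinators are selected by the shape of the function: unifying against
    each of them in turn would unfold the complex operations to pairs. *)
Ltac ccont := repeat (cbv beta; first [assumption |
  match goal with K : forall _, continuous _ _ |- _ => exact (K _) end | lazymatch goal with
  | |- continuous (fun t => Cplus _ _) _ => apply continuous_Cplus
  | |- continuous (fun t => Cminus _ _) _ => apply continuous_Cminus
  | |- continuous (fun t => Copp _) _ => apply continuous_Copp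
  | |- continuous (fun t => Cmult _ _) _ => apply continuous_Cmult
  | |- continuous (Cmult ?a) _ => apply (continuous_Cmult (fun _ => a) (fun t => t))
  | |- continuous Cconj _ => apply (continuous_Cconj (fun t => t))
  | |- continuous (fun t => Cconj _) _ => apply continuous_Cconj
  | |- continuous circle_pt _ => apply continuous_cis
  | |- continuous (fun t => t) _ => apply continuous_id
  | |- continuous (fun t => ?c) _ => apply continuous_const
  end]).

(** * Wirtinger calculus *)

(** Real differentiability of [F] at [z] with [p] and [q] the values of the two
    Wirtinger derivatives, in Caratheodory's form: the difference quotients are
    replaced by continuous factors, so that the product and chain rules become
    algebraic identities. *)
Definition has_wirtinger (F : C -> C) (z p q : C) : Prop :=
  exists A B : C -> C,
    ccont_at A z /\
    ccont_at B z /\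
    A z = p /\ B z = q /\
    forall w, F w = (F z + A w * (w - z) + B w * Cconj (w - z))%C.

Ltac conj_push :=
  repeat first [ rewrite Cplus_conj | rewrite Cminus_conj | rewrite Cmult_conj
               | rewrite Copp_conj | rewrite Cconj_conj ].

Lemma has_wirtinger_eq (F : C -> C) (z p q p' q' : C) :
  has_wirtinger F z p q -> p = p' -> q = q' -> has_wirtinger F z p' q'.
Proof. intros H <- <-; exact H. Qed.

Lemma has_wirtinger_ext (F G : C -> C) (z p q : C) :
  (forall w, F w = G w) -> has_wirtinger F z p q -> has_wirtinger G z p q.
Proof.
intros E (A & B & HA & HB & Ap & Bq & H); exists A, B.
split; [exact HA|split; [exact HB|split; [exact Ap|split; [exact Bq|]]]].
intro w; rewrite <- !E; apply H.
Qed.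

Lemma has_wirtinger_continuous (F : C -> C) (z p q : C) :
  has_wirtinger F z p q -> ccont_at F z.
Proof.
intros (A & B & HA & HB & _ & _ & H).
apply (continuous_ext (fun w => F z + A w * (w - z) + B w * Cconj (w - z))%C).
- intro w; symmetry; apply H.
- ccont.
Qed.

Lemma has_wirtinger_const (c z : C) : has_wirtinger (fun _ => c) z 0 0.
Proof.
exists (fun _ => RtoC 0), (fun _ => RtoC 0); repeat split; try apply continuous_const.
intro w; ring.
Qed.

Lemma has_wirtinger_id (z : C) : has_wirtinger (fun w => w) z 1 0.
Proof.
exists (fun _ => RtoC 1), (fun _ => RtoC 0); repeat split; try apply continuous_const.
intro w; ring.
Qed.

Lemma has_wirtinger_plus (F G : C -> C) (z p q p' q' : C) :
  has_wirtinger F z p q -> has_wirtinger G z p' q' ->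
  has_wirtinger (fun w => F w + G w)%C z (p + p')%C (q + q')%C.
Proof.
intros (A & B & HA & HB & Ap & Bq & H) (A' & B' & HA' & HB' & Ap' & Bq' & H').
exists (fun w => A w + A' w)%C, (fun w => B w + B' w)%C.
split; [ccont|split; [ccont|split; [congruence|split; [congruence|]]]].
intro w; rewrite (H w), (H' w); ring.
Qed.

(** From [F w G w - F z G z = (F w - F z) G w + F z (G w - G z)]. *)
Lemma has_wirtinger_mult (F G : C -> C) (z p q p' q' : C) :
  has_wirtinger F z p q -> has_wirtinger G z p' q' ->
  has_wirtinger (fun w => F w * G w)%C z (p * G z + F z * p')%C (q * G z + F z * q')%C.
Proof.
intros HF HG.
pose proof (has_wirtinger_continuous _ _ _ _ HG).
destruct HF as (A & B & HA & HB & Ap & Bq & H0), HG as (A' & B' & HA' & HB' & Ap' & Bq' & H').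
exists (fun w => A w * G w + F z * A' w)%C, (fun w => B w * G w + F z * B' w)%C.
split; [ccont|split; [ccont|split; [congruence|split; [congruence|]]]].
intro w; rewrite (H0 w), (H' w); ring.
Qed.

Lemma has_wirtinger_conj (F : C -> C) (z p q : C) :
  has_wirtinger F z p q -> has_wirtinger (fun w => Cconj (F w)) z (Cconj q) (Cconj p).
Proof.
intros (A & B & HA & HB & Ap & Bq & H).
exists (fun w => Cconj (B w)), (fun w => Cconj (A w)).
split; [ccont|split; [ccont|split; [congruence|split; [congruence|]]]].
intro w; rewrite (H w); conj_push; ring.
Qed.

Lemma has_wirtinger_comp (G F : C -> C) (z p q s t : C) :
  has_wirtinger F z p q -> has_wirtinger G (F z) s t ->
  has_wirtinger (fun w => G (F w)) z (s * p + t * Cconj q)%C (s * q + t * Cconj p)%C.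
Proof.
intros HF (S & T & HS & HT & Ss & Tt & H).
pose proof (has_wirtinger_continuous _ _ _ _ HF) as CF.
destruct HF as (A & B & HA & HB & Ap & Bq & H0).
pose proof (ccontinuous_comp F S z CF HS) as HSF.
pose proof (ccontinuous_comp F T z CF HT) as HTF.
exists (fun w => S (F w) * A w + T (F w) * Cconj (B w))%C,
       (fun w => S (F w) * B w + T (F w) * Cconj (A w))%C.
split; [ccont|split; [ccont|split; [congruence|split; [congruence|]]]].
intro w; rewrite (H (F w)).
replace (F w - F z)%C with (A w * (w - z) + B w * Cconj (w - z))%C by (rewrite (H0 w); ring).
conj_push; ring.
Qed.

Lemma has_wirtinger_inv (z : C) :
  z <> 0 -> has_wirtinger Cinv z (- (/ z * / z))%C 0.
Proof.
intros Hz.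
(* Off the origin the factor is [- / (w z)]; at the origin its value is forced
   by the convention [/ 0 = 0]. *)
exists (fun w => if Ceq_dec w 0 then (/ z * / z)%C else (- (/ w * / z))%C), (fun _ => RtoC 0).
split.
- assert (K : ccont_at (fun w => - (/ w * / z))%C z).
  { apply continuous_Copp, continuous_Cmult; [|apply continuous_const].
    apply (continuous_Cinv (fun w => w)); [apply continuous_id|exact Hz]. }
  unfold continuous; destruct (Ceq_dec z 0) as [E|_]; [contradiction|].
  apply (filterlim_ext_loc (fun w : C => (- (/ w * / z))%C)); [|exact K].
  apply locally_C_iff; exists (Cmod z); split; [apply Cmod_gt_0, Hz|].
  intros w Hw; destruct (Ceq_dec w 0) as [E|_]; [|reflexivity].
  exfalso; rewrite E in Hw; replace (0 - z)%C with (- z)%C in Hw by ring.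
  rewrite Cmod_opp in Hw; lra.
- split; [apply continuous_const|split; [|split; [reflexivity|]]].
  + destruct (Ceq_dec z 0); [contradiction|reflexivity].
  + intro w; destruct (Ceq_dec w 0) as [->|Hw].
    * replace (/ 0)%C with (RtoC 0); [field; exact Hz|].
      unfold Cinv, RtoC; simpl; apply injective_projections; simpl; unfold Rdiv; ring.
    * field; split; assumption.
Qed.

(** Passage from the first-order expansion with a small remainder: the whole
    remainder is charged to the factor of [w - z]. *)
Lemma has_wirtinger_of_remainder (F : C -> C) (z p q : C) :
  (forall eps, 0 < eps -> exists d, 0 < d /\ forall w, Cmod (w - z)%C < d ->
     Cmod (F w - F z - p * (w - z) - q * Cconj (w - z))%C <= eps * Cmod (w - z)%C) ->
  has_wirtinger F z p q.
Proof.
intros H.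
pose (E w := (F w - F z - p * (w - z) - q * Cconj (w - z))%C).
exists (fun w => p + (if Ceq_dec w z then 0 else E w / (w - z)))%C, (fun _ => q).
assert (Hz0 : forall w, w <> z -> (w - z)%C <> 0).
{ intros w Hw K; apply Hw; replace w with ((w - z) + z)%C by ring; rewrite K; ring. }
split.
- apply continuous_C_metric; intros eps He.
  destruct (H (eps / 2)) as [d [Hd K]]; [lra|].
  exists d; split; [exact Hd|]; intros w Hw.
  destruct (Ceq_dec z z) as [_|N]; [|contradiction].
  destruct (Ceq_dec w z) as [->|N].
  + replace (p + 0 - (p + 0))%C with (RtoC 0) by ring; rewrite Cmod_0; exact He.
  + replace (p + E w / (w - z) - (p + 0))%C with (E w / (w - z))%C by ring.
    rewrite Cmod_div by (apply Hz0, N).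
    assert (Hp : 0 < Cmod (w - z)%C) by (apply Cmod_gt_0, Hz0, N).
    apply (Rmult_lt_reg_r (Cmod (w - z)%C)); [exact Hp|].
    unfold Rdiv; rewrite Rmult_assoc, Rinv_l, Rmult_1_r by lra.
    generalize (K w Hw); fold (E w); nra.
- split; [apply continuous_const|split; [|split; [reflexivity|]]].
  + destruct (Ceq_dec z z) as [_|N]; [ring|contradiction].
  + intro w; destruct (Ceq_dec w z) as [->|N].
    * replace (z - z)%C with (RtoC 0) by ring.
      rewrite ?(Cconj_RtoC 0); ring.
    * unfold E; field; apply Hz0, N.
Qed.

Lemma has_wirtinger_of_differentiable (F : C -> C) (z : C) (ux uy vx vy : R) :
  differentiable_pt_lim (fun a b => Re (F (a, b))) (Re z) (Im z) ux uy ->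
  differentiable_pt_lim (fun a b => Im (F (a, b))) (Re z) (Im z) vx vy ->
  has_wirtinger F z ((ux + vy) / 2, (vx - uy) / 2)%R ((ux - vy) / 2, (vx + uy) / 2)%R.
Proof.
intros Hu Hv; apply has_wirtinger_of_remainder; intros eps He.
assert (He2 : 0 < eps / 2) by lra.
generalize (Hu (mkposreal _ He2)) (Hv (mkposreal _ He2)); simpl; intros K1 K2.
destruct (locally_2d_and _ _ _ _ K1 K2) as [d Hd].
exists d; split; [apply cond_pos|].
intros [a b] Hw.
destruct z as [x y]; simpl in *.
assert (Hmax : Rmax (Rabs (a - x)) (Rabs (b - y)) <= Cmod ((a, b) - (x, y))%C).
{ apply (Rmax_Cmod ((a, b) - (x, y))%C). }
assert (Ha : Rabs (a - x) < d).
{ eapply Rle_lt_trans; [apply Rmax_l|]; eapply Rle_lt_trans; [apply Hmax|]; exact Hw. }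
assert (Hb : Rabs (b - y) < d).
{ eapply Rle_lt_trans; [apply Rmax_r|]; eapply Rle_lt_trans; [apply Hmax|]; exact Hw. }
destruct (Hd a b Ha Hb) as [D1 D2].
set (m := Cmod ((a, b) - (x, y))%C) in *.
set (E1 := Re (F (a, b)) - Re (F (x, y)) - (ux * (a - x) + uy * (b - y))) in *.
set (E2 := Im (F (a, b)) - Im (F (x, y)) - (vx * (a - x) + vy * (b - y))) in *.
match goal with |- Cmod ?c <= _ => replace c with (RtoC E1 + Ci * RtoC E2)%C end.
- eapply Rle_trans; [apply Cmod_triangle|].
  rewrite Cmod_mult, Cmod_Ci, !Cmod_R.
  assert (K : eps / 2 * Rmax (Rabs (a - x)) (Rabs (b - y)) <= eps / 2 * m)
    by (apply Rmult_le_compat_l; lra).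
  lra.
- unfold E1, E2; destruct (F (a, b)) as [Fa Fb], (F (x, y)) as [Ga Gb].
  apply injective_projections; simpl; field.
Qed.

(** The derivative along the line through [z] in the direction [v]. Real parts
    suffice: imaginary parts are those of [- Ci * F]. *)
Lemma has_wirtinger_is_derive_line (F : C -> C) (z v p q : C) (t : R) :
  has_wirtinger F (z + RtoC t * v)%C p q ->
  is_derive (V := R_NormedModule) (fun s : R => Re (F (z + RtoC s * v)%C)) t (Re (p * v + q * Cconj
      v)%C).
Proof.
intros (A & B & HA & HB & Ap & Bq & H).
set (z0 := (z + RtoC t * v)%C) in *.
apply is_derive_Reals; intros eps He.
assert (HC : ccont_at
   (fun w => A w * v + B w * Cconj v)%C z0) by ccont.
assert (HL : ccontinuous (fun s : R => (z + RtoC s * v)%C) t).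
{ apply continuous_Cplus; [apply continuous_const|].
  apply continuous_Cmult; [|apply continuous_const].
  apply continuous_RtoC, continuous_id. }
pose proof (ccontinuous_comp _ _ _ HL HC) as HC'.
destruct (proj1 (continuous_R_metric _ _) HC' eps He) as [d [Hd K]].
exists (mkposreal d Hd); intros h Hh0 Hh; simpl in Hh.
assert (Hh' : Rabs (t + h - t) < d) by (replace (t + h - t) with h by ring; exact Hh).
specialize (K _ Hh').
fold z0 in K; set (w := (z + RtoC (t + h) * v)%C) in *; cbv beta in K.
rewrite Ap, Bq in K.
eapply Rle_lt_trans; [|exact K].
eapply Rle_trans; [|apply re_le_Cmod].
apply Req_le; f_equal.
rewrite (H w).
assert (E : (w - z0)%C = (RtoC h * v)%C) by (unfold w, z0; rewrite RtoC_plus; ring).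
rewrite E, Cmult_conj; fold z0.
destruct (F z0) as [f1 f2], (A w) as [a1 a2], (B w) as [b1 b2], v as [v1 v2], p as [p1 p2],
    q as [q1 q2].
simpl; field; exact Hh0.
Qed.

(** The Wirtinger derivatives are determined by the partial derivatives along
    the two axes. *)
Lemma has_wirtinger_partials (F : C -> C) (z p q : C) :
  has_wirtinger F z p q -> Defs.Dx F z = (p + q)%C /\ Dy F z = (Ci * (p - q))%C.
Proof.
intros H.
assert (Hi : has_wirtinger (fun w => - Ci * F w)%C z (- Ci * p)%C (- Ci * q)%C).
{ eapply has_wirtinger_eq; [apply has_wirtinger_mult;
    [apply has_wirtinger_const|exact H]| |]; cbv beta; ring. }
assert (EI : forall c : C, Re (- Ci * c)%C = Im c).
{ intros [c1 c2]; simpl; ring. }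
assert (Hx : forall G s t, has_wirtinger G z s t ->
  Derive (fun u => Re (G (u, Im z))) (Re z) = Re (s + t)%C).
{ intros G s t HG; apply is_derive_unique.
  assert (E0 : forall u, ((0, Im z) + RtoC u * 1)%C = (u, Im z)).
  { intro u; apply injective_projections; simpl; ring. }
  apply (is_derive_ext (fun u : R => Re (G ((0, Im z) + RtoC u * 1)%C))).
  - intro u; rewrite E0; reflexivity.
  - replace (s + t)%C with (s * 1 + t * Cconj 1)%C.
    + apply has_wirtinger_is_derive_line; rewrite E0; destruct z; exact HG.
    + rewrite ?(Cconj_RtoC 1); ring. }
assert (Hy : forall G s t, has_wirtinger G z s t ->
  Derive (fun u => Re (G (Re z, u))) (Im z) = Re (Ci * (s - t))%C).
{ intros G s t HG; apply is_derive_unique.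
  assert (E0 : forall u, ((Re z, 0) + RtoC u * Ci)%C = (Re z, u)).
  { intro u; apply injective_projections; simpl; ring. }
  apply (is_derive_ext (fun u : R => Re (G ((Re z, 0) + RtoC u * Ci)%C))).
  - intro u; rewrite E0; reflexivity.
  - replace (Ci * (s - t))%C with (s * Ci + t * Cconj Ci)%C.
    + apply has_wirtinger_is_derive_line; rewrite E0; destruct z; exact HG.
    + rewrite Cconj_Ci; ring. }
split; apply injective_projections; unfold Defs.Dx, Dy, fst, snd.
- rewrite (Hx F p q H); reflexivity.
- transitivity (Derive (fun u => Re (- Ci * F (u, Im z))%C) (Re z)).
  + apply Derive_ext; intro; rewrite EI; reflexivity.
  + rewrite (Hx _ _ _ Hi).
    replace (- Ci * p + - Ci * q)%C with (- Ci * (p + q))%C by ring.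
    rewrite EI; reflexivity.
- rewrite (Hy F p q H); reflexivity.
- transitivity (Derive (fun u => Re (- Ci * F (Re z, u))%C) (Im z)).
  + apply Derive_ext; intro; rewrite EI; reflexivity.
  + rewrite (Hy _ _ _ Hi).
    replace (Ci * (- Ci * p - - Ci * q))%C with (- Ci * (Ci * (p - q)))%C by ring.
    rewrite EI; reflexivity.
Qed.

Lemma has_wirtinger_Dz (F : C -> C) (z p q : C) :
  has_wirtinger F z p q -> Dz F z = p /\ Dzbar F z = q.
Proof.
intros H; destruct (has_wirtinger_partials F z p q H) as [Ex Ey].
unfold Dz, Dzbar; rewrite Ex, Ey, Ci_sqr.
assert (N : RtoC 2 <> 0) by (intro K; apply RtoC_inj in K; lra).
split; field; exact N.
Qed.

Lemma differentiable_of_partials (u ux uy : R -> R -> R) (x y : R) :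
  locally_2d (fun a b => is_derive (fun t => u t b) a (ux a b)) x y ->
  is_derive (fun t => u x t) y (uy x y) ->
  continuity_2d_pt ux x y ->
  differentiable_pt_lim u x y (ux x y) (uy x y).
Proof.
intros H1 H2 H3.
apply filterdiff_differentiable_pt_lim.
generalize (is_derive_filterdiff u x y ux (uy x y) (proj1 (locally_2d_locally _ _ _) H1) H2
  (proj1 (continuity_2d_pt_filterlim _ _ _) H3)).
intros H; exact H.
Qed.

(** Logarithms, arguments and powers enter through real functions of real
    parts; with [F] complex the rule also covers imaginary parts, as
    [Re (- Ci * F)]. *)
Lemma has_wirtinger_real_comp (th : R -> R) (F : C -> C) (z p q : C) (d : R) :
  has_wirtinger F z p q -> is_derive th (Re (F z)) d ->
  has_wirtinger (fun w => RtoC (th (Re (F w)))) z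
    (RtoC (d / 2) * (p + Cconj q))%C (RtoC (d / 2) * (q + Cconj p))%C.
Proof.
intros HF Hd.
apply (has_wirtinger_eq (fun w => RtoC (th (Re (F w)))) z
  (RtoC (d / 2) * p + RtoC (d / 2) * Cconj q)%C (RtoC (d / 2) * q + RtoC (d / 2) * Cconj p)%C);
  [|ring|ring].
apply (has_wirtinger_comp (fun c => RtoC (th (Re c)))); [exact HF|].
set (z0 := F z) in *; destruct z0 as [x y]; simpl in Hd.
eapply has_wirtinger_eq.
- apply (has_wirtinger_of_differentiable _ (x, y) d 0 0 0); simpl.
  + apply differentiable_pt_lim_proj1_0, is_derive_Reals, Hd.
  + apply (differentiable_pt_lim_proj1_0 (fun _ => 0)), derivable_pt_lim_const.
- apply injective_projections; simpl; field.
- apply injective_projections; simpl; field.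
Qed.

(** * The complex exponential and powers on the right half-plane *)

Definition cexp (z : C) : C := (RtoC (exp (Re z)) * cis (Im z))%C.

Lemma has_wirtinger_cis_re (F : C -> C) (z p q : C) :
  has_wirtinger F z p q ->
  has_wirtinger (fun w => cis (Re (F w))) z
    (Ci * cis (Re (F z)) / 2 * (p + Cconj q))%C (Ci * cis (Re (F z)) / 2 * (q + Cconj p))%C.
Proof.
intros H.
apply (has_wirtinger_ext (fun w => RtoC (cos (Re (F w))) + Ci * RtoC (sin (Re (F w))))%C).
  intro w; apply injective_projections; simpl; ring.
eapply has_wirtinger_eq.
- apply has_wirtinger_plus.
  + eapply (has_wirtinger_real_comp cos _ _ _ _ _ H), is_derive_cos.
  + apply has_wirtinger_mult; [apply has_wirtinger_const|].
    eapply (has_wirtinger_real_comp sin _ _ _ _ _ H), is_derive_sin.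
- set (t := Re (F z)); generalize (p + Cconj q)%C; intros [a b].
  apply injective_projections; simpl; field.
- set (t := Re (F z)); generalize (q + Cconj p)%C; intros [a b].
  apply injective_projections; simpl; field.
Qed.

Lemma has_wirtinger_cexp (z : C) : has_wirtinger cexp z (cexp z) 0.
Proof.
apply (has_wirtinger_ext (fun w => RtoC (exp (Re w)) * cis (Re (- Ci * w)))%C).
{ intros [x y]; unfold cexp; do 2 f_equal; simpl; ring. }
assert (H : has_wirtinger (fun w => - Ci * w)%C z (- Ci)%C 0).
{ eapply has_wirtinger_eq; [apply has_wirtinger_mult;
    [apply has_wirtinger_const|apply has_wirtinger_id]| |]; cbv beta; ring. }
eapply has_wirtinger_eq.
- apply has_wirtinger_mult.
  + eapply (has_wirtinger_real_comp exp _ _ _ _ _ (has_wirtinger_id z)), is_derive_exp.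
  + apply (has_wirtinger_cis_re _ _ _ _ H).
- unfold cexp; destruct z as [x y].
  replace (Re (- Ci * (x, y))%C) with y by (simpl; ring).
  apply injective_projections; simpl; field.
- unfold cexp; destruct z as [x y].
  replace (Re (- Ci * (x, y))%C) with y by (simpl; ring).
  apply injective_projections; simpl; field.
Qed.

(** The principal logarithm, as [ln |z|^2 / 2] and the angle [atan (y / x)]. *)
Definition clog (z : C) : C := (ln (Re (z * Cconj z)%C) / 2, atan (Im z / Re z)).

Lemma has_wirtinger_clog (z : C) : 0 < Re z -> has_wirtinger clog z (/ z)%C 0.
Proof.
intros Hz.
assert (Hz0 : z <> 0) by (intro K; rewrite K in Hz; simpl in Hz; lra).
assert (Hn : 0 < fst z ^ 2 + snd z ^ 2).
{ destruct z as [x y]; simpl in *; nra. }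
(* [-i (w - conj w) / (w + conj w)] is the slope [Im w / Re w]. *)
pose (sl w := (- Ci * (w + - Cconj w) * / (w + Cconj w))%C).
apply (has_wirtinger_ext (fun w => RtoC (ln (Re (w * Cconj w)%C)) * RtoC (/ 2)
   + Ci * RtoC (atan (Re (sl w))))%C).
{ intros [x y]; unfold clog, sl.
  replace (Re (- Ci * ((x, y) + - Cconj (x, y)) * / ((x, y) + Cconj (x, y)))%C) with (Im (x,
      y) / Re (x, y)).
  - apply injective_projections; simpl; field.
  - destruct (Req_dec x 0) as [->|Hx].
    + unfold Rdiv; simpl.
      replace (0 + 0) with 0 by ring; replace (y + - y) with 0 by ring.
      unfold Rdiv; replace (0 * (0 * 1) + 0 * (0 * 1)) with 0 by ring; rewrite Rinv_0; ring.
    + simpl; field; split; [nra|exact Hx]. }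
assert (Hc : has_wirtinger Cconj z 0 1).
{ eapply has_wirtinger_eq; [apply (has_wirtinger_conj _ _ _ _ (has_wirtinger_id z))| |];
    apply injective_projections; simpl; ring. }
assert (HD : (z + Cconj z)%C <> 0).
{ intro K; apply (f_equal Re) in K; destruct z; simpl in *; lra. }
eapply has_wirtinger_eq.
- apply has_wirtinger_plus.
  + apply has_wirtinger_mult; [|apply has_wirtinger_const].
    eapply (has_wirtinger_real_comp ln).
    * apply has_wirtinger_mult; [apply has_wirtinger_id|apply Hc].
    * apply is_derive_ln; destruct z as [x y]; simpl in *; nra.
  + apply has_wirtinger_mult; [apply has_wirtinger_const|].
    eapply (has_wirtinger_real_comp atan).
    * unfold sl; apply has_wirtinger_mult.
      -- apply has_wirtinger_mult; [apply has_wirtinger_const|].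
         apply has_wirtinger_plus; [apply has_wirtinger_id|].
         apply (has_wirtinger_ext (fun w => (- (1)) * Cconj w)%C); [intro; ring|].
         apply has_wirtinger_mult; [apply has_wirtinger_const|apply Hc].
      -- apply (has_wirtinger_comp Cinv); [|apply (has_wirtinger_inv _ HD)].
         apply has_wirtinger_plus; [apply has_wirtinger_id|apply Hc].
    * apply is_derive_atan.
- clear - Hz Hn; unfold sl; destruct z as [x y]; simpl in *.
  assert (P1 : 0 < x * x) by nra; assert (P2 : 0 < x * x + y * y) by nra.
  pose proof (Rmult_lt_0_compat _ _ P1 P2).
  apply injective_projections; simpl; unfold Rsqr; field; repeat split; apply Rgt_not_eq; nra.
- clear - Hz Hn; unfold sl; destruct z as [x y]; simpl in *.
  assert (P1 : 0 < x * x) by nra; assert (P2 : 0 < x * x + y * y) by nra.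
  pose proof (Rmult_lt_0_compat _ _ P1 P2).
  apply injective_projections; simpl; unfold Rsqr; field; repeat split; apply Rgt_not_eq; nra.
Qed.

Definition cpow (z : C) (s : R) : C := cexp (RtoC s * clog z)%C.

Lemma has_wirtinger_cpow (s : R) (z : C) :
  0 < Re z -> has_wirtinger (fun w => cpow w s) z (RtoC s * cpow z s * / z)%C 0.
Proof.
intros Hz; unfold cpow.
eapply has_wirtinger_eq.
- apply (has_wirtinger_comp cexp (fun w => RtoC s * clog w)%C).
  + apply has_wirtinger_mult; [apply has_wirtinger_const|apply (has_wirtinger_clog _ Hz)].
  + apply has_wirtinger_cexp.
- cbv beta; ring.
- cbv beta; ring.
Qed.

Lemma Cmod_cexp (z : C) : Cmod (cexp z) = exp (Re z).
Proof.
unfold cexp; rewrite Cmod_mult, Cmod_cis, Cmod_R, Rabs_pos_eq; [ring|].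
left; apply exp_pos.
Qed.

Lemma Cmod_cpow (z : C) (s : R) : z <> 0 -> Cmod (cpow z s) = Rpower (Cmod z) s.
Proof.
intros Hz; unfold cpow, Rpower; rewrite Cmod_cexp; f_equal.
replace (Re (RtoC s * clog z)%C) with (s * (ln (Re (z * Cconj z)%C) / 2)) by (simpl; ring).
rewrite <- Cmod2_conj; simpl Re.
replace (Cmod z * (Cmod z * 1)) with (Cmod z * Cmod z) by ring.
rewrite ln_mult by (apply Cmod_gt_0, Hz); field.
Qed.

Lemma cpow_1 (s : R) : cpow 1 s = 1.
Proof.
unfold cpow, clog, cexp; simpl.
replace (1 * 1 - 0 * -0) with 1 by ring; rewrite ln_1.
replace (0 / 1) with 0 by field; rewrite atan_0.
replace (s * (0 / 2) - 0 * 0) with 0 by field.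
replace (s * 0 + 0 * (0 / 2)) with 0 by field.
rewrite exp_0, cis_0; ring.
Qed.

Lemma cexp_plus (z w : C) : cexp (z + w)%C = (cexp z * cexp w)%C.
Proof.
unfold cexp; rewrite re_plus, im_plus, exp_plus, cis_plus, RtoC_mult; ring.
Qed.

Lemma cpow_plus (z : C) (s t : R) : cpow z (s + t) = (cpow z s * cpow z t)%C.
Proof. unfold cpow; rewrite <- cexp_plus; f_equal; rewrite RtoC_plus; ring. Qed.

Lemma cpow_conj_mult (z : C) (s : R) :
  z <> 0 -> (cpow z s * Cconj (cpow z s))%C = RtoC (Rpower (Cmod z ^ 2) s).
Proof.
intros Hz; rewrite <- Cmod2_conj, Cmod_cpow by exact Hz; f_equal.
assert (0 < Cmod z) by (apply Cmod_gt_0, Hz).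
unfold Rpower; simpl; rewrite !Rmult_1_r, <- exp_plus; f_equal.
rewrite ln_mult by assumption; ring.
Qed.

(** * Mean value inequalities *)

(** A unimodular factor [om] reduces this to the real mean value theorem for
    [Re (om * F) - Phi]. *)
Lemma wirtinger_mean_value (F : C -> C) (Phi phi : R -> R) (a b : R) :
  a <= b ->
  (forall t, a <= t <= b -> is_derive Phi t (phi t)) ->
  (forall t, a <= t <= b -> exists p q,
     has_wirtinger F (RtoC t) p q /\ Cmod (p + q)%C <= phi t) ->
  Cmod (F (RtoC b) - F (RtoC a))%C <= Phi b - Phi a.
Proof.
intros Hab HPhi HF.
destruct (Cmod_dual (F (RtoC b) - F (RtoC a))%C) as [om [Hom ->]].
pose (u t := Re (om * F (RtoC t))%C - Phi t).
assert (Hu : forall t, a <= t <= b -> exists l, is_derive u t l /\ l <= 0).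
{ intros t Ht; destruct (HF t Ht) as (p & q & Hpq & Hb).
  exists (Re (om * (p + q))%C - phi t); split.
  - apply (is_derive_minus (V := R_NormedModule)); [|apply HPhi, Ht].
    apply (is_derive_ext (fun s : R => Re (om * F (0 + RtoC s * 1)%C)%C)).
    + intro s; do 4 f_equal; ring.
    + replace (om * (p + q))%C with (om * p * 1 + om * q * Cconj 1)%C.
      * apply (has_wirtinger_is_derive_line (fun w => om * F w)%C).
        replace (0 + RtoC t * 1)%C with (RtoC t) by ring.
        eapply has_wirtinger_eq; [apply has_wirtinger_mult;
          [apply has_wirtinger_const|exact Hpq]| |]; cbv beta; ring.
      * rewrite ?(Cconj_RtoC 1); ring.
  - generalize (Re_le_Cmod (om * (p + q))%C); rewrite Cmod_mult, Hom; lra. }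
assert (Hdec : u b <= u a).
{ destruct (MVT_gen u a b (Derive u)) as [c [Hc E]].
  - rewrite Rmin_left, Rmax_right by exact Hab; intros t Ht.
    destruct (Hu t) as [l [Hl _]]; [lra|].
    apply Derive_correct; exists l; exact Hl.
  - rewrite Rmin_left, Rmax_right by exact Hab; intros t Ht.
    destruct (Hu t Ht) as [l [Hl _]].
    apply continuity_pt_filterlim, (ex_derive_continuous u); exists l; exact Hl.
  - rewrite Rmin_left, Rmax_right in Hc by exact Hab.
    destruct (Hu c Hc) as [l [Hl Hl0]].
    rewrite (is_derive_unique _ _ _ Hl) in E; nra. }
unfold u in Hdec.
replace (om * (F (RtoC b) - F (RtoC a)))%C with (om * F (RtoC b) - om * F (RtoC a))%C by ring.
unfold Cminus; rewrite re_plus, re_opp; lra.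
Qed.

(** Subtracting the first-order part at [z] leaves a function whose derivative
    along the segment is at most [2 e |w - z|]. *)
Lemma wirtinger_segment (F P Q : C -> C) (z w : C) (e : R) :
  (forall t : R, 0 <= t <= 1 ->
     let y := (z + RtoC t * (w - z))%C in
     has_wirtinger F y (P y) (Q y) /\ Cmod (P y - P z)%C <= e /\ Cmod (Q y - Q z)%C <= e) ->
  Cmod (F w - F z - P z * (w - z) - Q z * Cconj (w - z))%C <= 2 * e * Cmod (w - z)%C.
Proof.
intros H.
pose (G y := (F (z + y * (w - z)) + y * (- (P z * (w - z) + Q z * Cconj (w - z))))%C).
replace (F w - F z - P z * (w - z) - Q z * Cconj (w - z))%C with (G (RtoC 1) - G (RtoC 0))%C.
2:{ unfold G; replace (z + 1 * (w - z))%C with w by ring.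
    replace (z + 0 * (w - z))%C with z by ring; ring. }
replace (2 * e * Cmod (w - z)%C) with
  ((fun t => 2 * e * Cmod (w - z)%C * t) 1 - (fun t => 2 * e * Cmod (w - z)%C * t) 0) by (simpl;
      ring).
apply (wirtinger_mean_value G _ (fun _ => 2 * e * Cmod (w - z)%C)); [lra| |].
- intros t _; auto_derive; [exact I|ring].
- intros t Ht; destruct (H t Ht) as (HF & HP & HQ).
  set (y := (z + RtoC t * (w - z))%C) in *.
  eexists; eexists; split.
  + unfold G; apply has_wirtinger_plus.
    * apply (has_wirtinger_comp F (fun s => z + s * (w - z))%C); [|exact HF].
      apply has_wirtinger_plus; [apply has_wirtinger_const|].
      apply has_wirtinger_mult; [apply has_wirtinger_id|apply has_wirtinger_const].
    * apply has_wirtinger_mult; [apply has_wirtinger_id|apply has_wirtinger_const].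
  + cbv beta.
    match goal with |- Cmod ?c <= _ =>
      replace c with ((P y - P z) * (w - z) + (Q y - Q z) * Cconj (w - z))%C end.
    * eapply Rle_trans; [apply Cmod_triangle|].
      rewrite !Cmod_mult, Cmod_conj.
      generalize (Cmod_ge_0 (w - z)%C); nra.
    * conj_push; rewrite ?Cconj_RtoC; ring.
Qed.

(** * Means over the circle *)

Definition circle_mean (u : R -> C) : C :=
  (RtoC (/ (2 * PI)) * RInt (V := C_R_CompleteNormedModule) u 0 (2 * PI))%C.

Lemma two_PI_pos : 0 < 2 * PI.
Proof. generalize PI_RGT_0; lra. Qed.

Lemma ex_RInt_C (u : R -> C) (a b : R) :
  (forall t, ccontinuous u t) ->
  ex_RInt (V := C_R_CompleteNormedModule) u a b.
Proof. intros H; apply (ex_RInt_continuous (V := C_R_CompleteNormedModule)); intros; apply H. Qed.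

Lemma ex_RInt_R (v : R -> R) (a b : R) : (forall t, continuous v t) -> ex_RInt v a b.
Proof. intros H; apply (ex_RInt_continuous (V := R_CompleteNormedModule)); intros; apply H. Qed.

Lemma circle_mean_pair (u : R -> C) :
  (forall t, ccontinuous u t) ->
  circle_mean u = (/ (2 * PI) * RInt (fun t => Re (u t)) 0 (2 * PI),
                   / (2 * PI) * RInt (fun t => Im (u t)) 0 (2 * PI)).
Proof.
intros Hu; unfold circle_mean.
replace (RInt (V := C_R_CompleteNormedModule) u 0 (2 * PI))
  with (RInt (fun t => Re (u t)) 0 (2 * PI), RInt (fun t => Im (u t)) 0 (2 * PI)).
- apply injective_projections; simpl; ring.
- symmetry; refine (is_RInt_unique (V := C_R_CompleteNormedModule) u 0 (2 * PI) (_, _) _).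
  apply (is_RInt_fct_extend_pair (U := R_NormedModule) (V := R_NormedModule));
    apply (RInt_correct (V := R_CompleteNormedModule)), ex_RInt_R; intro t.
  + apply continuous_Re, Hu.
  + apply continuous_Im, Hu.
Qed.

Lemma circle_mean_ext (u v : R -> C) :
  (forall t, 0 <= t <= 2 * PI -> u t = v t) -> circle_mean u = circle_mean v.
Proof.
intros H; unfold circle_mean; f_equal; apply RInt_ext; intros t Ht.
rewrite Rmin_left, Rmax_right in Ht by (generalize two_PI_pos; lra).
apply H; lra.
Qed.

Lemma circle_mean_plus (u v : R -> C) :
  (forall t, ccontinuous u t) ->
  (forall t, ccontinuous v t) ->
  circle_mean (fun t => u t + v t)%C = (circle_mean u + circle_mean v)%C.
Proof.
intros Hu Hv; unfold circle_mean.
rewrite (RInt_plus (V := C_R_CompleteNormedModule) u v) by (apply ex_RInt_C; assumption).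
unfold plus; simpl.
generalize (RInt (V := C_R_CompleteNormedModule) u 0 (2 * PI)); intro a.
generalize (RInt (V := C_R_CompleteNormedModule) v 0 (2 * PI)); intro b.
change (RtoC (/ (2 * PI)) * (a + b) = RtoC (/ (2 * PI)) * a + RtoC (/ (2 * PI)) * b)%C; ring.
Qed.

Lemma RInt_circle_lin (u v : R -> R) (a b : R) :
  (forall t, continuous u t) -> (forall t, continuous v t) ->
  RInt (fun t => a * u t + b * v t) 0 (2 * PI) =
  a * RInt u 0 (2 * PI) + b * RInt v 0 (2 * PI).
Proof.
intros Hu Hv.
rewrite (RInt_plus (V := R_CompleteNormedModule) (fun t => a * u t) (fun t => b * v t)).
- unfold plus; simpl; f_equal.
  + apply (RInt_scal (V := R_CompleteNormedModule)), ex_RInt_R, Hu.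
  + apply (RInt_scal (V := R_CompleteNormedModule)), ex_RInt_R, Hv.
- apply (ex_RInt_scal (V := R_CompleteNormedModule)), ex_RInt_R, Hu.
- apply (ex_RInt_scal (V := R_CompleteNormedModule)), ex_RInt_R, Hv.
Qed.

Lemma circle_mean_scal (c : C) (u : R -> C) :
  (forall t, ccontinuous u t) ->
  circle_mean (fun t => c * u t)%C = (c * circle_mean u)%C.
Proof.
intros Hu.
rewrite !circle_mean_pair.
2: exact Hu.
2: intro t; apply continuous_Cmult; [apply continuous_const|apply Hu].
assert (HR : forall t, continuous (fun t => Re (u t)) t) by (intro; apply continuous_Re, Hu).
assert (HI : forall t, continuous (fun t => Im (u t)) t) by (intro; apply continuous_Im, Hu).
destruct c as [c1 c2].
apply injective_projections; simpl.
- rewrite (RInt_ext _ (fun t => c1 * Re (u t) + (- c2) * Im (u t))) ;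
    [|intros t _; unfold Re, Im; simpl; match goal with |- ?a = ?b => change (@eq R a b) end; ring].
  rewrite RInt_circle_lin by assumption; unfold Re, Im; ring.
- rewrite (RInt_ext _ (fun t => c1 * Im (u t) + c2 * Re (u t))) ;
    [|intros t _; unfold Re, Im; simpl; match goal with |- ?a = ?b => change (@eq R a b) end; ring].
  rewrite RInt_circle_lin by assumption; unfold Re, Im; ring.
Qed.

Lemma circle_mean_RtoC (v : R -> R) :
  (forall t, continuous v t) ->
  circle_mean (fun t => RtoC (v t)) = RtoC (/ (2 * PI) * RInt v 0 (2 * PI)).
Proof.
intros Hv; rewrite circle_mean_pair by (intro; apply continuous_RtoC, Hv).
apply injective_projections; simpl; [reflexivity|].
rewrite RInt_const; unfold scal; simpl; unfold mult; simpl; ring.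
Qed.

Lemma circle_mean_const (c : C) : circle_mean (fun _ => c) = c.
Proof.
unfold circle_mean; rewrite RInt_const, scal_R_Cmult, Rminus_0_r, Cmult_assoc, <- RtoC_mult.
rewrite Rinv_l by (generalize two_PI_pos; lra); ring.
Qed.

Lemma circle_mean_le (u : R -> C) (v : R -> R) :
  (forall t, ccontinuous u t) -> (forall t, continuous v t) ->
  (forall t, 0 <= t <= 2 * PI -> Cmod (u t) <= v t) ->
  Cmod (circle_mean u) <= Re (circle_mean (fun t => RtoC (v t))).
Proof.
intros Hu Hv H.
rewrite circle_mean_RtoC by exact Hv; unfold circle_mean; simpl.
rewrite Cmod_mult, Cmod_R, Rabs_pos_eq by (left; apply Rinv_0_lt_compat, two_PI_pos).
apply Rmult_le_compat_l; [left; apply Rinv_0_lt_compat, two_PI_pos|].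
rewrite Cmod_norm.
apply (norm_RInt_le (V := C_R_NormedModule) u v 0 (2 * PI)).
- generalize two_PI_pos; lra.
- intros t Ht; rewrite <- Cmod_norm; apply H, Ht.
- apply (RInt_correct (V := C_R_CompleteNormedModule)), ex_RInt_C, Hu.
- apply (RInt_correct (V := R_CompleteNormedModule)), ex_RInt_R, Hv.
Qed.

Lemma circle_mean_bound (u : R -> C) (B : R) :
  (forall t, ccontinuous u t) ->
  (forall t, 0 <= t <= 2 * PI -> Cmod (u t) <= B) -> Cmod (circle_mean u) <= B.
Proof.
intros Hu H.
generalize (circle_mean_le u (fun _ => B) Hu (fun t => continuous_const _ _) H).
rewrite (circle_mean_const (RtoC B)); simpl; trivial.
Qed.

(** The mean is a difference of end values; the function of a real variable is
    presented as the restriction of [F] to the real axis, so that the Wirtinger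
    rules compute its derivative [P + Q]. *)
Lemma circle_mean_derivative (F : C -> C) (P Q : R -> C) :
  (forall t : R, has_wirtinger F (RtoC t) (P t) (Q t)) ->
  (forall t : R, ccontinuous (fun t : R => P t + Q t)%C t) ->
  F (RtoC (2 * PI)) = F (RtoC 0) ->
  circle_mean (fun t => P t + Q t)%C = 0.
Proof.
intros HF HC HE.
assert (K : forall G P' Q', (forall t : R, has_wirtinger G (RtoC t) (P' t) (Q' t)) ->
  (forall t : R, continuous (fun t : R => Re (P' t + Q' t)%C) t) ->
  G (RtoC (2 * PI)) = G (RtoC 0) ->
  RInt (fun t => Re (P' t + Q' t)%C) 0 (2 * PI) = 0).
{ intros G P' Q' HG HC' HE'; apply is_RInt_unique.
  replace 0 with (minus (Re (G (RtoC (2 * PI)))) (Re (G (RtoC 0)))) at 2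
    by (rewrite HE'; unfold minus, plus, opp; simpl; ring).
  apply (is_RInt_derive (V := R_CompleteNormedModule) (fun t : R => Re (G (RtoC t)))).
  - intros t _.
    apply (is_derive_ext (fun s : R => Re (G (0 + RtoC s * 1)%C))).
    + intro s; do 2 f_equal; ring.
    + replace (P' t + Q' t)%C with (P' t * 1 + Q' t * Cconj 1)%C.
      * apply has_wirtinger_is_derive_line.
        replace (0 + RtoC t * 1)%C with (RtoC t) by ring; apply HG.
      * rewrite ?(Cconj_RtoC 1); ring.
  - intros; apply HC'. }
rewrite circle_mean_pair by exact HC.
change (RtoC 0) with (0, 0) at 1.
apply injective_projections; cbn [fst snd].
- rewrite K with (G := F) by (try assumption; intro; apply continuous_Re, HC); ring.
- rewrite (RInt_ext _ (fun t => Re (- Ci * P t + - Ci * Q t)%C)).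
  2:{ intros; simpl; unfold Re, Im; ring. }
  rewrite (K (fun w => - Ci * F w)%C (fun t => - Ci * P t)%C (fun t => - Ci * Q t)%C).
  + ring.
  + intro t; eapply has_wirtinger_eq; [apply has_wirtinger_mult;
      [apply has_wirtinger_const|apply HF]| |]; cbv beta; ring.
  + intro t; apply continuous_Re.
    apply (continuous_ext (fun t => - Ci * (P t + Q t))%C).
      { intro t'; match goal with |- ?a = ?b => change (@eq C a b) end; ring. }
    apply continuous_Cmult; [apply continuous_const|apply HC].
  + rewrite HE; reflexivity.
Qed.

Lemma circle_mean_shift (u : R -> C) (s : R) :
  (forall t, ccontinuous u t) ->
  (forall t, u (t + 2 * PI) = u t) ->
  circle_mean (fun t => u (t + s)) = circle_mean u.
Proof.
intros Hu Hp; unfold circle_mean; f_equal.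
assert (EI : forall a b, ex_RInt (V := C_R_CompleteNormedModule) u a b) by (intros;
    apply ex_RInt_C, Hu).
assert (Sh : forall c a b, RInt (V := C_R_CompleteNormedModule) (fun t => u (t + c)) a b
   = RInt (V := C_R_CompleteNormedModule) u (a + c) (b + c)).
{ intros c a b.
  generalize (RInt_comp_lin (V := C_R_CompleteNormedModule) u 1 c a b (EI _ _)).
  rewrite !Rmult_1_l; intros <-.
  apply RInt_ext; intros t _; rewrite Rmult_1_l; symmetry; apply (scal_one (K := R_Ring)). }
rewrite Sh.
generalize (RInt_Chasles (V := C_R_CompleteNormedModule) u (0 + s) (2 * PI) (2 * PI + s) (EI _ _)
    (EI _ _)).
generalize (RInt_Chasles (V := C_R_CompleteNormedModule) u 0 (0 + s) (2 * PI) (EI _ _) (EI _ _)).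
replace (RInt (V := C_R_CompleteNormedModule) u (2 * PI) (2 * PI + s))
  with (RInt (V := C_R_CompleteNormedModule) u 0 (0 + s)).
- intros <- <-; apply (plus_comm (G := C_R_NormedModule)).
- generalize (Sh (2 * PI) 0 s); rewrite !Rplus_0_l, (Rplus_comm s); intros <-.
  apply RInt_ext; intros; symmetry; apply Hp.
Qed.

(** * Averages over rotations *)

Lemma continuous_interval_bounded (u : R -> C) :
  (forall t, ccontinuous u t) ->
  exists K, 0 < K /\ forall t, 0 <= t <= 2 * PI -> Cmod (u t) <= K.
Proof.
intros Hu.
destruct (continuity_ab_maj (fun t => Cmod (u t)) 0 (2 * PI)) as [t0 [H0 _]].
- generalize two_PI_pos; lra.
- intros t _; apply continuity_pt_filterlim, (continuous_Cmod u), Hu.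
- exists (Cmod (u t0) + 1); split; [generalize (Cmod_ge_0 (u t0)); lra|].
  intros t Ht; generalize (H0 t Ht); lra.
Qed.

Lemma continuous_orbit (z : C) (t : R) :
  ccontinuous (fun t : R => (cis t * z)%C) t.
Proof. apply continuous_Cmult; [apply continuous_cis|apply continuous_const]. Qed.

Lemma disk_cis (t : R) (z : C) : disk z -> disk (cis t * z)%C.
Proof. unfold disk; rewrite Cmod_mult, Cmod_cis, Rmult_1_l; trivial. Qed.

(** Continuity is uniform in the neighbourhood of a circular orbit, by
    compactness of the interval of angles. *)
Lemma orbit_uniform_continuity (F : C -> C) (z : C) (eps : R) :
  (forall y, disk y -> ccont_at F y) -> disk z -> 0 < eps ->
  exists d, 0 < d /\ forall t w, 0 <= t <= 2 * PI -> Cmod (w - z)%C < d ->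
    Cmod (F (cis t * w) - F (cis t * z))%C < eps.
Proof.
intros HF Hz He.
assert (H : forall t0 : R, exists d : posreal, forall t w, Rabs (t - t0) < d ->
  Cmod (w - z)%C < d -> Cmod (F (cis t * w) - F (cis t * z))%C < eps).
{ intros t0.
  assert (He2 : 0 < eps / 2) by lra.
  destruct (proj1 (continuous_C_metric _ _) (HF _ (disk_cis t0 z Hz)) _ He2) as [d1 [Hd1 K1]].
  assert (Hd12 : 0 < d1 / 2) by lra.
  destruct (proj1 (continuous_R_metric _ _) (continuous_orbit z t0) _ Hd12) as [d2 [Hd2 K2]].
  assert (Hd : 0 < Rmin d2 (d1 / 2)) by (apply Rmin_glb_lt; assumption).
  exists (mkposreal _ Hd); simpl; intros t w Ht Hw.
  assert (Ht2 : Rabs (t - t0) < d2) by (eapply Rlt_le_trans; [exact Ht|apply Rmin_l]).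
  assert (Hw2 : Cmod (w - z)%C < d1 / 2) by (eapply Rlt_le_trans; [exact Hw|apply Rmin_r]).
  specialize (K2 t Ht2).
  assert (A1 : Cmod (F (cis t * z)%C - F (cis t0 * z)%C)%C < eps / 2) by (apply K1; lra).
  assert (A2 : Cmod (F (cis t * w)%C - F (cis t0 * z)%C)%C < eps / 2).
  { apply K1.
    replace (cis t * w - cis t0 * z)%C with (cis t * (w - z) + (cis t * z - cis t0 * z))%C by ring.
    eapply Rle_lt_trans; [apply Cmod_triangle|].
    rewrite Cmod_mult, Cmod_cis; lra. }
  replace (F (cis t * w)%C - F (cis t * z)%C)%C with
    ((F (cis t * w)%C - F (cis t0 * z)%C) + - (F (cis t * z)%C - F (cis t0 * z)%C))%C by ring.
  eapply Rle_lt_trans; [apply Cmod_triangle|]; rewrite Cmod_opp; lra. }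
destruct (functional_choice _ H) as [delta Hdelta].
destruct (compactness_value_1d 0 (2 * PI) delta) as [d Hd].
exists d; split; [apply cond_pos|]; intros t w Ht Hw.
destruct (NNPP _ (Hd t Ht)) as [t0 [_ [H1 H2]]].
apply (Hdelta t0); [exact H1|lra].
Qed.

(** With the weight [cis (- k t)] and at a real point [r], this is the [k]-th
    Fourier coefficient of [F] on the circle of radius [r]; with a nonnegative
    trigonometric weight it is a smoothing of [F] that commutes with rotations. *)
Definition rot_avg (psi : R -> C) (F : C -> C) (z : C) : C :=
  circle_mean (fun t => psi t * F (cis t * z)%C)%C.

Definition C1_wirtinger (F P Q : C -> C) : Prop :=
  forall z, disk z -> has_wirtinger F z (P z) (Q z) /\ ccont_at P z /\ ccont_at Q z.

Lemma rot_avg_integrand_continuous (psi : R -> C) (F : C -> C) (z : C) :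
  (forall t, ccontinuous psi t) ->
  (forall y, disk y -> ccont_at F y) -> disk z ->
  forall t, ccontinuous (fun t : R => psi t * F (cis t * z)%C)%C t.
Proof.
intros Hpsi HF Hz t; apply continuous_Cmult; [apply Hpsi|].
apply (ccontinuous_comp (fun t => cis t * z)%C F); [apply continuous_orbit|].
apply HF, disk_cis, Hz.
Qed.

Lemma circle_mean_minus (u v : R -> C) :
  (forall t, ccontinuous u t) ->
  (forall t, ccontinuous v t) ->
  circle_mean (fun t => u t - v t)%C = (circle_mean u - circle_mean v)%C.
Proof.
intros Hu Hv.
rewrite (circle_mean_ext _ (fun t => u t + (- (1)) * v t)%C) by (intros; ring).
rewrite circle_mean_plus, circle_mean_scal; try assumption.
- ring.
- intro t; apply continuous_Cmult; [apply continuous_const|apply Hv].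
Qed.

Lemma disk_neighbourhood (z : C) : disk z ->
  forall w, Cmod (w - z)%C < 1 - Cmod z -> disk w.
Proof.
intros Hz w Hw; unfold disk.
replace w with ((w - z) + z)%C by ring.
eapply Rle_lt_trans; [apply Cmod_triangle|]; lra.
Qed.

Lemma rot_avg_continuous (psi : R -> C) (F : C -> C) (z : C) :
  (forall t, ccontinuous psi t) ->
  (forall y, disk y -> ccont_at F y) -> disk z -> ccont_at (rot_avg psi F) z.
Proof.
intros Hpsi HF Hz.
destruct (continuous_interval_bounded psi Hpsi) as [K [HK0 HK]].
apply continuous_C_metric; intros eps He.
assert (He2 : 0 < eps / (2 * K)) by (apply Rdiv_lt_0_compat; lra).
destruct (orbit_uniform_continuity F z _ HF Hz He2) as [d [Hd H]].
exists (Rmin d (1 - Cmod z)); split; [apply Rmin_glb_lt; [exact Hd|unfold disk in Hz; lra]|].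
intros w Hw.
assert (Hw1 : Cmod (w - z)%C < d) by (eapply Rlt_le_trans; [exact Hw|apply Rmin_l]).
assert (Hw2 : disk w).
{ apply (disk_neighbourhood z Hz); eapply Rlt_le_trans; [exact Hw|apply Rmin_r]. }
unfold rot_avg.
rewrite <- circle_mean_minus by (apply rot_avg_integrand_continuous; assumption).
apply Rle_lt_trans with (eps / 2); [|lra].
apply circle_mean_bound.
- intro t; apply continuous_Cminus; apply rot_avg_integrand_continuous; assumption.
- intros t Ht.
  replace (psi t * F (cis t * w) - psi t * F (cis t * z))%C
    with (psi t * (F (cis t * w) - F (cis t * z)))%C by ring.
  rewrite Cmod_mult; specialize (H t w Ht Hw1); specialize (HK t Ht).
  replace (eps / 2) with (K * (eps / (2 * K))) by (field; lra).
  apply Rmult_le_compat; try apply Cmod_ge_0; lra.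
Qed.

(** Differentiation under the mean: each rotated copy of [F] has a first-order
    expansion at [z], uniformly in the angle. *)
Lemma rot_avg_C1 (psi : R -> C) (F P Q : C -> C) :
  (forall t, ccontinuous psi t) ->
  C1_wirtinger F P Q ->
  C1_wirtinger (rot_avg psi F) (rot_avg (fun t => psi t * cis t)%C P)
    (rot_avg (fun t => psi t * Cconj (cis t))%C Q).
Proof.
intros Hpsi HF.
assert (CF : forall y, disk y -> ccont_at F y)
  by (intros y Hy; apply (has_wirtinger_continuous _ _ _ _ (proj1 (HF y Hy)))).
assert (CP : forall y, disk y -> ccont_at P y)
  by (intros y Hy; exact (proj1 (proj2 (HF y Hy)))).
assert (CQ : forall y, disk y -> ccont_at Q y)
  by (intros y Hy; exact (proj2 (proj2 (HF y Hy)))).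
assert (Hpsi1 : forall t, ccontinuous (fun t : R => psi t * cis t)%C t)
  by (intro; ccont).
assert (Hpsi2 : forall t, ccontinuous (fun t : R => psi t * Cconj (cis t))%C t)
  by (intro; ccont).
intros z Hz; split; [|split; apply rot_avg_continuous; assumption].
destruct (continuous_interval_bounded psi Hpsi) as [K [HK0 HK]].
apply has_wirtinger_of_remainder; intros eps He.
assert (He2 : 0 < eps / (2 * K)) by (apply Rdiv_lt_0_compat; lra).
destruct (orbit_uniform_continuity P z _ CP Hz He2) as [d1 [Hd1 H1]].
destruct (orbit_uniform_continuity Q z _ CQ Hz He2) as [d2 [Hd2 H2]].
exists (Rmin (Rmin d1 d2) (1 - Cmod z)); split.
{ repeat apply Rmin_glb_lt; [exact Hd1|exact Hd2|unfold disk in Hz; lra]. }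
intros w Hw.
assert (Hw0 : Cmod (w - z)%C < Rmin d1 d2) by (eapply Rlt_le_trans; [exact Hw|apply Rmin_l]).
assert (Hw1 : Cmod (w - z)%C < d1) by (eapply Rlt_le_trans; [exact Hw0|apply Rmin_l]).
assert (Hw2 : Cmod (w - z)%C < d2) by (eapply Rlt_le_trans; [exact Hw0|apply Rmin_r]).
assert (Hw3 : Cmod (w - z)%C < 1 - Cmod z) by (eapply Rlt_le_trans; [exact Hw|apply Rmin_r]).
pose proof (disk_neighbourhood z Hz w Hw3) as Dw.
pose (u1 := fun t => (psi t * F (cis t * w))%C); pose (u2 := fun t => (psi t * F (cis t * z))%C).
pose (u3 := fun t => (psi t * cis t * P (cis t * z))%C).
pose (u4 := fun t => (psi t * Cconj (cis t) * Q (cis t * z))%C).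
assert (C1 : forall t, ccontinuous u1 t) by (apply rot_avg_integrand_continuous; assumption).
assert (C2 : forall t, ccontinuous u2 t) by (apply rot_avg_integrand_continuous; assumption).
assert (C3 : forall t, ccontinuous u3 t)
  by (apply (rot_avg_integrand_continuous (fun t => psi t * cis t)%C); assumption).
assert (C4 : forall t, ccontinuous u4 t)
  by (apply (rot_avg_integrand_continuous (fun t => psi t * Cconj (cis t))%C); assumption).
assert (C3' : forall t, ccontinuous (fun t : R => (w - z) * u3 t)%C t)
  by (intro; ccont).
assert (C4' : forall t, ccontinuous (fun t : R => Cconj (w - z) * u4 t)%C t)
  by (intro; ccont).
assert (C12 : forall t, ccontinuous (fun t : R => u1 t - u2 t)%C t)
  by (intro; ccont).
assert (C123 : forall t, ccontinuous (fun t : R => u1 t - u2 t - (w - z) * u3 t)%C t)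
  by (intro; ccont).
assert (E : (rot_avg psi F w - rot_avg psi F z -
     rot_avg (fun t => (psi t * cis t)%C) P z * (w - z) -
     rot_avg (fun t => (psi t * Cconj (cis t))%C) Q z * Cconj (w - z))%C =
   circle_mean (fun t => u1 t - u2 t - (w - z) * u3 t - Cconj (w - z) * u4 t)%C).
{ rewrite (circle_mean_minus (fun t => u1 t - u2 t - (w - z) * u3 t)%C _ C123 C4').
  rewrite (circle_mean_minus (fun t => u1 t - u2 t)%C _ C12 C3').
  rewrite (circle_mean_minus _ _ C1 C2).
  rewrite (circle_mean_scal (w - z)%C _ C3), (circle_mean_scal (Cconj (w - z)%C) _ C4).
  unfold rot_avg, u1, u2, u3, u4; ring. }
rewrite E; apply circle_mean_bound.
{ intro t; apply continuous_Cminus; [apply C123|apply C4']. }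
intros t Ht; unfold u1, u2, u3, u4.
pose proof (wirtinger_segment F P Q (cis t * z)%C (cis t * w)%C (eps / (2 * K))) as SG.
replace (cis t * w - cis t * z)%C with (cis t * (w - z))%C in SG by ring.
rewrite Cmod_mult, Cmod_cis, Rmult_1_l, Cmult_conj in SG.
replace (psi t * F (cis t * w) - psi t * F (cis t * z) -
   (w - z) * (psi t * cis t * P (cis t * z)) -
   Cconj (w - z) * (psi t * Cconj (cis t) * Q (cis t * z)))%C with
  (psi t * (F (cis t * w)%C - F (cis t * z)%C - P (cis t * z)%C * (cis t * (w - z)) -
     Q (cis t * z)%C * (Cconj (cis t) * Cconj (w - z))))%C by ring.
rewrite Cmod_mult.
replace (eps * Cmod (w - z)%C) with (K * (2 * (eps / (2 * K)) * Cmod (w - z)%C)) by (field; lra).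
apply Rmult_le_compat; try apply Cmod_ge_0; [apply HK, Ht|].
apply SG; intros s Hs.
replace (cis t * z + RtoC s * (cis t * (w - z)))%C with (cis t * (z + RtoC s * (w - z)))%C by ring.
assert (Hy : Cmod (z + RtoC s * (w - z) - z)%C <= Cmod (w - z)%C).
{ replace (z + RtoC s * (w - z) - z)%C with (RtoC s * (w - z))%C by ring.
  rewrite Cmod_mult, Cmod_R, Rabs_pos_eq by lra.
  generalize (Cmod_ge_0 (w - z)%C); nra. }
cbv zeta; split; [|split].
- apply HF, disk_cis, (disk_neighbourhood z Hz); lra.
- left; apply H1; [exact Ht|lra].
- left; apply H2; [exact Ht|lra].
Qed.

(** * Fourier coefficients along circles *)

(** The frequency is kept real; integrality enters as [cis (2 * PI * k) = 1]. *)
Definition fcoef (k : R) (F : C -> C) : C -> C := rot_avg (fun t => cis (- (k * t))) F.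

Lemma continuous_cis_lin (k t : R) :
  ccontinuous (fun t : R => cis (- (k * t))) t.
Proof.
apply (continuous_comp (fun t => - (k * t)) cis); [|apply continuous_cis].
apply (continuous_opp (V := R_NormedModule)), (continuous_scal_r (V := R_NormedModule) k).
apply continuous_id.
Qed.

(** Rotating [F] by [cis t] multiplies its two derivatives by [cis t] and its
    conjugate, which shifts the frequency by one. *)
Lemma C1_wirtinger_fcoef (k : R) (F P Q : C -> C) :
  C1_wirtinger F P Q ->
  C1_wirtinger (fcoef k F) (fcoef (k - 1) P) (fcoef (k + 1) Q).
Proof.
intros HF z Hz.
destruct (rot_avg_C1 _ F P Q (continuous_cis_lin k) HF z Hz) as (H & HP & HQ).
assert (EP : forall y, rot_avg (fun t => cis (- (k * t)) * cis t)%C P y = fcoef (k - 1) P y).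
{ intro y; apply circle_mean_ext; intros t _; rewrite <- cis_plus; do 2 f_equal; ring. }
assert (EQ : forall y, rot_avg (fun t => cis (- (k * t)) * Cconj (cis t))%C Q y = fcoef (k + 1) Q
    y).
{ intro y; apply circle_mean_ext; intros t _; rewrite <- cis_opp, <- cis_plus; do 2 f_equal; ring. }
split; [|split].
- rewrite <- EP, <- EQ; exact H.
- apply (continuous_ext _ _ _ EP HP).
- apply (continuous_ext _ _ _ EQ HQ).
Qed.

Lemma cexp_i (t : R) : cexp (Ci * RtoC t)%C = cis t.
Proof.
unfold cexp; replace (Re (Ci * RtoC t)%C) with 0 by (simpl; ring).
replace (Im (Ci * RtoC t)%C) with t by (simpl; ring).
rewrite exp_0; ring.
Qed.

(** The angular derivative of [cis (- k t) * F (cis t * z)] has mean zero. With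
    [C1_wirtinger_fcoef], which gives the radial derivative, this yields the
    ordinary differential equations for the Fourier coefficients. *)
Lemma fcoef_angular (k : R) (F P Q : C -> C) (z : C) :
  C1_wirtinger F P Q -> cis (2 * PI * k) = 1 -> disk z ->
  (RtoC k * fcoef k F z = z * fcoef (k - 1) P z - Cconj z * fcoef (k + 1) Q z)%C.
Proof.
intros HF Hk Hz.
assert (CF : forall y, disk y -> ccont_at F y)
  by (intros y Hy; apply (has_wirtinger_continuous _ _ _ _ (proj1 (HF y Hy)))).
assert (CP : forall y, disk y -> ccont_at P y)
  by (intros y Hy; exact (proj1 (proj2 (HF y Hy)))).
assert (CQ : forall y, disk y -> ccont_at Q y)
  by (intros y Hy; exact (proj2 (proj2 (HF y Hy)))).
pose (u1 := fun t => (cis (- (k * t)) * F (cis t * z))%C).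
pose (u2 := fun t => (cis (- ((k - 1) * t)) * P (cis t * z))%C).
pose (u3 := fun t => (cis (- ((k + 1) * t)) * Q (cis t * z))%C).
assert (C1 : forall t, ccontinuous u1 t)
  by (apply rot_avg_integrand_continuous; [apply continuous_cis_lin|assumption|assumption]).
assert (C2 : forall t, ccontinuous u2 t)
  by (apply rot_avg_integrand_continuous; [apply continuous_cis_lin|assumption|assumption]).
assert (C3 : forall t, ccontinuous u3 t)
  by (apply rot_avg_integrand_continuous; [apply continuous_cis_lin|assumption|assumption]).
assert (C1' : forall t, ccontinuous (fun t : R => (- (Ci * RtoC k)) * u1 t)%C t)
  by (intro; ccont).
assert (C2' : forall t, ccontinuous (fun t : R => (Ci * z) * u2 t)%C t)
  by (intro; ccont).
assert (C3' : forall t, ccontinuous (fun t : R => (- (Ci * Cconj z)) * u3 t)%C t)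
  by (intro; ccont).
assert (C12 : forall t, ccontinuous
   (fun t : R => (- (Ci * RtoC k)) * u1 t + (Ci * z) * u2 t)%C t)
  by (intro; ccont).
assert (M : circle_mean (fun t => ((- (Ci * RtoC k)) * u1 t + (Ci * z) * u2 t)
    + (- (Ci * Cconj z)) * u3 t)%C = 0).
{ apply (circle_mean_derivative (fun s => cexp (Ci * (RtoC (- k) * s)) * F (cexp (Ci * s) * z))%C
    (fun t => (- (Ci * RtoC k)) * u1 t + (Ci * z) * u2 t)%C (fun t => (- (Ci * Cconj z)) * u3 t)%C).
  - intro t.
    assert (E1 : cexp (Ci * (RtoC (- k) * RtoC t))%C = cis (- (k * t))).
    { rewrite <- RtoC_mult, cexp_i; f_equal; ring. }
    eapply has_wirtinger_eq.
    + apply has_wirtinger_mult.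
      * apply (has_wirtinger_comp cexp (fun s => Ci * (RtoC (- k) * s))%C);
          [|apply has_wirtinger_cexp].
        apply has_wirtinger_mult; [apply has_wirtinger_const|].
        apply has_wirtinger_mult; [apply has_wirtinger_const|apply has_wirtinger_id].
      * apply (has_wirtinger_comp F (fun s => cexp (Ci * s) * z)%C).
        -- apply has_wirtinger_mult; [|apply has_wirtinger_const].
           apply (has_wirtinger_comp cexp (fun s => Ci * s)%C); [|apply has_wirtinger_cexp].
           apply has_wirtinger_mult; [apply has_wirtinger_const|apply has_wirtinger_id].
        -- rewrite cexp_i; apply HF, disk_cis, Hz.
    + cbv beta; rewrite E1, !cexp_i; unfold u1, u2, u3.
      replace (- ((k - 1) * t)) with (- (k * t) + t) by ring.
      rewrite cis_plus, RtoC_opp; conj_push.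
      rewrite ?(Cconj_RtoC 0).
      ring.
    + cbv beta; rewrite E1, !cexp_i; unfold u1, u2, u3.
      replace (- ((k + 1) * t)) with (- (k * t) + - t) by ring.
      rewrite cis_plus; generalize (cis (- (k * t))); intro c; rewrite cis_opp; conj_push.
      rewrite ?(Cconj_RtoC 0).
      rewrite ?(Cconj_RtoC 1).
      rewrite Cconj_Ci.
      ring.
  - intro t; apply continuous_Cplus; [apply C12|apply C3'].
  - cbv beta.
    replace (Ci * (RtoC (- k) * RtoC (2 * PI)))%C with (Ci * RtoC (- (2 * PI * k)))%C
      by (rewrite <- RtoC_mult; do 2 f_equal; ring).
    replace (Ci * (RtoC (- k) * RtoC 0))%C with (Ci * RtoC 0)%C by ring.
    rewrite !cexp_i, cis_opp, Hk, cis_0.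
    replace (cis (2 * PI)) with (cis 0) by (unfold cis; rewrite cos_0, sin_0, cos_2PI, sin_2PI;
        reflexivity).
    rewrite cis_0; f_equal; apply injective_projections; simpl; ring. }
rewrite (circle_mean_plus _ _ C12 C3'), (circle_mean_plus _ _ C1' C2') in M.
rewrite (circle_mean_scal _ u1 C1), (circle_mean_scal _ u2 C2), (circle_mean_scal _ u3 C3) in M.
change (circle_mean u1) with (fcoef k F z) in M.
change (circle_mean u2) with (fcoef (k - 1) P z) in M.
change (circle_mean u3) with (fcoef (k + 1) Q z) in M.
apply Ceq_minus.
match goal with |- ?c = _ => replace c with (Ci * (- (Ci * RtoC k) * fcoef k F z + Ci * z * fcoef
    (k - 1) P z +
     - (Ci * Cconj z) * fcoef (k + 1) Q z))%C end.
- rewrite M; ring.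
- transitivity (Ci * (Ci * (- RtoC k * fcoef k F z + z * fcoef (k - 1) P z - Cconj z * fcoef (k +
    1) Q z)))%C;
    [ring|rewrite Ci_sqr; ring].
Qed.

Lemma C1_wirtinger_const (c : C) : C1_wirtinger (fun _ => c) (fun _ => RtoC 0) (fun _ => RtoC 0).
Proof.
intros z _; split; [apply has_wirtinger_const|split; apply continuous_const].
Qed.

(** Only the value of [F] at the origin matters, so [F] may be taken constant. *)
Lemma fcoef_origin (k : R) (F : C -> C) :
  k <> 0 -> cis (2 * PI * k) = 1 -> fcoef k F 0 = 0.
Proof.
intros Hk0 Hk.
assert (D0 : disk 0) by (unfold disk; rewrite Cmod_0; lra).
pose proof (fcoef_angular k _ _ _ 0 (C1_wirtinger_const (F 0)) Hk D0) as H.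
replace (fcoef k F 0) with (fcoef k (fun _ => F 0) 0).
2:{ apply circle_mean_ext; intros t _; f_equal; f_equal; ring. }
rewrite (Cconj_RtoC 0) in H.
assert (Hk1 : RtoC k <> 0) by (intro K; apply Hk0, RtoC_inj, K).
replace (fcoef k (fun _ => F 0) 0) with (/ RtoC k * (RtoC k * fcoef k (fun _ => F 0%C) 0))%C
  by (field; exact Hk1).
rewrite H; ring.
Qed.

Lemma fcoef_0_origin (F : C -> C) : fcoef 0 F 0 = F 0.
Proof.
unfold fcoef, rot_avg; rewrite <- (circle_mean_const (F 0)); apply circle_mean_ext.
intros t _; replace (- (0 * t)) with 0 by ring; rewrite cis_0, Cmult_0_r; ring.
Qed.

Lemma fcoef_bound (k B : R) (F : C -> C) (z : C) :
  (forall y, disk y -> ccont_at F y) -> disk z ->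
  (forall y, Cmod y = Cmod z -> Cmod (F y) <= B) -> Cmod (fcoef k F z) <= B.
Proof.
intros CF Hz H; apply circle_mean_bound.
- apply rot_avg_integrand_continuous; [apply continuous_cis_lin|assumption|assumption].
- intros t _; rewrite Cmod_mult, Cmod_cis, Rmult_1_l; apply H.
  rewrite Cmod_mult, Cmod_cis; ring.
Qed.

(** * A Poisson-type mean *)

Lemma C1_wirtinger_continuous (F P Q : C -> C) :
  C1_wirtinger F P Q -> forall y, disk y -> ccont_at F y.
Proof. intros HF y Hy; exact (has_wirtinger_continuous _ _ _ _ (proj1 (HF y Hy))). Qed.

Lemma disk_RtoC (r : R) : 0 <= r < 1 -> disk (RtoC r).
Proof. intros; unfold disk; rewrite Cmod_RtoC_pos; lra. Qed.

Lemma cis_period (k : R) : k = 0 \/ k = 1 \/ k = -1 \/ k = 2 -> cis (2 * PI * k) = 1.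
Proof.
assert (E : cis (2 * PI) = 1) by (unfold cis; rewrite cos_2PI, sin_2PI; reflexivity).
intros [->|[->|[->| ->]]].
- rewrite Rmult_0_r; apply cis_0.
- rewrite Rmult_1_r; exact E.
- replace (2 * PI * -1) with (- (2 * PI)) by ring; rewrite cis_opp, E; apply Cconj_RtoC.
- replace (2 * PI * 2) with (2 * PI + 2 * PI) by ring; rewrite cis_plus, E; ring.
Qed.

Lemma circle_mean_conj (u : R -> C) :
  (forall t, ccontinuous u t) ->
  circle_mean (fun t => Cconj (u t)) = Cconj (circle_mean u).
Proof.
intros Hu; rewrite !circle_mean_pair; [|exact Hu|intro t; apply continuous_Cconj, Hu].
apply injective_projections; cbn [fst snd Cconj]; [reflexivity|].
rewrite (RInt_ext (fun t => Im (Cconj (u t))) (fun t => (-1) * Im (u t) + 0 * Im (u t))).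
- rewrite RInt_circle_lin; [ring| |]; intro; apply continuous_Im, Hu.
- intros t _; match goal with |- ?a = ?b => change (@eq R a b) end; simpl; unfold Im; ring.
Qed.

Lemma circle_mean_0 : circle_mean (fun _ => RtoC 0) = 0.
Proof. apply (circle_mean_const 0). Qed.

Lemma fcoef_zero (k : R) (z : C) : fcoef k (fun _ => RtoC 0) z = 0.
Proof.
transitivity (circle_mean (fun _ => RtoC 0)); [|apply circle_mean_0].
apply circle_mean_ext; intros; apply Cmult_0_r.
Qed.

(** The mean value property: by [fcoef_angular] with [k = 0] the radial
    derivative of the circular mean vanishes. *)
Lemma fcoef_0_holomorphic (F P : C -> C) (r : R) :
  C1_wirtinger F P (fun _ => RtoC 0) -> 0 <= r < 1 -> fcoef 0 F (RtoC r) = F 0.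
Proof.
intros HF Hr.
pose proof (C1_wirtinger_fcoef 0 F P _ HF) as HA.
assert (Z1 : forall z, fcoef (0 + 1) (fun _ => RtoC 0) z = 0) by (intro; apply fcoef_zero).
assert (E : Cmod (fcoef 0 F (RtoC r) - fcoef 0 F (RtoC 0))%C <= 0 - 0).
{ apply (wirtinger_mean_value (fcoef 0 F) (fun _ => 0) (fun _ => 0)); [lra| |].
  - intros; auto_derive; trivial.
  - intros t Ht; eexists; eexists; split; [apply (HA (RtoC t)), disk_RtoC; lra|].
    rewrite Z1.
    assert (Z2 : fcoef (0 - 1) P (RtoC t) = 0).
    { destruct (Req_dec t 0) as [->|Ht0].
      - apply fcoef_origin; [lra|apply cis_period; right; right; left; ring].
      - pose proof (fcoef_angular 0 F P _ (RtoC t) HF) as K.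
        rewrite Z1 in K.
        assert (Ht1 : RtoC t <> 0) by (intro K'; apply Ht0, RtoC_inj, K').
        replace (fcoef (0 - 1) P (RtoC t)) with (/ RtoC t * (RtoC t * fcoef (0 - 1) P (RtoC t) -
            Cconj (RtoC t) * 0))%C
          by (field; exact Ht1).
        rewrite <- K; [ring| |apply disk_RtoC; lra].
        apply cis_period; left; reflexivity. }
    rewrite Z2, Cplus_0_r, Cmod_0; lra. }
rewrite fcoef_0_origin in E.
apply Ceq_minus, Cmod_eq_0.
generalize (Cmod_ge_0 (fcoef 0 F (RtoC r) - F (RtoC 0))%C); lra.
Qed.

Lemma Re_1_plus_pos (a z : C) : disk a -> Cmod z <= 1 -> 0 < Re (1 + Cconj a * z)%C.
Proof.
intros Ha Hz.
assert (K : Cmod (Cconj a * z)%C < 1).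
{ rewrite Cmod_mult, Cmod_conj; unfold disk in Ha.
  generalize (Cmod_ge_0 a) (Cmod_ge_0 z); nra. }
rewrite re_plus, re_RtoC.
generalize (Re_le_Cmod (- (Cconj a * z))%C); rewrite Cmod_opp, re_opp; lra.
Qed.

Lemma one_plus_neq_0 (a z : C) : disk a -> Cmod z <= 1 -> (1 + Cconj a * z)%C <> 0.
Proof.
intros Ha Hz K; generalize (Re_1_plus_pos a z Ha Hz); rewrite K; simpl; lra.
Qed.

Lemma has_wirtinger_one_plus (a z : C) : has_wirtinger (fun w => 1 + Cconj a * w)%C z (Cconj a) 0.
Proof.
eapply has_wirtinger_eq.
- apply has_wirtinger_plus; [apply has_wirtinger_const|].
  apply has_wirtinger_mult; [apply has_wirtinger_const|apply has_wirtinger_id].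
- cbv beta; ring.
- cbv beta; ring.
Qed.

Lemma C1_wirtinger_inv_one_plus (a : C) : disk a ->
  C1_wirtinger (fun z => / (1 + Cconj a * z))%C
    (fun z => - Cconj a * (/ (1 + Cconj a * z) * / (1 + Cconj a * z)))%C (fun _ => RtoC 0).
Proof.
intros Ha z Hz.
pose proof (one_plus_neq_0 a z Ha (Rlt_le _ _ Hz)) as N.
split; [|split].
- eapply has_wirtinger_eq.
  + apply (has_wirtinger_comp Cinv); [apply has_wirtinger_one_plus|apply (has_wirtinger_inv _ N)].
  + cbv beta; ring.
  + cbv beta; ring.
- assert (ccont_at (fun z => / (1 + Cconj a * z))%C z).
  { apply continuous_Cinv; [|exact N]; ccont. }
  apply continuous_Cmult; [apply continuous_const|apply continuous_Cmult; assumption].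
- apply continuous_const.
Qed.

(** The mean of [1 / |1 + w|^4] over [|w|^2 = q]. With [s = 1 / (1 + w)] and
    [T = w / (1 + w)^2], both holomorphic in [w], the integrand is a real linear
    combination of [s], [T], their conjugates and [1], so the mean value
    property evaluates it. *)
Lemma mean_inv_one_plus_4 (a : C) (r : R) : disk a -> 0 <= r < 1 ->
  circle_mean (fun t => RtoC (/ Cmod (1 + Cconj a * (cis t * RtoC r))%C ^ 4)) =
  RtoC ((1 + Cmod a ^ 2 * r ^ 2) / (1 - Cmod a ^ 2 * r ^ 2) ^ 3).
Proof.
intros Ha Hr.
set (q := Cmod a ^ 2 * r ^ 2).
assert (Hq : 0 <= q < 1).
{ unfold q; unfold disk in Ha; generalize (Cmod_ge_0 a); intro.
  assert (0 <= Cmod a ^ 2 < 1) by (simpl; nra). assert (0 <= r ^ 2 < 1) by (simpl; nra). nra. }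
pose proof (C1_wirtinger_inv_one_plus a Ha) as HS.
set (S := fun z : C => (/ (1 + Cconj a * z))%C) in *.
set (P := fun z : C => (- Cconj a * (/ (1 + Cconj a * z) * / (1 + Cconj a * z)))%C) in *.
pose proof (C1_wirtinger_continuous _ _ _ HS) as CS.
assert (CP : forall y, disk y -> ccont_at P y) by (intros y Hy; exact (proj1 (proj2 (HS y Hy)))).
pose proof (disk_RtoC r Hr) as Dr.
assert (MS : fcoef 0 S (RtoC r) = 1).
{ rewrite (fcoef_0_holomorphic S P r HS Hr); unfold S.
  replace (1 + Cconj a * 0)%C with (RtoC 1) by ring; field. }
assert (MT : (RtoC r * fcoef (0 - 1) P (RtoC r))%C = 0).
{ pose proof (fcoef_angular 0 S P _ (RtoC r) HS (cis_period 0 (or_introl eq_refl)) Dr) as K.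
  rewrite Cmult_0_l in K.
  replace (fcoef (0 + 1) (fun _ => RtoC 0) (RtoC r)) with (RtoC 0) in K.
  - replace (RtoC r * fcoef (0 - 1) P (RtoC r))%C with
     (RtoC r * fcoef (0 - 1) P (RtoC r) - Cconj (RtoC r) * 0)%C by ring.
    symmetry; exact K.
  - symmetry; apply fcoef_zero. }
pose (us := fun t : R => (cis (- (0 * t)) * S (cis t * RtoC r))%C).
pose (uT := fun t : R => (cis (- ((0 - 1) * t)) * P (cis t * RtoC r))%C).
assert (Cs : forall t, ccontinuous us t)
  by (apply rot_avg_integrand_continuous; [apply continuous_cis_lin|assumption|assumption]).
assert (CT : forall t, ccontinuous uT t)
  by (apply rot_avg_integrand_continuous; [apply continuous_cis_lin|assumption|assumption]).
change (fcoef 0 S (RtoC r)) with (circle_mean us) in MS.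
change (fcoef (0 - 1) P (RtoC r)) with (circle_mean uT) in MT.
pose (c1 := RtoC ((1 + q) / (1 - q) ^ 3)); pose (c2 := RtoC (1 / (1 - q) ^ 2 * r)).
rewrite (circle_mean_ext _ (fun t => c1 * us t + (c1 * Cconj (us t) + (- c1 + (c2 * uT t + c2 *
    Cconj (uT t)))))%C).
2:{ intros t _; unfold us, uT.
    replace (- (0 * t)) with 0 by ring; replace (- ((0 - 1) * t)) with t by ring.
    rewrite cis_0, Cmult_1_l.
    assert (Hz : Cmod (cis t * RtoC r)%C <= 1) by (rewrite Cmod_mult, Cmod_cis, Cmod_RtoC_pos; lra).
    pose proof (one_plus_neq_0 a _ Ha Hz) as N.
    unfold P, S; set (w := (Cconj a * (cis t * RtoC r))%C) in *.
    assert (Ew : (w * Cconj w)%C = RtoC q).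
    { unfold w; rewrite <- Cmod2_conj, !Cmod_mult, Cmod_conj, Cmod_cis, Cmod_RtoC_pos by lra.
      unfold q; f_equal; ring. }
    assert (Nc : (1 + Cconj w)%C <> 0).
    { intro K; apply N; rewrite <- (Cconj_conj (1 + w)%C), Cplus_conj, Cconj_RtoC, K;
        apply Cconj_RtoC. }
    assert (E4 : RtoC (/ Cmod (1 + w)%C ^ 4) = (/ ((1 + w) * (1 + Cconj w) * ((1 + w) * (1 + Cconj
        w))))%C).
    { replace (1 + Cconj w)%C with (Cconj (1 + w)%C) by (rewrite Cplus_conj, Cconj_RtoC;
        reflexivity).
      rewrite <- Cmod2_conj, <- RtoC_mult, <- RtoC_inv.
      - apply (f_equal RtoC), f_equal; ring.
      - apply Rgt_not_eq; assert (0 < Cmod (1 + w)%C) by (apply Cmod_gt_0, N).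
        repeat apply Rmult_lt_0_compat; lra. }
    rewrite E4.
    assert (Nq : (1 - w * Cconj w)%C <> 0).
    { rewrite Ew, <- RtoC_minus; intro K; apply RtoC_inj in K; lra. }
    assert (Ec1 : c1 = ((1 + w * Cconj w) / ((1 - w * Cconj w) * (1 - w * Cconj w) * (1 - w * Cconj
        w)))%C).
    { unfold c1; rewrite Ew, <- RtoC_plus, <- RtoC_minus, <- !RtoC_mult, <- RtoC_div.
      - apply (f_equal RtoC), f_equal; ring.
      - assert (0 < 1 - q) by lra; apply Rgt_not_eq; apply Rmult_lt_0_compat;
          [apply Rmult_lt_0_compat|]; lra. }
    assert (Ec2 : c2 = (/ ((1 - w * Cconj w) * (1 - w * Cconj w)) * RtoC r)%C).
    { unfold c2; rewrite Ew, <- RtoC_minus, <- !RtoC_mult, <- RtoC_inv, <- RtoC_mult.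
      - apply (f_equal RtoC); field; lra.
      - assert (0 < 1 - q) by lra; apply Rgt_not_eq; apply Rmult_lt_0_compat; lra. }
    replace (c2 * (cis t * (- Cconj a * (/ (1 + w) * / (1 + w)))))%C with
      (- (w * / (1 + w) * / (1 + w) * / ((1 - w * Cconj w) * (1 - w * Cconj w))))%C
      by (rewrite Ec2; unfold w at 1; ring).
    replace (c2 * Cconj (cis t * (- Cconj a * (/ (1 + w) * / (1 + w)))))%C with
      (- (Cconj w * / (1 + Cconj w) * / (1 + Cconj w) * / ((1 - w * Cconj w) * (1 - w * Cconj
          w))))%C.
    2:{ rewrite Ec2; conj_push; rewrite !Cinv_conj by exact N; rewrite !Cplus_conj, !Cconj_RtoC.
        replace (Cconj w) with (a * (Cconj (cis t) * RtoC r))%C at 1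
          by (unfold w; conj_push; rewrite Cconj_RtoC; reflexivity).
        conj_push; ring. }
    rewrite Cinv_conj by exact N; rewrite Cplus_conj, Cconj_RtoC, Ec1.
    field; repeat split; assumption. }
assert (D1 : forall t, ccontinuous (fun t : R => Cconj (us t)) t)
  by (intro; ccont).
assert (D2 : forall t, ccontinuous (fun t : R => Cconj (uT t)) t)
  by (intro; ccont).
assert (D3 : forall t, ccontinuous (fun t : R => c1 * us t)%C t)
  by (intro; ccont).
assert (D4 : forall t, ccontinuous (fun t : R => c1 * Cconj (us t))%C t)
  by (intro; ccont).
assert (D5 : forall t, ccontinuous (fun t : R => c2 * uT t)%C t)
  by (intro; ccont).
assert (D6 : forall t, ccontinuous (fun t : R => c2 * Cconj (uT t))%C t)
  by (intro; ccont).
assert (D7 : forall t, ccontinuous (fun t : R => c2 * uT t + c2 * Cconj (uT t))%C t)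
  by (intro; ccont).
assert (D8 : forall t, ccontinuous (fun t : R => - c1 + (c2 * uT t + c2 * Cconj (uT t)))%C t)
  by (intro; ccont).
assert (D9 : forall t, ccontinuous (fun t : R => c1 * Cconj (us t) + (- c1 + (c2 * uT t + c2 *
    Cconj (uT t))))%C t)
  by (intro; ccont).
rewrite (circle_mean_plus _ _ D3 D9), (circle_mean_plus _ _ D4 D8),
  (circle_mean_plus (fun _ => - c1)%C _ (fun t => continuous_const _ _) D7),
      (circle_mean_plus _ _ D5 D6).
rewrite (circle_mean_scal c1 us Cs), (circle_mean_scal c1 _ D1), (circle_mean_scal c2 uT CT),
    (circle_mean_scal c2 _ D2).
rewrite circle_mean_const, (circle_mean_conj us Cs), (circle_mean_conj uT CT), MS.
assert (E2 : (c2 * circle_mean uT)%C = 0).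
{ unfold c2; rewrite RtoC_mult; transitivity (RtoC (1 / (1 - q) ^ 2) * (RtoC r * circle_mean
    uT))%C; [ring|].
  rewrite MT; ring. }
assert (E3 : (c2 * Cconj (circle_mean uT))%C = 0).
{ rewrite <- (Cconj_conj c2), <- Cmult_conj; unfold c2 at 1; rewrite Cconj_RtoC.
  fold c2; rewrite E2; apply Cconj_RtoC. }
rewrite E2, E3, Cconj_RtoC; fold c1; ring.
Qed.

(** * The radial weight *)

Definition weight (s : R) (z : C) : R := Rpower (1 - Cmod z ^ 2) s.

Lemma weight_arg_pos (z : C) : disk z -> 0 < 1 - Cmod z ^ 2.
Proof. unfold disk; intro; generalize (Cmod_ge_0 z); simpl; nra. Qed.

Lemma weight_pos (s : R) (z : C) : 0 < weight s z.
Proof. apply exp_pos. Qed.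

Lemma is_derive_Rpower_l (s x : R) : 0 < x ->
    is_derive (fun x => Rpower x s) x (s * Rpower x s / x).
Proof. intros Hx; unfold Rpower; auto_derive; [exact Hx|field; lra]. Qed.

Lemma has_wirtinger_weight (s : R) (z : C) : disk z ->
  has_wirtinger (fun w => RtoC (weight s w)) z
    (RtoC (- (s * weight s z / (1 - Cmod z ^ 2))) * Cconj z)%C
    (RtoC (- (s * weight s z / (1 - Cmod z ^ 2))) * z)%C.
Proof.
intros Hz; pose proof (weight_arg_pos z Hz) as Hp.
assert (E : forall w : C, Re (1 + (- (1)) * (w * Cconj w))%C = 1 - Cmod w ^ 2).
{ intro w; rewrite <- Cmod2_conj; simpl; ring. }
apply (has_wirtinger_ext (fun w => RtoC (Rpower (Re (1 + (- (1)) * (w * Cconj w))%C) s))).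
{ intro w; rewrite E; reflexivity. }
eapply has_wirtinger_eq.
- apply (has_wirtinger_real_comp (fun x => Rpower x s)).
  + apply has_wirtinger_plus; [apply has_wirtinger_const|].
    apply has_wirtinger_mult; [apply has_wirtinger_const|].
    apply has_wirtinger_mult; [apply has_wirtinger_id|].
    apply (has_wirtinger_conj (fun w => w)), has_wirtinger_id.
  + rewrite E; apply is_derive_Rpower_l, Hp.
- cbv beta; fold (weight s z); generalize (s * weight s z / (1 - Cmod z ^ 2)); intro k.
  destruct z as [x y]; apply injective_projections; simpl; field.
- cbv beta; fold (weight s z); generalize (s * weight s z / (1 - Cmod z ^ 2)); intro k.
  destruct z as [x y]; apply injective_projections; simpl; field.
Qed.

Lemma weight_RtoC (s r : R) : weight s (RtoC r) = Rpower (1 - r ^ 2) s.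
Proof. unfold weight; rewrite Cmod_R, pow2_abs; reflexivity. Qed.

Lemma weight_le_1 (s : R) (z : C) : 0 <= s -> disk z -> weight s z <= 1.
Proof.
intros Hs Hz; pose proof (weight_arg_pos z Hz) as Hp.
assert (ln (1 - Cmod z ^ 2) <= 0).
{ rewrite <- ln_1; apply ln_le; [exact Hp|].
  generalize (Cmod_ge_0 z); simpl; nra. }
assert (Hn : s * ln (1 - Cmod z ^ 2) <= 0) by nra.
unfold weight, Rpower; apply Rle_trans with (exp 0); [|rewrite exp_0; lra].
destruct Hn as [Hn|Hn]; [left; apply exp_increasing, Hn|rewrite Hn; apply Rle_refl].
Qed.

(** Since the weight [(1 - r^2)^alpha] decreases in [r], multiplying by it can
    be done after integration: a bound for the weighted derivative integrates to
    a bound for the weighted function. *)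
Lemma weighted_growth (alpha : R) (B : C -> C) (S S' : R -> R) :
  0 <= alpha -> B 0 = 0 -> S 0 = 0 ->
  (forall t, 0 <= t < 1 -> 0 <= S t) ->
  (forall t, 0 <= t < 1 -> is_derive S t (S' t)) ->
  (forall t, 0 <= t < 1 -> exists p q,
     has_wirtinger B (RtoC t) p q /\ weight alpha (RtoC t) * Cmod (p + q)%C <= S' t) ->
  forall r, 0 <= r < 1 -> weight alpha (RtoC r) * Cmod (B (RtoC r)) <= S r.
Proof.
intros Ha HB0 HS0 HSp HS HB r Hr.
assert (Hw : forall t, 0 <= t < 1 -> 0 < 1 - t ^ 2) by (intros; simpl; nra).
assert (Einv : forall t, 0 <= t < 1 -> Rpower (1 - t ^ 2) (- alpha) * weight alpha (RtoC t) = 1).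
{ intros t Ht; rewrite weight_RtoC, <- Rpower_plus, Rplus_opp_l; apply Rpower_O, Hw, Ht. }
assert (K : Cmod (B (RtoC r) - B (RtoC 0))%C <=
   (fun t => Rpower (1 - t ^ 2) (- alpha) * S t) r - (fun t => Rpower (1 - t ^ 2) (- alpha) * S t)
       0).
{ apply (wirtinger_mean_value B (fun t => Rpower (1 - t ^ 2) (- alpha) * S t)
    (fun t => 2 * alpha * t * Rpower (1 - t ^ 2) (- alpha) / (1 - t ^ 2) * S t + Rpower (1 - t ^ 2)
        (- alpha) * S' t)); [lra| |].
  - intros t Ht.
    assert (Ht1 : 0 <= t < 1) by lra.
    apply (is_derive_ext (fun t => mult (Rpower (1 - t ^ 2) (- alpha)) (S t))); [reflexivity|].
    replace (2 * alpha * t * Rpower (1 - t ^ 2) (- alpha) / (1 - t ^ 2) * S t + Rpower (1 - t ^ 2)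
        (- alpha) * S' t)
     with (plus (mult (2 * alpha * t * Rpower (1 - t ^ 2) (- alpha) / (1 - t ^ 2)) (S t))
       (mult (Rpower (1 - t ^ 2) (- alpha)) (S' t))) by reflexivity.
    apply (is_derive_mult (K := R_AbsRing) (fun t => Rpower (1 - t ^ 2) (- alpha)) S t);
      [|apply HS, Ht1|intros; apply Rmult_comm].
    pose proof (Hw t Ht1) as Hwt.
    replace (2 * alpha * t * Rpower (1 - t ^ 2) (- alpha) / (1 - t ^ 2)) with
      (scal (- (2 * t)) (- alpha * Rpower (1 - t ^ 2) (- alpha) / (1 - t ^ 2)))
      by (change (- (2 * t) * (- alpha * Rpower (1 - t ^ 2) (- alpha) / (1 - t ^ 2)) =
            2 * alpha * t * Rpower (1 - t ^ 2) (- alpha) / (1 - t ^ 2)); field; lra).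
    apply (is_derive_comp (fun y => Rpower y (- alpha)) (fun t => 1 - t ^ 2)).
    + apply is_derive_Rpower_l, Hwt.
    + auto_derive; [exact I|simpl; ring].
  - intros t Ht.
    assert (Ht1 : 0 <= t < 1) by lra.
    destruct (HB t Ht1) as (p & q & Hpq & Hb); exists p, q; split; [exact Hpq|].
    pose proof (Hw t Ht1) as Hwt; pose proof (HSp t Ht1) as HSt.
    assert (Rp : 0 < Rpower (1 - t ^ 2) (- alpha)) by apply exp_pos.
    assert (0 <= 2 * alpha * t * Rpower (1 - t ^ 2) (- alpha) / (1 - t ^ 2) * S t).
    { apply Rmult_le_pos; [|exact HSt].
      apply Rmult_le_pos; [|left; apply Rinv_0_lt_compat, Hwt].
      repeat apply Rmult_le_pos; lra. }
    assert (Cmod (p + q)%C = Rpower (1 - t ^ 2) (- alpha) * (weight alpha (RtoC t) * Cmod (p +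
        q)%C)).
    { rewrite <- Rmult_assoc, (Einv t Ht1); ring. }
    assert (Rpower (1 - t ^ 2) (- alpha) * (weight alpha (RtoC t) * Cmod (p + q)%C) <= Rpower (1 -
        t ^ 2) (- alpha) * S' t)
      by (apply Rmult_le_compat_l; lra).
    lra. }
cbv beta in K; rewrite HB0, HS0, Rmult_0_r, Rminus_0_r in K.
replace (B (RtoC r) - 0)%C with (B (RtoC r)) in K by ring.
replace (S r) with (weight alpha (RtoC r) * (Rpower (1 - r ^ 2) (- alpha) * S r)).
- apply Rmult_le_compat_l; [left; apply weight_pos|exact K].
- rewrite <- Rmult_assoc, (Rmult_comm (weight _ _)), (Einv r Hr); ring.
Qed.

(** * Estimates at the origin *)

(** The second-order equation as two equations of first order, with source [G]:
    [H] is [(1 - |z|^2)^(- alpha) Q]. *)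
Record weighted_system (alpha : R) (F P Q H G Hb : C -> C) : Prop := {
  ws_F : C1_wirtinger F P Q;
  ws_H : C1_wirtinger H G Hb;
  ws_weight : forall z, disk z -> Q z = (RtoC (weight alpha z) * H z)%C }.

Arguments ws_F {alpha F P Q H G Hb}.
Arguments ws_H {alpha F P Q H G Hb}.
Arguments ws_weight {alpha F P Q H G Hb}.

(** [limsup |F| <= M] at the circle, uniformly in the angle. *)
Definition boundary_bound (F : C -> C) (M : R) : Prop :=
  forall eps, 0 < eps -> exists rho, rho < 1 /\
    forall z, disk z -> rho <= Cmod z -> Cmod (F z) <= M + eps.

(** The weight is radial, hence invariant under rotations. *)
Lemma rot_avg_radial (alpha : R) (psi : R -> C) (Q H : C -> C) (z : C) :
  (forall t, ccontinuous psi t) -> (forall y, disk y -> ccont_at H y) -> disk z ->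
  (forall z, disk z -> Q z = (RtoC (weight alpha z) * H z)%C) ->
  rot_avg psi Q z = (RtoC (weight alpha z) * rot_avg psi H z)%C.
Proof.
intros Hpsi HH Hz HQ.
unfold rot_avg; rewrite <- circle_mean_scal.
- apply circle_mean_ext; intros t _; rewrite (HQ _ (disk_cis t _ Hz)).
  unfold weight; rewrite Cmod_mult, Cmod_cis, Rmult_1_l; ring.
- apply rot_avg_integrand_continuous; assumption.
Qed.
(** ** Passage to the limit *)

Lemma le_of_le_mult_near_1 (c D rho : R) :
  rho < 1 -> 0 <= c -> (forall R, 0 < R < 1 -> rho <= R -> R * c <= D) -> c <= D.
Proof.
intros Hrho Hc H.
destruct (Rle_lt_dec c D) as [K|K]; [exact K|exfalso].
pose (R0 := Rmax rho (Rmax (1 / 2) ((1 + D / c) / 2))).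
assert (Hc0 : 0 < c).
{ destruct (Rle_lt_dec c 0) as [K0|K0]; [|exact K0].
  pose (R1 := Rmax rho (1 / 2)).
  assert (R1 < 1) by (apply Rmax_lub_lt; lra).
  assert (rho <= R1) by apply Rmax_l.
  assert (1 / 2 <= R1) by apply Rmax_r.
  assert (c = 0) by lra; subst c; generalize (H R1); lra. }
assert (HD : D / c < 1) by (apply (Rmult_lt_reg_r c); [exact Hc0|]; unfold Rdiv;
    rewrite Rmult_assoc, Rinv_l; lra).
assert (R0 < 1) by (repeat apply Rmax_lub_lt; lra).
assert (rho <= R0) by apply Rmax_l.
assert (Rmax (1 / 2) ((1 + D / c) / 2) <= R0) by apply Rmax_r.
assert (1 / 2 <= R0) by (eapply Rle_trans; [apply Rmax_l|eassumption]).
assert ((1 + D / c) / 2 <= R0) by (eapply Rle_trans; [apply Rmax_r|eassumption]).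
assert (K1 : R0 * c <= D) by (apply H; lra).
assert (K2 : (1 + D / c) / 2 * c <= R0 * c) by (apply Rmult_le_compat_r; lra).
replace ((1 + D / c) / 2 * c) with ((c + D) / 2) in K2 by (field; lra).
lra.
Qed.

Lemma le_of_le_eps (x y : R) : (forall eps, 0 < eps -> x <= y + eps) -> x <= y.
Proof.
intros H; destruct (Rle_lt_dec x y) as [K|K]; [exact K|].
specialize (H ((x - y) / 2)); lra.
Qed.

(** On the real axis the two Caratheodory factors add up to [A r / r]. *)
Lemma derivative_bound_at_0 (A : C -> C) (p q : C) (K : R) :
  has_wirtinger A 0 p q -> A 0 = 0 ->
  (forall r, 0 < r < 1 -> Cmod (A (RtoC r)) <= K * r) -> Cmod (p + q)%C <= K.
Proof.
intros (A1 & B1 & HA & HB & Ap & Bq & E) A0 HK.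
assert (CS : ccont_at (fun w => A1 w + B1 w)%C (RtoC 0)) by ccont.
apply le_of_le_eps; intros eps He.
destruct (proj1 (continuous_C_metric _ _) CS eps He) as [d [Hd K1]].
pose (r := Rmin (1 / 2) (d / 2)).
assert (Hr0 : 0 < r) by (apply Rmin_glb_lt; lra).
assert (Hr1 : r <= 1 / 2) by apply Rmin_l.
assert (Hr2 : r <= d / 2) by apply Rmin_r.
assert (Hd' : Cmod (RtoC r - 0)%C < d).
{ replace (RtoC r - 0)%C with (RtoC r) by ring; rewrite Cmod_RtoC_pos; lra. }
specialize (K1 _ Hd'); rewrite Ap, Bq in K1.
assert (K2 : Cmod (A1 (RtoC r) + B1 (RtoC r))%C <= K).
{ apply (Rmult_le_reg_r r); [exact Hr0|].
  eapply Rle_trans; [|apply (HK r); lra].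
  rewrite (E (RtoC r)), A0; replace (RtoC r - 0)%C with (RtoC r) by ring; rewrite Cconj_RtoC.
  replace (0 + A1 (RtoC r) * RtoC r + B1 (RtoC r) * RtoC r)%C with ((A1 (RtoC r) + B1 (RtoC r)) *
      RtoC r)%C by ring.
  rewrite Cmod_mult, (Cmod_RtoC_pos r) by lra; lra. }
replace (p + q)%C with ((A1 (RtoC r) + B1 (RtoC r)) + - (A1 (RtoC r) + B1 (RtoC r) - (p + q)))%C by
    ring.
eapply Rle_trans; [apply Cmod_triangle|]; rewrite Cmod_opp; lra.
Qed.

(** Below, [L] bounds the source in the form that the transported problem
    provides, and [x r^2 = |conj a z|^2] on the circle [|z| = r]. *)
Section Origin.

Variables (alpha : R) (F P Q H G Hb : C -> C) (a : C) (L M : R).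
Hypothesis Halpha : 0 <= alpha.
Hypothesis Hsys : weighted_system alpha F P Q H G Hb.
Hypothesis Ha : disk a.
Hypothesis HL : 0 <= L.
Hypothesis HG : forall z, disk z -> weight alpha z * Cmod (G z) <= L * / Cmod (1 + Cconj a * z)%C ^
    4.
Hypothesis HM : boundary_bound F M.

Let x := Cmod a ^ 2.

Lemma x_range : 0 <= x < 1.
Proof. unfold x; unfold disk in Ha; generalize (Cmod_ge_0 a); simpl; nra. Qed.

Lemma xr_range (r : R) : 0 <= r < 1 -> 0 <= x * r ^ 2 <= x.
Proof. generalize x_range; intros; assert (0 <= r ^ 2 <= 1) by (simpl; nra); nra. Qed.

Lemma G_continuous : forall y, disk y -> ccont_at G y.
Proof. intros y Hy; exact (proj1 (proj2 (ws_H Hsys y Hy))). Qed.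

(** The numerical factor is the circular mean of [1 / |1 + conj a z|^4]. *)
Lemma fcoef_G_bound (k r : R) : 0 <= r < 1 ->
  weight alpha (RtoC r) * Cmod (fcoef k G (RtoC r)) <=
  L * ((1 + x * r ^ 2) / (1 - x * r ^ 2) ^ 3).
Proof.
intros Hr; pose proof (disk_RtoC r Hr) as Dr.
pose (v := fun t : R => / weight alpha (RtoC r) * (L * / Cmod (1 + Cconj a * (cis t * RtoC r))%C ^
    4)).
assert (Hc : forall t : R, Cmod (cis t * RtoC r)%C = r) by (intro;
    rewrite Cmod_mult, Cmod_cis, Cmod_RtoC_pos; lra).
assert (Hv0 : forall t, continuous (fun t : R => / Cmod (1 + Cconj a * (cis t * RtoC r))%C ^ 4) t).
{ intro t.
  assert (Hct : continuous (fun t : R => Cmod (1 + Cconj a * (cis t * RtoC r))%C) t).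
  { apply (continuous_Cmod (fun t : R => 1 + Cconj a * (cis t * RtoC r))%C).
    apply continuous_Cplus; [apply continuous_const|].
    apply continuous_Cmult; [apply continuous_const|apply continuous_orbit]. }
  apply (continuous_comp (fun t : R => Cmod (1 + Cconj a * (cis t * RtoC r))%C) (fun y => / y ^
      4)); [exact Hct|].
  apply continuity_pt_filterlim, continuity_pt_inv.
  - apply derivable_continuous_pt, derivable_pt_pow.
  - apply pow_nonzero; intro K; apply Cmod_eq_0 in K; revert K.
    apply one_plus_neq_0; [exact Ha|rewrite Hc; lra]. }
assert (Hv1 : forall t, ccontinuous (fun t : R => RtoC (/ Cmod (1 + Cconj a * (cis t * RtoC r))%C ^
    4)) t)
  by (intro; apply continuous_RtoC, Hv0).
assert (Hv : forall t, continuous v t).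
{ intro t; unfold v; apply (continuous_scal_r (V := R_NormedModule)), (continuous_scal_r (V :=
    R_NormedModule)), Hv0. }
assert (Hw : 0 < weight alpha (RtoC r)) by apply weight_pos.
assert (K : Cmod (fcoef k G (RtoC r)) <= Re (circle_mean (fun t => RtoC (v t)))).
{ apply circle_mean_le; [|exact Hv|].
  - apply rot_avg_integrand_continuous; [apply continuous_cis_lin|apply G_continuous|exact Dr].
  - intros t _; rewrite Cmod_mult, Cmod_cis, Rmult_1_l.
    generalize (HG _ (disk_cis t _ Dr)); unfold weight at 1; rewrite Hc.
    replace (Rpower (1 - r ^ 2) alpha) with (weight alpha (RtoC r)) by apply weight_RtoC.
    intro K; unfold v.
    apply (Rmult_le_reg_l (weight alpha (RtoC r))); [exact Hw|].
    rewrite <- Rmult_assoc, Rinv_r, Rmult_1_l by lra; exact K. }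
assert (E : circle_mean (fun t => RtoC (v t)) =
  RtoC (/ weight alpha (RtoC r) * (L * ((1 + x * r ^ 2) / (1 - x * r ^ 2) ^ 3)))).
{ rewrite (circle_mean_ext _ (fun t => RtoC (/ weight alpha (RtoC r) * L) * RtoC (/ Cmod (1 + Cconj
    a * (cis t * RtoC r))%C ^ 4))%C).
  - rewrite (circle_mean_scal _ _ Hv1), (mean_inv_one_plus_4 a r Ha Hr); fold x.
    rewrite <- RtoC_mult; f_equal; ring.
  - intros t _; unfold v; rewrite <- RtoC_mult; f_equal; ring. }
rewrite E in K; simpl Re in K.
replace (L * ((1 + x * r ^ 2) / (1 - x * r ^ 2) ^ 3)) with
  (weight alpha (RtoC r) * (/ weight alpha (RtoC r) * (L * ((1 + x * r ^ 2) / (1 - x * r ^ 2) ^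
      3))))
  by (field; split; [generalize (xr_range r Hr) x_range; lra|lra]).
apply Rmult_le_compat_l; [lra|exact K].
Qed.

Lemma fcoef_Q (k r : R) : 0 <= r < 1 ->
  fcoef k Q (RtoC r) = (RtoC (weight alpha (RtoC r)) * fcoef k H (RtoC r))%C.
Proof.
intros Hr; pose proof (disk_RtoC r Hr) as Dr.
apply (rot_avg_radial alpha); [apply continuous_cis_lin| |exact Dr|apply (ws_weight Hsys)].
apply (C1_wirtinger_continuous _ _ _ (ws_H Hsys)).
Qed.

Lemma fcoef_F_near (k r : R) (eps rho : R) :
  (forall z, disk z -> rho <= Cmod z -> Cmod (F z) <= M + eps) ->
  rho <= r -> 0 <= r < 1 -> Cmod (fcoef k F (RtoC r)) <= M + eps.
Proof.
intros HF Hrho Hr; apply fcoef_bound.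
- apply (C1_wirtinger_continuous _ _ _ (ws_F Hsys)).
- apply disk_RtoC, Hr.
- intros y Hy; rewrite Cmod_RtoC_pos in Hy by lra; apply HF; unfold disk; lra.
Qed.

Lemma M_nonneg : 0 <= M.
Proof.
apply le_of_le_eps; intros eps He; destruct (HM eps He) as [rho [Hrho K]].
pose (r := Rmax rho 0).
assert (r < 1) by (apply Rmax_lub_lt; lra).
assert (0 <= r) by apply Rmax_r. assert (rho <= r) by apply Rmax_l.
generalize (K (RtoC r)); rewrite Cmod_RtoC_pos by lra.
intros K1; specialize (K1 (disk_RtoC r (conj H1 H0)) H2).
generalize (Cmod_ge_0 (F (RtoC r))); lra.
Qed.

Let cis1 : cis (2 * PI * 1) = 1 := cis_period 1 (or_intror (or_introl eq_refl)).
Let cis0 : cis (2 * PI * 0) = 1 := cis_period 0 (or_introl eq_refl).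
Let cism1 : cis (2 * PI * -1) = 1 := cis_period (-1) (or_intror (or_intror (or_introl eq_refl))).
Let cis2 : cis (2 * PI * 2) = 1 := cis_period 2 (or_intror (or_intror (or_intror eq_refl))).

(** Order [0]. With [B = r H_1] the equations are [B' = 2 r G_0] and
    [F_0' = (2 / r) (1 - r^2)^alpha B]. The majorant [t^2 / (1 - x t^2)^2] of the
    weighted [B], multiplied by [2 / t], integrates to [t^2 / (1 - x t^2)], with
    value [1 / (1 - x)] at [t = 1]. *)
Lemma origin_value : Cmod (F 0) <= M + L / (1 - x).
Proof.
pose proof x_range as Hx.
pose (S t := L * (t ^ 2 / (1 - x * t ^ 2) ^ 2)).
assert (HB : forall r, 0 <= r < 1 ->
  weight alpha (RtoC r) * Cmod (RtoC r * fcoef 1 H (RtoC r))%C <= S r).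
{ apply (weighted_growth alpha (fun z => z * fcoef 1 H z)%C S
    (fun t => L * (2 * t * ((1 + x * t ^ 2) / (1 - x * t ^ 2) ^ 3)))); [exact Halpha|ring|unfold S;
        field; lra| | |].
  - intros t Ht; unfold S; generalize (xr_range t Ht); intro.
    apply Rmult_le_pos; [exact HL|]; apply Rmult_le_pos; [apply pow2_ge_0|].
    left; apply Rinv_0_lt_compat, pow_lt; lra.
  - intros t Ht; generalize (xr_range t Ht); simpl; intro; unfold S; auto_derive; [|field; lra].
    repeat apply Rmult_integral_contrapositive_currified; lra.
  - intros t Ht.
    pose proof (disk_RtoC t Ht) as Dt.
    eexists; eexists; split.
    + apply has_wirtinger_mult; [apply has_wirtinger_id|].
      apply (C1_wirtinger_fcoef 1 H G Hb (ws_H Hsys) _ Dt).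
    + pose proof (fcoef_angular 1 H G Hb (RtoC t) (ws_H Hsys) cis1 Dt) as K.
      rewrite Cconj_RtoC, Cmult_1_l in K.
      cbv beta; match goal with |- _ * Cmod ?c <= _ => replace c with (RtoC (2 * t) * fcoef (1 - 1)
          G (RtoC t))%C end.
      * rewrite Cmod_mult, Cmod_RtoC_pos by lra.
        generalize (fcoef_G_bound (1 - 1) t Ht); intro.
        apply (Rmult_le_compat_l (2 * t)) in H0; [|lra]; nra.
      * rewrite K, RtoC_mult; ring. }
assert (HA : forall r, 0 <= r < 1 -> Cmod (fcoef 0 F (RtoC r) - fcoef 0 F (RtoC 0))%C <= L / (1 -
    x)).
{ intros r Hr.
  apply Rle_trans with ((fun t => L * (t ^ 2 / (1 - x * t ^ 2))) r - (fun t => L * (t ^ 2 / (1 - x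
      * t ^ 2))) 0).
  - apply (wirtinger_mean_value (fcoef 0 F) (fun t => L * (t ^ 2 / (1 - x * t ^ 2))) (fun t => L *
      (2 * t / (1 - x * t ^ 2) ^ 2))); [lra| |].
    + intros t Ht; assert (Ht1 : 0 <= t < 1) by lra; generalize (xr_range t Ht1); simpl; intro.
      auto_derive; [lra|field; lra].
    + intros t Ht; assert (Ht1 : 0 <= t < 1) by lra.
      pose proof (disk_RtoC t Ht1) as Dt.
      eexists; eexists; split; [apply (C1_wirtinger_fcoef 0 F P Q (ws_F Hsys) _ Dt)|].
      generalize (xr_range t Ht1); intro Hxt.
      destruct (Req_dec t 0) as [->|Ht0].
      * rewrite !fcoef_origin.
        -- rewrite Cplus_0_r, Cmod_0; right; field; lra.
        -- lra.
        -- replace (0 + 1) with 1 by ring; exact cis1.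
        -- lra.
        -- replace (0 - 1) with (-1) by ring; exact cism1.
      * pose proof (fcoef_angular 0 F P Q (RtoC t) (ws_F Hsys) cis0 Dt) as K.
        rewrite Cconj_RtoC, Cmult_0_l in K.
        pose proof (RtoC_neq_0 t Ht0) as Ht2.
        replace (fcoef (0 - 1) P (RtoC t)) with
          (/ RtoC t * (RtoC t * fcoef (0 - 1) P (RtoC t) - RtoC t * fcoef (0 + 1) Q (RtoC t)) +
              fcoef (0 + 1) Q (RtoC t))%C
          by (field; exact Ht2).
        rewrite <- K, Cmult_0_r, Cplus_0_l.
        rewrite (fcoef_Q (0 + 1) t Ht1); replace (0 + 1) with 1 by ring.
        replace (RtoC (weight alpha (RtoC t)) * fcoef 1 H (RtoC t) + RtoC (weight alpha (RtoC t)) *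
            fcoef 1 H (RtoC t))%C
          with (RtoC (2 / t * weight alpha (RtoC t)) * (RtoC t * fcoef 1 H (RtoC t)))%C.
        -- rewrite Cmod_mult, Cmod_RtoC_pos.
           ++ generalize (HB t Ht1); unfold S; intro K1.
              apply (Rmult_le_compat_l (2 / t)) in K1; [|left; apply Rdiv_lt_0_compat; lra].
              rewrite Rmult_assoc; eapply Rle_trans; [exact K1|]; right; field; lra.
           ++ apply Rmult_le_pos; [left; apply Rdiv_lt_0_compat; lra|left; apply weight_pos].
        -- rewrite RtoC_mult, RtoC_div by exact Ht0; field; exact Ht2.
  - cbv beta; generalize (xr_range r Hr); intro.
    replace (L * (r ^ 2 / (1 - x * r ^ 2)) - L * (0 ^ 2 / (1 - x * 0 ^ 2))) with (L * (r ^ 2 / (1 -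
        x * r ^ 2))) by (field; lra).
    unfold Rdiv at 2; apply Rmult_le_compat_l; [exact HL|].
    unfold Rdiv; rewrite <- (Rmult_1_l (/ (1 - x))); apply Rmult_le_compat; [apply pow2_ge_0| | |].
    + left; apply Rinv_0_lt_compat; lra.
    + simpl; nra.
    + apply Rinv_le_contravar; lra. }
apply le_of_le_eps; intros eps He; destruct (HM eps He) as [rho [Hrho K]].
pose (r := Rmax rho 0).
assert (Hr1 : r < 1) by (apply Rmax_lub_lt; lra).
assert (Hr0 : 0 <= r) by apply Rmax_r. assert (Hr2 : rho <= r) by apply Rmax_l.
pose proof (fcoef_F_near 0 r eps rho K Hr2 (conj Hr0 Hr1)) as K1.
pose proof (HA r (conj Hr0 Hr1)) as K2; rewrite fcoef_0_origin in K2.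
replace (F 0) with (fcoef 0 F (RtoC r) + - (fcoef 0 F (RtoC r) - F 0%C))%C by ring.
eapply Rle_trans; [apply Cmod_triangle|]; rewrite Cmod_opp; lra.
Qed.

(** Order [1]. With [A = F_1 / r] and [B = r^2 H_2] the equations are
    [B' = 2 r^2 G_1] and [A' = 2 r^(-3) (1 - r^2)^alpha B], and [A] tends to
    [F_z(0)] at the origin. The exact integral of [2 t^2 (1 + x t^2) / (1 - x t^2)^3]
    contains an inverse hyperbolic tangent, the integral of
    [t^2 / (2 (1 - x t^2))]; bounding the latter by [t^2 / (2 (1 - x))] keeps the
    majorant rational, and exact for [x = 0]. *)
Lemma origin_dz : Cmod (P 0) <= M + 4 / 3 * (L / (1 - x)).
Proof.
pose proof x_range as Hx; pose proof M_nonneg as HM0.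
pose (S t := L * (t ^ 3 * (1 + x * t ^ 2) / (2 * (1 - x * t ^ 2) ^ 2) + t ^ 3 / (6 * (1 - x)))).
assert (HB : forall r, 0 <= r < 1 ->
  weight alpha (RtoC r) * Cmod (RtoC r * RtoC r * fcoef 2 H (RtoC r))%C <= S r).
{ apply (weighted_growth alpha (fun z => z * z * fcoef 2 H z)%C S
    (fun t => L * (2 * t ^ 2 * ((1 + x * t ^ 2) / (1 - x * t ^ 2) ^ 3) +
       (t ^ 2 / (2 * (1 - x)) - t ^ 2 / (2 * (1 - x * t ^ 2)))))); [exact Halpha|ring|unfold S;
           field; lra| | |].
  - intros t Ht; unfold S; generalize (xr_range t Ht); intro.
    apply Rmult_le_pos; [exact HL|].
    assert (0 <= t ^ 3) by (apply pow_le; lra).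
    apply Rplus_le_le_0_compat; apply Rmult_le_pos.
    + apply Rmult_le_pos; lra.
    + left; apply Rinv_0_lt_compat, Rmult_lt_0_compat; [lra|apply pow_lt; lra].
    + assumption.
    + left; apply Rinv_0_lt_compat; lra.
  - intros t Ht; generalize (xr_range t Ht); simpl; intro; unfold S; auto_derive; [|field; lra].
    repeat split; repeat apply Rmult_integral_contrapositive_currified; lra.
  - intros t Ht.
    pose proof (disk_RtoC t Ht) as Dt.
    eexists; eexists; split.
    + apply has_wirtinger_mult; [apply has_wirtinger_mult; apply has_wirtinger_id|].
      apply (C1_wirtinger_fcoef 2 H G Hb (ws_H Hsys) _ Dt).
    + pose proof (fcoef_angular 2 H G Hb (RtoC t) (ws_H Hsys) cis2 Dt) as K.
      rewrite Cconj_RtoC in K.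
      cbv beta; match goal with |- _ * Cmod ?c <= _ => replace c with (RtoC (2 * t ^ 2) * fcoef (2
          - 1) G (RtoC t))%C end.
      * rewrite Cmod_mult, Cmod_RtoC_pos by (apply Rmult_le_pos; [lra|apply pow2_ge_0]).
        generalize (fcoef_G_bound (2 - 1) t Ht) (xr_range t Ht); intros K1 Hxt.
        apply (Rmult_le_compat_l (2 * t ^ 2)) in K1; [|apply Rmult_le_pos; [lra|apply pow2_ge_0]].
        assert (/ (1 - x * t ^ 2) <= / (1 - x)) by (apply Rinv_le_contravar; lra).
        assert (0 <= L * (t ^ 2 / (2 * (1 - x)) - t ^ 2 / (2 * (1 - x * t ^ 2)))).
        { apply Rmult_le_pos; [exact HL|].
          replace (t ^ 2 / (2 * (1 - x)) - t ^ 2 / (2 * (1 - x * t ^ 2))) with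
            (t ^ 2 / 2 * (/ (1 - x) - / (1 - x * t ^ 2))) by (field; lra).
          apply Rmult_le_pos; [generalize (pow2_ge_0 t); lra|lra]. }
        lra.
      * transitivity (RtoC t * (RtoC 2 * fcoef 2 H (RtoC t)) + RtoC t * RtoC t * (fcoef (2 - 1) G
          (RtoC t) + fcoef (2 + 1) Hb (RtoC t)))%C;
          [rewrite K, RtoC_mult, RtoC_pow; ring|ring]. }
pose proof (C1_wirtinger_fcoef 1 F P Q (ws_F Hsys)) as CA.
pose (Psi t := L * (t / (1 - x * t ^ 2) + t / (3 * (1 - x)))).
assert (HPsi : forall t, 0 <= t < 1 -> 0 <= Psi t <= 4 / 3 * (L / (1 - x))).
{ intros t Ht; generalize (xr_range t Ht); intro; unfold Psi.
  replace (4 / 3 * (L / (1 - x))) with (L * (1 / (1 - x) + 1 / (3 * (1 - x)))) by (field; lra).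
  assert (0 < / (1 - x)) by (apply Rinv_0_lt_compat; lra).
  assert (0 < / (3 * (1 - x))) by (apply Rinv_0_lt_compat; lra).
  assert (0 < / (1 - x * t ^ 2)) by (apply Rinv_0_lt_compat; lra).
  assert (/ (1 - x * t ^ 2) <= / (1 - x)) by (apply Rinv_le_contravar; lra).
  unfold Rdiv; split.
  - apply Rmult_le_pos; [exact HL|]; apply Rplus_le_le_0_compat; apply Rmult_le_pos; lra.
  - apply Rmult_le_compat_l; [exact HL|]; apply Rplus_le_compat.
    + apply Rmult_le_compat; lra.
    + apply Rmult_le_compat_r; lra. }
assert (HA : forall r R0, 0 < r -> r <= R0 -> R0 < 1 ->
  Cmod (/ RtoC R0 * fcoef 1 F (RtoC R0) - / RtoC r * fcoef 1 F (RtoC r))%C <= 4 / 3 * (L / (1 -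
      x))).
{ intros r R0 Hr HrR HR.
  apply Rle_trans with (Psi R0 - Psi r); [|generalize (HPsi R0) (HPsi r); lra].
  apply (wirtinger_mean_value (fun z => / z * fcoef 1 F z)%C Psi
    (fun t => L * ((1 + x * t ^ 2) / (1 - x * t ^ 2) ^ 2 + 1 / (3 * (1 - x))))); [lra| |].
  - intros t Ht; assert (Ht1 : 0 <= t < 1) by lra; generalize (xr_range t Ht1); simpl; intro.
    unfold Psi; auto_derive; [split; [lra|split; [lra|exact I]] || lra|field; lra].
  - intros t Ht; assert (Ht1 : 0 <= t < 1) by lra.
    pose proof (disk_RtoC t Ht1) as Dt.
    assert (Ht0 : t <> 0) by lra.
    pose proof (RtoC_neq_0 t Ht0) as Ht2.
    eexists; eexists; split.
    + apply has_wirtinger_mult; [apply (has_wirtinger_inv _ Ht2)|apply (CA _ Dt)].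
    + generalize (xr_range t Ht1); intro Hxt.
      pose proof (fcoef_angular 1 F P Q (RtoC t) (ws_F Hsys) cis1 Dt) as K.
      rewrite Cconj_RtoC, Cmult_1_l in K.
      cbv beta; match goal with |- Cmod ?c <= _ =>
        replace c with (RtoC (2 / t ^ 3 * weight alpha (RtoC t)) * (RtoC t * RtoC t * fcoef 2 H
            (RtoC t)))%C end.
      * rewrite Cmod_mult, Cmod_RtoC_pos.
        -- generalize (HB t Ht1); unfold S; intro K1.
           assert (0 < t ^ 3) by (apply pow_lt; lra).
           apply (Rmult_le_compat_l (2 / t ^ 3)) in K1; [|left; apply Rdiv_lt_0_compat; lra].
           rewrite Rmult_assoc; eapply Rle_trans; [exact K1|]; right; field; lra.
        -- apply Rmult_le_pos; [left; apply Rdiv_lt_0_compat; [lra|apply pow_lt; lra]|left;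
            apply weight_pos].
      * rewrite K, (fcoef_Q (1 + 1) t Ht1); replace (1 + 1) with 2 by ring.
        rewrite RtoC_mult, RtoC_div, RtoC_pow by (apply pow_nonzero, Ht0).
        simpl Cpow; field; exact Ht2. }
assert (HK : forall r, 0 < r < 1 -> Cmod (fcoef 1 F (RtoC r)) <= (M + 4 / 3 * (L / (1 - x))) * r).
{ intros r Hr.
  assert (Hr2 : RtoC r <> 0) by (intro K'; apply RtoC_inj in K'; lra).
  assert (E : Cmod (fcoef 1 F (RtoC r)) = r * Cmod (/ RtoC r * fcoef 1 F (RtoC r))%C).
  { rewrite <- (Cmod_RtoC_pos r) at 2 by lra; rewrite <- Cmod_mult; f_equal; field; exact Hr2. }
  rewrite E, Rmult_comm; apply Rmult_le_compat_r; [lra|].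
  apply le_of_le_eps; intros eps He; destruct (HM eps He) as [rho [Hrho K]].
  apply (le_of_le_mult_near_1 _ _ (Rmax rho r)); [apply Rmax_lub_lt; lra|apply Cmod_ge_0|].
  intros R0 HR0 HR1.
  assert (rho <= R0) by (eapply Rle_trans; [apply Rmax_l|exact HR1]).
  assert (r <= R0) by (eapply Rle_trans; [apply Rmax_r|exact HR1]).
  assert (HR2 : RtoC R0 <> 0) by (intro K'; apply RtoC_inj in K'; lra).
  pose proof (HA r R0) as K2.
  assert (HR3 : 0 <= R0 < 1) by lra.
  pose proof (fcoef_F_near 1 R0 eps rho K H0 HR3) as K1.
  rewrite <- (Cmod_RtoC_pos R0) at 1 by lra; rewrite <- Cmod_mult.
  replace (RtoC R0 * (/ RtoC r * fcoef 1 F (RtoC r)))%C with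
    (fcoef 1 F (RtoC R0) + - (RtoC R0 * (/ RtoC R0 * fcoef 1 F (RtoC R0) - / RtoC r * fcoef 1 F
        (RtoC r))))%C
    by (field; split; assumption).
  eapply Rle_trans; [apply Cmod_triangle|]; rewrite Cmod_opp, Cmod_mult, Cmod_RtoC_pos by lra.
  assert (0 <= 4 / 3 * (L / (1 - x))) by (generalize (HPsi 0); lra).
  assert (R0 * Cmod (/ RtoC R0 * fcoef 1 F (RtoC R0) - / RtoC r * fcoef 1 F (RtoC r))%C <= 1 * (4 /
      3 * (L / (1 - x)))).
  { apply Rmult_le_compat; [lra|apply Cmod_ge_0|lra|apply K2; lra]. }
  lra. }
assert (D0 : disk 0) by (unfold disk; rewrite Cmod_0; lra).
assert (E0 : fcoef 1 F 0 = 0) by (apply fcoef_origin; [lra|exact cis1]).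
generalize (derivative_bound_at_0 (fcoef 1 F) _ _ _ (proj1 (CA 0%C D0)) E0 HK).
replace (1 - 1) with 0 by ring; rewrite fcoef_0_origin.
rewrite (fcoef_origin (1 + 1)); [rewrite Cplus_0_r; trivial|lra|].
replace (1 + 1) with 2 by ring; exact cis2.
Qed.

(** Order [-1]. The equations are [(r F_(-1))' = 2 r (1 - r^2)^alpha H_0] and
    [H_0' = 2 G_(-1)]. With [K = (1 - r^2)^(alpha + 1) / (alpha + 1)], an
    antiderivative of [- 2 r (1 - r^2)^alpha], the derivative of
    [Y = r F_(-1) + K H_0] is [2 K G_(-1)]. Estimating [H_0] before integrating,
    as for the other two orders, would cost a factor [alpha + 1] on the source. *)
Lemma origin_dzbar : Cmod (Q 0) <= (alpha + 1) * M + 4 / 3 * (L / (1 - x)).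
Proof.
pose proof x_range as Hx; pose proof M_nonneg as HM0.
pose proof (C1_wirtinger_fcoef (-1) F P Q (ws_F Hsys)) as CA.
pose proof (C1_wirtinger_fcoef 0 H G Hb (ws_H Hsys)) as CH.
assert (Hang : forall t, 0 <= t < 1 ->
  (fcoef (0 - 1) G (RtoC t) + fcoef (0 + 1) Hb (RtoC t))%C = (RtoC 2 * fcoef (-1) G (RtoC t))%C).
{ intros t Ht.
  replace (0 - 1) with (-1) by ring; replace (0 + 1) with 1 by ring.
  destruct (Req_dec t 0) as [->|Ht0].
  - rewrite !fcoef_origin; [ring|lra|exact cis1|lra|exact cism1].
  - pose proof (RtoC_neq_0 t Ht0) as Ht2.
    pose proof (fcoef_angular 0 H G Hb (RtoC t) (ws_H Hsys) cis0 (disk_RtoC t Ht)) as K.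
    rewrite Cconj_RtoC, Cmult_0_l in K.
    replace (0 - 1) with (-1) in K by ring; replace (0 + 1) with 1 in K by ring.
    replace (fcoef 1 Hb (RtoC t)) with
      (fcoef (-1) G (RtoC t) - / RtoC t * (RtoC t * fcoef (-1) G (RtoC t) - RtoC t * fcoef 1 Hb
          (RtoC t)))%C
      by (field; exact Ht2).
    rewrite <- K; ring. }
(* A crude bound suffices to see that [K H_0] vanishes at the boundary. *)
pose (C0 := 4 * L / (1 - x) ^ 3).
assert (HC0 : 0 <= C0).
{ unfold C0; apply Rmult_le_pos; [lra|left; apply Rinv_0_lt_compat, pow_lt; lra]. }
assert (HB : forall r, 0 <= r < 1 ->
  weight alpha (RtoC r) * Cmod (fcoef 0 H (RtoC r) - H 0)%C <= C0 * r).
{ apply (weighted_growth alpha (fun z => fcoef 0 H z - H 0)%C (fun t => C0 * t) (fun _ => C0));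
    [exact Halpha|rewrite fcoef_0_origin; ring|ring| | |].
  - intros t Ht; apply Rmult_le_pos; lra.
  - intros t Ht; auto_derive; [exact I|ring].
  - intros t Ht; eexists; eexists; split.
    + apply has_wirtinger_plus; [apply (CH _ (disk_RtoC t Ht))|apply has_wirtinger_const].
    + rewrite !Cplus_0_r, (Hang t Ht), Cmod_mult, Cmod_RtoC_pos by lra.
      generalize (fcoef_G_bound (-1) t Ht) (xr_range t Ht); intros K1 Hxt.
      assert (K2 : (1 + x * t ^ 2) / (1 - x * t ^ 2) ^ 3 <= 2 / (1 - x) ^ 3).
      { unfold Rdiv; apply Rmult_le_compat; [lra|left; apply Rinv_0_lt_compat, pow_lt; lra|lra|].
        apply Rinv_le_contravar; [apply pow_lt; lra|apply pow_incr; lra]. }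
      apply (Rmult_le_compat_l L) in K2; [|exact HL].
      replace C0 with (2 * (L * (2 / (1 - x) ^ 3))) by (unfold C0; field; lra).
      lra. }
pose (Kf z := (RtoC (weight (alpha + 1) z) * RtoC (/ (alpha + 1)))%C).
pose (Y z := (z * fcoef (-1) F z + Kf z * fcoef 0 H z)%C).
(* [E] is an antiderivative of
   [2 (1 - t^2) (1 + x t^2) / (1 - x t^2)^3 - (1 - t^2) / (2 (1 - x t^2))] with
   [E 1 = 1 / (1 - x)]; the subtracted term is restored in [Psi] with
   [1 - x] in place of [1 - x t^2]. *)
pose (E t := t * ((3 - x * t ^ 2) - t ^ 2 * (1 + x * t ^ 2)) / (2 * (1 - x * t ^ 2) ^ 2)).
pose (Psi t := L / (alpha + 1) * (E t + (t - t ^ 3 / 3) / (2 * (1 - x)))).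
assert (Hw1 : forall t, 0 <= t < 1 -> weight (alpha + 1) (RtoC t) = weight alpha (RtoC t) * (1 - t
    ^ 2)).
{ intros t Ht; rewrite !weight_RtoC, Rpower_plus, Rpower_1; [reflexivity|simpl; nra]. }
assert (HY : forall r, 0 <= r < 1 -> Cmod (Y (RtoC r) - Y (RtoC 0))%C <= Psi r - Psi 0).
{ intros r Hr.
  apply (wirtinger_mean_value Y Psi (fun t => L / (alpha + 1) *
     (2 * (1 - t ^ 2) * ((1 + x * t ^ 2) / (1 - x * t ^ 2) ^ 3) +
        ((1 - t ^ 2) / (2 * (1 - x)) - (1 - t ^ 2) / (2 * (1 - x * t ^ 2)))))); [lra| |].
  - intros t Ht; assert (Ht1 : 0 <= t < 1) by lra; generalize (xr_range t Ht1); simpl; intro.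
    unfold Psi, E; auto_derive; [|field; lra].
    repeat split; repeat apply Rmult_integral_contrapositive_currified; lra.
  - intros t Ht; assert (Ht1 : 0 <= t < 1) by lra.
    pose proof (disk_RtoC t Ht1) as Dt.
    eexists; eexists; split.
    + unfold Y; apply has_wirtinger_plus.
      * apply has_wirtinger_mult; [apply has_wirtinger_id|apply (CA _ Dt)].
      * apply has_wirtinger_mult; [|apply (CH _ Dt)].
        unfold Kf; apply has_wirtinger_mult; [apply (has_wirtinger_weight _ _ Dt)|apply
            has_wirtinger_const].
    + generalize (xr_range t Ht1); intro Hxt.
      pose proof (weight_arg_pos _ Dt) as Hp; rewrite (Cmod_RtoC_pos t) in Hp by lra.
      pose proof (fcoef_angular (-1) F P Q (RtoC t) (ws_F Hsys) cism1 Dt) as K.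
      rewrite Cconj_RtoC in K.
      cbv beta; match goal with |- Cmod ?c <= _ =>
        replace c with (RtoC (2 * (1 - t ^ 2) / (alpha + 1) * weight alpha (RtoC t)) * fcoef (-1) G
            (RtoC t))%C end.
      * rewrite Cmod_mult, Cmod_RtoC_pos.
        -- generalize (fcoef_G_bound (-1) t Ht1); intro K1.
           assert (Hc : 0 <= 2 * (1 - t ^ 2) / (alpha + 1)).
           { apply Rmult_le_pos; [lra|left; apply Rinv_0_lt_compat; lra]. }
           apply (Rmult_le_compat_l _ _ _ Hc) in K1.
           rewrite Rmult_assoc; eapply Rle_trans; [exact K1|].
           assert (/ (1 - x * t ^ 2) <= / (1 - x)) by (apply Rinv_le_contravar; lra).
           assert (0 <= L / (alpha + 1) * ((1 - t ^ 2) / (2 * (1 - x)) - (1 - t ^ 2) / (2 * (1 - x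
               * t ^ 2)))).
           { apply Rmult_le_pos; [apply Rmult_le_pos; [exact HL|left; apply Rinv_0_lt_compat;
               lra]|].
             replace ((1 - t ^ 2) / (2 * (1 - x)) - (1 - t ^ 2) / (2 * (1 - x * t ^ 2))) with
               ((1 - t ^ 2) / 2 * (/ (1 - x) - / (1 - x * t ^ 2))) by (field; lra).
             apply Rmult_le_pos; lra. }
           rewrite Rmult_plus_distr_l.
           replace (2 * (1 - t ^ 2) / (alpha + 1) * (L * ((1 + x * t ^ 2) / (1 - x * t ^ 2) ^ 3)))
               with
             (L / (alpha + 1) * (2 * (1 - t ^ 2) * ((1 + x * t ^ 2) / (1 - x * t ^ 2) ^ 3))) by
                 (field; lra).
           lra.
        -- apply Rmult_le_pos; [apply Rmult_le_pos; [lra|left; apply Rinv_0_lt_compat; lra]|left;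
            apply weight_pos].
      * transitivity ((fcoef (-1) F (RtoC t) + (RtoC t * fcoef (-1 - 1) P (RtoC t) - RtoC t * fcoef
          (-1 + 1) Q (RtoC t)))
          + (RtoC 2 * RtoC t * fcoef (-1 + 1) Q (RtoC t) - RtoC (2 * t * weight alpha (RtoC t)) *
              fcoef 0 H (RtoC t))
          + Kf (RtoC t) * (fcoef (0 - 1) G (RtoC t) + fcoef (0 + 1) Hb (RtoC t)))%C.
        -- rewrite <- K, (Hang t Ht1), (fcoef_Q _ t Ht1); replace (-1 + 1) with 0 by ring.
           unfold Kf; rewrite (Hw1 t Ht1).
           replace (2 * (1 - t ^ 2) / (alpha + 1) * weight alpha (RtoC t))
             with (2 * (weight alpha (RtoC t) * (1 - t ^ 2) * / (alpha + 1))) by (field; lra).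
           rewrite !RtoC_mult; ring.
        -- unfold Kf; rewrite Cconj_RtoC, (Hw1 t Ht1), (Cmod_RtoC_pos t) by lra.
           replace (RtoC (- ((alpha + 1) * (weight alpha (RtoC t) * (1 - t ^ 2)) / (1 - t ^ 2))))
             with (- (RtoC (alpha + 1) * RtoC (weight alpha (RtoC t))))%C
             by (rewrite <- RtoC_mult, <- RtoC_opp; apply (f_equal RtoC); field; lra).
           assert (Ea : (RtoC (alpha + 1) * RtoC (/ (alpha + 1)))%C = 1)
             by (rewrite <- RtoC_mult; apply (f_equal RtoC); field; lra).
           rewrite !RtoC_mult.
           transitivity (fcoef (-1) F (RtoC t) + RtoC t * (fcoef (-1 - 1) P (RtoC t) + fcoef (-1 +
               1) Q (RtoC t))
             - RtoC 2 * (RtoC (alpha + 1) * RtoC (/ (alpha + 1))) * RtoC t * RtoC (weight alpha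
                 (RtoC t)) * fcoef 0 H (RtoC t)
             + RtoC (weight alpha (RtoC t)) * RtoC (1 - t ^ 2) * RtoC (/ (alpha + 1)) *
               (fcoef (0 - 1) G (RtoC t) + fcoef (0 + 1) Hb (RtoC t)))%C; [rewrite Ea; ring|ring]. }
assert (HPsi : forall t, 0 <= t < 1 -> Psi t - Psi 0 <= 4 / 3 * (L / (1 - x)) / (alpha + 1)).
{ intros t Ht.
  replace (Psi 0) with 0 by (unfold Psi, E; field; lra); rewrite Rminus_0_r; unfold Psi.
  replace (4 / 3 * (L / (1 - x)) / (alpha + 1)) with (L / (alpha + 1) * (1 / (1 - x) + 2 / 3 / (2 *
      (1 - x)))) by (field; lra).
  apply Rmult_le_compat_l; [apply Rmult_le_pos; [exact HL|left; apply Rinv_0_lt_compat; lra]|].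
  generalize (xr_range t Ht); intro Hxt.
  apply Rplus_le_compat.
  - unfold E.
    apply (Rmult_le_reg_r (2 * (1 - x * t ^ 2) ^ 2 * (1 - x))).
    + apply Rmult_lt_0_compat; [apply Rmult_lt_0_compat; [lra|apply pow_lt; lra]|lra].
    + replace (t * (3 - x * t ^ 2 - t ^ 2 * (1 + x * t ^ 2)) / (2 * (1 - x * t ^ 2) ^ 2) * (2 * (1
        - x * t ^ 2) ^ 2 * (1 - x)))
        with (t * (3 - x * t ^ 2 - t ^ 2 * (1 + x * t ^ 2)) * (1 - x)) by (field; lra).
      replace (1 / (1 - x) * (2 * (1 - x * t ^ 2) ^ 2 * (1 - x))) with (2 * (1 - x * t ^ 2) ^ 2) by
          (field; lra).
      assert (0 <= (1 - t) ^ 2 * (2 + t + x * t * (2 * t + 3) + x * (1 - x) * t ^ 3)).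
      { assert (0 <= x * t) by (apply Rmult_le_pos; lra).
        assert (0 <= t ^ 3) by (apply pow_le; lra).
        apply Rmult_le_pos; [apply pow2_ge_0|].
        assert (0 <= x * t * (2 * t + 3)) by (apply Rmult_le_pos; lra).
        assert (0 <= x * (1 - x) * t ^ 3) by (apply Rmult_le_pos; [apply Rmult_le_pos;
            lra|assumption]).
        lra. }
      apply Rminus_le.
      replace (t * (3 - x * t ^ 2 - t ^ 2 * (1 + x * t ^ 2)) * (1 - x) - 2 * (1 - x * t ^ 2) ^ 2)
          with
        (- ((1 - t) ^ 2 * (2 + t + x * t * (2 * t + 3) + x * (1 - x) * t ^ 3))) by ring.
      lra.
  - unfold Rdiv; apply Rmult_le_compat_r; [left; apply Rinv_0_lt_compat; lra|].
    assert (0 <= (1 - t) * (2 - t - t * t)) by (apply Rmult_le_pos; nra).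
    simpl; nra. }
assert (D0 : disk 0) by (unfold disk; rewrite Cmod_0; lra).
assert (Y0 : Y (RtoC 0) = (RtoC (/ (alpha + 1)) * H 0)%C).
{ unfold Y, Kf; rewrite fcoef_0_origin.
  replace (weight (alpha + 1) (RtoC 0)) with 1; [ring|].
  rewrite weight_RtoC; replace (1 - 0 ^ 2) with 1 by ring.
  unfold Rpower; rewrite ln_1, Rmult_0_r, exp_0; reflexivity. }
assert (EQ0 : Q 0 = H 0).
{ rewrite (ws_weight Hsys 0%C D0).
  replace (weight alpha 0) with 1; [ring|].
  rewrite (weight_RtoC alpha 0); replace (1 - 0 ^ 2) with 1 by ring.
  unfold Rpower; rewrite ln_1, Rmult_0_r, exp_0; reflexivity. }
assert (Hfin : Cmod (RtoC (/ (alpha + 1)) * H 0)%C <= M + 4 / 3 * (L / (1 - x)) / (alpha + 1)).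
{ apply le_of_le_eps; intros eps He.
  assert (He2 : 0 < eps / 2) by lra.
  destruct (HM (eps / 2) He2) as [rho [Hrho K]].
  pose (D := (C0 + Cmod (H 0)) / (alpha + 1)).
  assert (HD : 0 <= D).
  { apply Rmult_le_pos; [generalize (Cmod_ge_0 (H 0%C)); lra|left; apply Rinv_0_lt_compat; lra]. }
  pose (r := Rmax (Rmax rho 0) (1 - eps / 2 / (2 * D + 1))).
  assert (Hed : 0 < eps / 2 / (2 * D + 1)) by (apply Rdiv_lt_0_compat; lra).
  assert (Hr1 : r < 1) by (repeat apply Rmax_lub_lt; lra).
  assert (Hr3 : Rmax rho 0 <= r) by apply Rmax_l.
  assert (Hr0 : 0 <= r) by (eapply Rle_trans; [apply Rmax_r|exact Hr3]).
  assert (Hr2 : rho <= r) by (eapply Rle_trans; [apply Rmax_l|exact Hr3]).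
  assert (Hr4 : 1 - eps / 2 / (2 * D + 1) <= r) by apply Rmax_r.
  assert (Hr : 0 <= r < 1) by lra.
  pose proof (fcoef_F_near (-1) r (eps / 2) rho K Hr2 Hr) as K1.
  pose proof (HY r Hr) as K2; pose proof (HPsi r Hr) as K3; rewrite Y0 in K2.
  assert (K4 : Cmod (Kf (RtoC r) * fcoef 0 H (RtoC r))%C <= (1 - r ^ 2) * D).
  { unfold Kf; rewrite !Cmod_mult, (Hw1 r Hr), !Cmod_RtoC_pos.
    - assert (K5 : weight alpha (RtoC r) * Cmod (fcoef 0 H (RtoC r)) <= C0 + Cmod (H 0)).
      { pose proof (HB r Hr) as K6.
        pose proof (weight_pos alpha (RtoC r)) as W0.
        pose proof (weight_le_1 alpha (RtoC r) Halpha (disk_RtoC r Hr)) as W1.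
        assert (Cmod (fcoef 0 H (RtoC r)) <= Cmod (fcoef 0 H (RtoC r) - H 0)%C + Cmod (H 0)).
        { replace (fcoef 0 H (RtoC r)) with ((fcoef 0 H (RtoC r) - H 0%C) + H 0%C)%C at 1 by ring.
          apply Cmod_triangle. }
        generalize (Cmod_ge_0 (H 0%C)); nra. }
      unfold D; apply (Rmult_le_compat_l ((1 - r ^ 2) / (alpha + 1))) in K5.
      + eapply Rle_trans; [|eapply Rle_trans; [exact K5|]]; right; field; lra.
      + apply Rmult_le_pos; [simpl; nra|left; apply Rinv_0_lt_compat; lra].
    - left; apply Rinv_0_lt_compat; lra.
    - apply Rmult_le_pos; [left; apply weight_pos|simpl; nra]. }
  assert (K5 : (1 - r ^ 2) * D <= eps / 2).
  { assert (1 - r ^ 2 <= 2 * (1 - r)) by (simpl; nra).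
    assert ((1 - r) * (2 * D + 1) <= eps / 2).
    { replace (eps / 2) with (eps / 2 / (2 * D + 1) * (2 * D + 1)) by (field; lra).
      apply Rmult_le_compat_r; lra. }
    nra. }
  replace (RtoC (/ (alpha + 1)) * H 0)%C with
    ((RtoC r * fcoef (-1) F (RtoC r) + Kf (RtoC r) * fcoef 0 H (RtoC r)) + - (Y (RtoC r) - RtoC (/
        (alpha + 1)) * H 0%C))%C
    by (unfold Y; ring).
  eapply Rle_trans; [apply Cmod_triangle|]; rewrite Cmod_opp.
  assert (Cmod (RtoC r * fcoef (-1) F (RtoC r) + Kf (RtoC r) * fcoef 0 H (RtoC r))%C <= (M + eps /
      2) + eps / 2).
  { eapply Rle_trans; [apply Cmod_triangle|].
    assert (Cmod (RtoC r * fcoef (-1) F (RtoC r))%C <= M + eps / 2).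
    { rewrite Cmod_mult, Cmod_RtoC_pos by lra; generalize (Cmod_ge_0 (fcoef (-1) F (RtoC r)));
        nra. }
    lra. }
  lra. }
rewrite EQ0.
rewrite Cmod_mult, Cmod_RtoC_pos in Hfin by (left; apply Rinv_0_lt_compat; lra).
apply (Rmult_le_compat_l (alpha + 1)) in Hfin; [|lra].
rewrite <- Rmult_assoc, Rinv_r, Rmult_1_l in Hfin by lra.
eapply Rle_trans; [exact Hfin|]; right; field; lra.
Qed.

End Origin.

(** * Moebius covariance *)

Lemma C1_wirtinger_eq (F P Q F' P' Q' : C -> C) :
  C1_wirtinger F P Q -> (forall z, F z = F' z) -> (forall z, P z = P' z) ->
      (forall z, Q z = Q' z) ->
  C1_wirtinger F' P' Q'.
Proof.
intros H EF EP EQ z Hz; destruct (H z Hz) as (H1 & H2 & H3); split; [|split].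
- apply (has_wirtinger_ext F); [exact EF|].
  apply (has_wirtinger_eq _ _ _ _ _ _ H1); [apply EP|apply EQ].
- apply (continuous_ext _ _ _ EP H2).
- apply (continuous_ext _ _ _ EQ H3).
Qed.

Lemma C1_wirtinger_mult (F P Q F' P' Q' : C -> C) :
  C1_wirtinger F P Q -> C1_wirtinger F' P' Q' ->
  C1_wirtinger (fun z => F z * F' z)%C (fun z => P z * F' z + F z * P' z)%C
    (fun z => Q z * F' z + F z * Q' z)%C.
Proof.
intros H H' z Hz; destruct (H z Hz) as (H1 & H2 & H3), (H' z Hz) as (H1' & H2' & H3').
pose proof (has_wirtinger_continuous _ _ _ _ H1); pose proof (has_wirtinger_continuous _ _ _ _ H1').
split; [apply has_wirtinger_mult; assumption|split; ccont].
Qed.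

Lemma C1_wirtinger_conj (F P Q : C -> C) :
  C1_wirtinger F P Q ->
  C1_wirtinger (fun z => Cconj (F z)) (fun z => Cconj (Q z)) (fun z => Cconj (P z)).
Proof.
intros H z Hz; destruct (H z Hz) as (H1 & H2 & H3).
split; [apply has_wirtinger_conj; assumption|split; ccont].
Qed.

Definition holomorphic_C1 (F P : C -> C) : Prop := C1_wirtinger F P (fun _ => RtoC 0).

Lemma C1_wirtinger_comp (F P Q phi phi' : C -> C) :
  C1_wirtinger F P Q -> holomorphic_C1 phi phi' -> (forall z, disk z -> disk (phi z)) ->
  C1_wirtinger (fun z => F (phi z)) (fun z => P (phi z) * phi' z)%C
    (fun z => Q (phi z) * Cconj (phi' z))%C.
Proof.
intros H Hphi HD z Hz; destruct (Hphi z Hz) as (K1 & K2 & _), (H _ (HD z Hz)) as (H1 & H2 & H3).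
pose proof (has_wirtinger_continuous _ _ _ _ K1) as K0.
pose proof (ccontinuous_comp phi P z K0 H2); pose proof (ccontinuous_comp phi Q z K0 H3).
split; [|split; ccont].
eapply has_wirtinger_eq; [apply (has_wirtinger_comp F phi); eassumption| |];
  rewrite ?Cconj_RtoC; ring.
Qed.

Lemma holomorphic_C1_mult (F P F' P' : C -> C) :
  holomorphic_C1 F P -> holomorphic_C1 F' P' ->
  holomorphic_C1 (fun z => F z * F' z)%C (fun z => P z * F' z + F z * P' z)%C.
Proof.
intros H H'; eapply C1_wirtinger_eq; [apply (C1_wirtinger_mult _ _ _ _ _ _ H H')| | |];
  intro z; cbv beta; ring.
Qed.

Definition moebius (a z : C) : C := ((z + a) * / (1 + Cconj a * z))%C.

Definition moebius' (a z : C) : C :=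
  (RtoC (1 - Cmod a ^ 2) * (/ (1 + Cconj a * z) * / (1 + Cconj a * z)))%C.

(** After multiplication by [|1 + conj a z|^2] this is
    [|1 + conj a z|^2 - |z + a|^2 = (1 - |z|^2) (1 - |a|^2)]. *)
Lemma moebius_identity (a z : C) : disk a -> Cmod z <= 1 ->
  1 - Cmod (moebius a z) ^ 2 =
  (1 - Cmod z ^ 2) * (1 - Cmod a ^ 2) / Cmod (1 + Cconj a * z)%C ^ 2.
Proof.
intros Ha Hz; pose proof (one_plus_neq_0 a z Ha Hz) as N.
assert (N2 : Cmod (1 + Cconj a * z)%C <> 0) by (intro K; apply N, Cmod_eq_0, K).
unfold moebius; rewrite Cmod_mult, Cmod_inv by exact N.
apply (Rmult_eq_reg_r (Cmod (1 + Cconj a * z)%C ^ 2)); [|apply pow_nonzero, N2].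
replace ((1 - Cmod z ^ 2) * (1 - Cmod a ^ 2) / Cmod (1 + Cconj a * z)%C ^ 2 * Cmod (1 + Cconj a *
    z)%C ^ 2)
  with ((1 - Cmod z ^ 2) * (1 - Cmod a ^ 2)) by (field; exact N2).
replace ((1 - (Cmod (z + a)%C * / Cmod (1 + Cconj a * z)%C) ^ 2) * Cmod (1 + Cconj a * z)%C ^ 2)
  with (Cmod (1 + Cconj a * z)%C ^ 2 - Cmod (z + a)%C ^ 2) by (field; exact N2).
rewrite !Cmod_sqr; destruct a, z; simpl; ring.
Qed.

Lemma disk_moebius (a z : C) : disk a -> disk z -> disk (moebius a z).
Proof.
intros Ha Hz; pose proof (moebius_identity a z Ha (Rlt_le _ _ Hz)) as E.
assert (0 < (1 - Cmod z ^ 2) * (1 - Cmod a ^ 2) / Cmod (1 + Cconj a * z)%C ^ 2).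
{ apply Rdiv_lt_0_compat.
  - apply Rmult_lt_0_compat; apply weight_arg_pos; assumption.
  - apply pow_lt, Cmod_gt_0, one_plus_neq_0; [exact Ha|left; exact Hz]. }
unfold disk; generalize (Cmod_ge_0 (moebius a z)); simpl in *; nra.
Qed.

Lemma holomorphic_moebius (a : C) : disk a -> holomorphic_C1 (moebius a) (moebius' a).
Proof.
intros Ha.
assert (H1 : holomorphic_C1 (fun z => z + a)%C (fun _ => RtoC 1)).
{ intros z _; split; [|split; apply continuous_const].
  eapply has_wirtinger_eq; [apply has_wirtinger_plus;
      [apply has_wirtinger_id|apply has_wirtinger_const]| |];
    ring. }
intros z Hz.
pose proof (one_plus_neq_0 a z Ha (Rlt_le _ _ Hz)) as N.
destruct (holomorphic_C1_mult _ _ _ _ H1 (C1_wirtinger_inv_one_plus a Ha) z Hz) as (K1 & _ & K3).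
split; [|split; [|exact K3]].
- apply (has_wirtinger_eq _ _ _ _ _ _ K1); [|reflexivity].
  unfold moebius'; rewrite RtoC_minus, Cmod2_conj; field; exact N.
- assert (ccont_at (fun z => / (1 + Cconj a * z))%C z)
    by (apply continuous_Cinv; [ccont|exact N]).
  unfold moebius'; apply continuous_Cmult; [apply continuous_const|apply continuous_Cmult;
      assumption].
Qed.

Lemma holomorphic_cpow_one_plus (a : C) (s : R) : disk a ->
  holomorphic_C1 (fun z => cpow (1 + Cconj a * z) s)%C
    (fun z => RtoC s * cpow (1 + Cconj a * z) s * / (1 + Cconj a * z) * Cconj a)%C.
Proof.
intros Ha z Hz.
pose proof (one_plus_neq_0 a z Ha (Rlt_le _ _ Hz)) as N.
assert (K : has_wirtinger (fun z => cpow (1 + Cconj a * z) s)%C z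
   (RtoC s * cpow (1 + Cconj a * z) s * / (1 + Cconj a * z) * Cconj a)%C 0).
{ eapply has_wirtinger_eq.
  - apply (has_wirtinger_comp (fun w => cpow w s)); [apply has_wirtinger_one_plus|].
    apply has_wirtinger_cpow, Re_1_plus_pos; [exact Ha|left; exact Hz].
  - cbv beta; ring.
  - cbv beta; ring. }
split; [exact K|split; [|apply continuous_const]].
pose proof (has_wirtinger_continuous _ _ _ _ K).
assert (ccont_at (fun z => / (1 + Cconj a * z))%C z)
  by (apply continuous_Cinv; [ccont|exact N]).
ccont.
Qed.

Lemma cpow_0 (z : C) : cpow z 0 = 1.
Proof. 
unfold cpow; rewrite Cmult_0_l; unfold cexp; simpl; rewrite exp_0, cis_0; ring.
Qed.

(** The change of unknown [F = (1 + conj a z)^alpha f(phi)] with [phi = moebius a]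
    turns a solution into a solution: the factor [|phi'|^(- alpha)] produced by
    the weight splits into a holomorphic half, which commutes with the
    [conj z]-derivative and is absorbed by [F], and an antiholomorphic half,
    which commutes with the [z]-derivative and is absorbed by [H]. *)
Definition transport (alpha : R) (a : C) (f : C -> C) (z : C) : C :=
  (cpow (1 + Cconj a * z) alpha * f (moebius a z))%C.

Definition transport_flux (alpha : R) (a : C) (h : C -> C) (z : C) : C :=
  (RtoC (Rpower (1 - Cmod a ^ 2) (alpha + 1)) *
   (Cconj (cpow (1 + Cconj a * z) (- alpha) * (/ (1 + Cconj a * z) * / (1 + Cconj a * z)))
    * h (moebius a z)))%C.

(** The source is the [z]-derivative of the flux: its first two factors are a
    constant and an antiholomorphic function. *)
Definition transport_source (alpha : R) (a : C) (g : C -> C) (z : C) : C :=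
  (RtoC (Rpower (1 - Cmod a ^ 2) (alpha + 1)) *
   (Cconj (cpow (1 + Cconj a * z) (- alpha) * (/ (1 + Cconj a * z) * / (1 + Cconj a * z)))
    * (g (moebius a z) * moebius' a z)))%C.

Definition transport_dz (alpha : R) (a : C) (f p : C -> C) (z : C) : C :=
  (RtoC alpha * cpow (1 + Cconj a * z) alpha * / (1 + Cconj a * z) * Cconj a * f (moebius a z)
   + cpow (1 + Cconj a * z) alpha * (p (moebius a z) * moebius' a z))%C.

Definition transport_dzbar (alpha : R) (a : C) (q : C -> C) (z : C) : C :=
  (cpow (1 + Cconj a * z) alpha * (q (moebius a z) * Cconj (moebius' a z)))%C.

Lemma transport_system (alpha : R) (a : C) (f p q h g hb : C -> C) :
  disk a -> weighted_system alpha f p q h g hb ->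
  exists Hb, weighted_system alpha (transport alpha a f) (transport_dz alpha a f p)
    (transport_dzbar alpha a q) (transport_flux alpha a h) (transport_source alpha a g) Hb.
Proof.
intros Ha [Hf Hh Hw].
pose proof (holomorphic_moebius a Ha) as Hm.
pose proof (fun z => disk_moebius a z Ha) as Dm.
pose proof (C1_wirtinger_inv_one_plus a Ha) as Hi.
pose proof (C1_wirtinger_conj _ _ _ (holomorphic_C1_mult _ _ _ _ (holomorphic_cpow_one_plus a (-
    alpha) Ha)
   (holomorphic_C1_mult _ _ _ _ Hi Hi))) as Hu.
eexists; split.
- eapply C1_wirtinger_eq.
  + apply (C1_wirtinger_mult _ _ _ _ _ _ (holomorphic_cpow_one_plus a alpha Ha) (C1_wirtinger_comp
      _ _ _ _ _ Hf Hm Dm)).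
  + reflexivity.
  + reflexivity.
  + intro z; unfold transport_dzbar; cbv beta; ring.
- eapply C1_wirtinger_eq.
  + apply (C1_wirtinger_mult _ _ _ _ _ _ (C1_wirtinger_const (RtoC (Rpower (1 - Cmod a ^ 2) (alpha
      + 1))))
      (C1_wirtinger_mult _ _ _ _ _ _ Hu (C1_wirtinger_comp _ _ _ _ _ Hh Hm Dm))).
  + reflexivity.
  + intro z; unfold transport_source; cbv beta; rewrite Cconj_RtoC; ring.
  + intro z; cbv beta; reflexivity.
- intros z Hz.
  pose proof (one_plus_neq_0 a z Ha (Rlt_le _ _ Hz)) as N.
  pose proof (proj1 (Cmod_gt_0 _) N) as Np.
  unfold transport_dzbar, transport_flux; rewrite (Hw _ (Dm z Hz)).
  set (c := (1 + Cconj a * z)%C) in *.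
  assert (Ew : weight alpha (moebius a z) =
    weight alpha z * (Rpower (1 - Cmod a ^ 2) alpha * Rpower (Cmod c ^ 2) (- alpha))).
  { unfold weight; rewrite moebius_identity by (try exact Ha; left; exact Hz); fold c.
    pose proof (weight_arg_pos z Hz); pose proof (weight_arg_pos a Ha).
    unfold Rdiv.
    rewrite Rpower_Ropp.
    assert (0 < Cmod c ^ 2) by (apply pow_lt, Np).
    assert (0 < / Cmod c ^ 2) by (apply Rinv_0_lt_compat; assumption).
    rewrite <- !Rpower_mult_distr by (try assumption; apply Rmult_lt_0_compat; assumption).
    rewrite Rmult_assoc; do 2 f_equal.
    unfold Rpower; rewrite ln_Rinv by assumption.
    rewrite <- exp_Ropp; f_equal; ring. }
  rewrite Ew, !RtoC_mult, <- (cpow_conj_mult c (- alpha) N).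
  assert (Ec : (cpow c alpha * cpow c (- alpha))%C = 1) by (rewrite <- cpow_plus, Rplus_opp_r;
      apply cpow_0).
  rewrite (Rpower_plus alpha 1), Rpower_1 by (apply weight_arg_pos, Ha).
  unfold moebius'; fold c; rewrite !Cmult_conj, Cconj_RtoC, RtoC_mult.
  transitivity ((cpow c alpha * cpow c (- alpha)) * (RtoC (weight alpha z) *
     (RtoC (Rpower (1 - Cmod a ^ 2) alpha) * RtoC (1 - Cmod a ^ 2) *
       (Cconj (cpow c (- alpha)) * (Cconj (/ c) * Cconj (/ c)) * h (moebius a z)))))%C;
           [ring|rewrite Ec; ring].
Qed.

Lemma Rpower_pos (x s : R) : 0 < Rpower x s.
Proof. apply exp_pos. Qed.

Lemma Cmod_one_plus_le_2 (a z : C) : disk a -> disk z -> Cmod (1 + Cconj a * z)%C <= 2.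
Proof.
intros Ha Hz; eapply Rle_trans; [apply Cmod_triangle|].
rewrite Cmod_1, Cmod_mult, Cmod_conj; unfold disk in *.
generalize (Cmod_ge_0 a) (Cmod_ge_0 z); nra.
Qed.

(** The modulus of the source is
    [(1 - |a|^2)^(alpha + 2) |g(phi)| / |1 + conj a z|^(alpha + 4)], and
    [(1 - |z|^2) (1 - |a|^2) <= |1 + conj a z|^2 <= 2 |1 + conj a z|] by
    [moebius_identity]. *)
Lemma transport_source_bound (alpha Lg : R) (a : C) (g : C -> C) :
  0 <= alpha -> disk a -> 0 <= Lg -> (forall z, disk z -> Cmod (g z) <= Lg) ->
  forall z, disk z -> weight alpha z * Cmod (transport_source alpha a g z) <=
    (Rpower 2 alpha * (1 - Cmod a ^ 2) ^ 2 * Lg) * / Cmod (1 + Cconj a * z)%C ^ 4.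
Proof.
intros Halpha Ha HL Hg z Hz.
pose proof (one_plus_neq_0 a z Ha (Rlt_le _ _ Hz)) as N.
pose proof (proj1 (Cmod_gt_0 _) N) as Np.
pose proof (weight_arg_pos z Hz) as Wz; pose proof (weight_arg_pos a Ha) as Wa.
pose proof (Cmod_one_plus_le_2 a z Ha Hz) as N2.
pose proof (moebius_identity a z Ha (Rlt_le _ _ Hz)) as E.
unfold transport_source, moebius'.
set (c := (1 + Cconj a * z)%C) in *.
rewrite !Cmod_mult, Cmod_conj, !Cmod_mult, !Cmod_inv, Cmod_cpow by exact N.
rewrite !Cmod_RtoC_pos by (left; apply Rpower_pos || exact Wa).
assert (K : (1 - Cmod z ^ 2) * (1 - Cmod a ^ 2) * / Cmod c <= 2).
{ apply (Rmult_le_reg_r (Cmod c)); [exact Np|].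
  rewrite Rmult_assoc, Rinv_l, Rmult_1_r by lra.
  assert (K0 : (1 - Cmod z ^ 2) * (1 - Cmod a ^ 2) = (1 - Cmod (moebius a z) ^ 2) * Cmod c ^ 2)
    by (rewrite E; field; lra).
  assert (K1 : (1 - Cmod (moebius a z) ^ 2) * Cmod c ^ 2 <= 1 * Cmod c ^ 2).
  { apply Rmult_le_compat_r; [apply pow2_ge_0|]; generalize (pow2_ge_0 (Cmod (moebius a z))); lra. }
  simpl in *; nra. }
assert (Ki : 0 < / Cmod c) by (apply Rinv_0_lt_compat, Np).
assert (K2 : weight alpha z * (Rpower (1 - Cmod a ^ 2) alpha * Rpower (Cmod c) (- alpha)) <= Rpower
    2 alpha).
{ replace (Rpower (Cmod c) (- alpha)) with (Rpower (/ Cmod c) alpha).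
  - unfold weight; rewrite Rpower_mult_distr by assumption.
    rewrite Rpower_mult_distr by (try assumption; apply Rmult_lt_0_compat; assumption).
    apply Rle_Rpower_l; [exact Halpha|split].
    + repeat apply Rmult_lt_0_compat; assumption.
    + rewrite <- Rmult_assoc; exact K.
  - unfold Rpower; rewrite ln_Rinv by exact Np; f_equal; ring. }
specialize (Hg _ (disk_moebius a z Ha Hz)).
rewrite (Rpower_plus alpha 1), Rpower_1 by exact Wa.
replace (weight alpha z * (Rpower (1 - Cmod a ^ 2) alpha * (1 - Cmod a ^ 2) *
   (Rpower (Cmod c) (- alpha) * (/ Cmod c * / Cmod c) *
   (Cmod (g (moebius a z)) * ((1 - Cmod a ^ 2) * (/ Cmod c * / Cmod c)))))) with
  ((weight alpha z * (Rpower (1 - Cmod a ^ 2) alpha * Rpower (Cmod c) (- alpha))) *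
    (Cmod (g (moebius a z)) * ((1 - Cmod a ^ 2) ^ 2 * / Cmod c ^ 4))) by (field; lra).
assert (0 <= (1 - Cmod a ^ 2) ^ 2 * / Cmod c ^ 4).
{ apply Rmult_le_pos; [apply pow2_ge_0|left; apply Rinv_0_lt_compat, pow_lt, Np]. }
replace (Rpower 2 alpha * (1 - Cmod a ^ 2) ^ 2 * Lg * / Cmod c ^ 4) with
  (Rpower 2 alpha * (Lg * ((1 - Cmod a ^ 2) ^ 2 * / Cmod c ^ 4))) by ring.
apply Rmult_le_compat.
- apply Rmult_le_pos; [left; apply weight_pos|]; left; apply Rmult_lt_0_compat; apply Rpower_pos.
- apply Rmult_le_pos; [apply Cmod_ge_0|assumption].
- exact K2.
- apply Rmult_le_compat_r; assumption.
Qed.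

(** By [moebius_identity], [phi(z)] tends to the circle uniformly when [z] does. *)
Lemma transport_boundary_bound (alpha M : R) (a : C) (f : C -> C) :
  0 <= alpha -> disk a -> boundary_bound f M ->
  boundary_bound (transport alpha a f) (Rpower 2 alpha * M).
Proof.
intros Halpha Ha HM eps He.
pose proof (Rpower_pos 2 alpha) as R2.
assert (He2 : 0 < eps / Rpower 2 alpha) by (apply Rdiv_lt_0_compat; assumption).
destruct (HM _ He2) as [rho [Hrho K]].
pose (r1 := Rmax rho 0).
assert (H1 : r1 < 1) by (apply Rmax_lub_lt; lra).
assert (H2 : 0 <= r1) by apply Rmax_r.
assert (H3 : rho <= r1) by apply Rmax_l.
assert (Hr1 : 0 < 1 - r1 ^ 2) by (simpl; nra).
assert (Ha1 : 0 < (1 - Cmod a) ^ 2) by (apply pow_lt; unfold disk in Ha; lra).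
exists (1 - (1 - r1 ^ 2) * (1 - Cmod a) ^ 2 / 2); split; [nra|].
intros z Hz Hzr.
pose proof (one_plus_neq_0 a z Ha (Rlt_le _ _ Hz)) as N.
pose proof (proj1 (Cmod_gt_0 _) N) as Np.
pose proof (weight_arg_pos z Hz) as Wz; pose proof (weight_arg_pos a Ha) as Wa.
pose proof (moebius_identity a z Ha (Rlt_le _ _ Hz)) as E.
assert (Hc : 1 - Cmod a <= Cmod (1 + Cconj a * z)%C).
{ assert (K1 : Cmod 1 <= Cmod (1 + Cconj a * z)%C + Cmod (- (Cconj a * z))%C).
  { replace (RtoC 1) with ((1 + Cconj a * z) + - (Cconj a * z))%C at 1 by ring;
      apply Cmod_triangle. }
  rewrite Cmod_1, Cmod_opp, Cmod_mult, Cmod_conj in K1; unfold disk in *.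
  generalize (Cmod_ge_0 a); nra. }
assert (Hphi : rho <= Cmod (moebius a z)).
{ apply Rle_trans with r1; [exact H3|].
  assert (Hz2 : 1 - Cmod z ^ 2 <= (1 - r1 ^ 2) * (1 - Cmod a) ^ 2).
  { assert (1 - Cmod z ^ 2 <= 2 * (1 - Cmod z)) by (generalize (pow2_ge_0 (1 - Cmod z)); simpl;
      nra). lra. }
  assert (Hc2 : (1 - Cmod a) ^ 2 <= Cmod (1 + Cconj a * z)%C ^ 2).
  { apply pow_incr; unfold disk in Ha; lra. }
  assert (K2 : 1 - Cmod (moebius a z) ^ 2 <= 1 - r1 ^ 2).
  { rewrite E; apply (Rmult_le_reg_r (Cmod (1 + Cconj a * z)%C ^ 2)); [apply pow_lt, Np|].
    unfold Rdiv; rewrite Rmult_assoc, Rinv_l, Rmult_1_r by (apply pow_nonzero; lra).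
    assert ((1 - Cmod z ^ 2) * (1 - Cmod a ^ 2) <= (1 - Cmod z ^ 2) * 1).
    { apply Rmult_le_compat_l; [lra|]; generalize (pow2_ge_0 (Cmod a)); lra. }
    assert ((1 - r1 ^ 2) * (1 - Cmod a) ^ 2 <= (1 - r1 ^ 2) * Cmod (1 + Cconj a * z)%C ^ 2)
      by (apply Rmult_le_compat_l; lra).
    lra. }
  generalize (Cmod_ge_0 (moebius a z)); simpl in K2; nra. }
specialize (K _ (disk_moebius a z Ha Hz) Hphi).
unfold transport; rewrite Cmod_mult, Cmod_cpow by exact N.
replace (Rpower 2 alpha * M + eps) with (Rpower 2 alpha * (M + eps / Rpower 2 alpha)) by (field;
    lra).
apply Rmult_le_compat; [left; apply Rpower_pos|apply Cmod_ge_0| |exact K].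
apply Rle_Rpower_l; [exact Halpha|split; [exact Np|apply Cmod_one_plus_le_2; assumption]].
Qed.

(** The estimates at the origin for the transported solution; the term
    [alpha conj a f(a)] in its [z]-derivative is absorbed by [origin_value]. *)
Lemma gradient_estimate (alpha M Lg : R) (f p q h g hb : C -> C) (a : C) :
  0 <= alpha -> weighted_system alpha f p q h g hb -> 0 <= Lg ->
  (forall z, disk z -> Cmod (g z) <= Lg) -> boundary_bound f M -> disk a ->
  Cmod (p a) + Cmod (q a) <=
    (alpha + 1) * Rpower 2 (alpha + 1) * M * (1 / (1 - Cmod a ^ 2))
    + (alpha + 4 / 3) * Rpower 2 (alpha + 1) * Lg.
Proof.
intros Halpha Hsys HL Hg HM Ha.
destruct (transport_system alpha a f p q h g hb Ha Hsys) as [Hb HT].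
set (x := Cmod a ^ 2).
pose proof (weight_arg_pos a Ha) as Hx; fold x in Hx.
pose proof (Rpower_pos 2 alpha) as R2.
pose (L := Rpower 2 alpha * (1 - Cmod a ^ 2) ^ 2 * Lg).
assert (HLL : 0 <= L).
{ unfold L; apply Rmult_le_pos; [apply Rmult_le_pos; [lra|apply pow2_ge_0]|exact HL]. }
pose proof (transport_source_bound alpha Lg a g Halpha Ha HL Hg) as HG.
pose proof (transport_boundary_bound alpha M a f Halpha Ha HM) as HMT.
pose proof (origin_value alpha _ _ _ _ _ _ a L _ Halpha HT Ha HLL HG HMT) as E0.
pose proof (origin_dz alpha _ _ _ _ _ _ a L _ Halpha HT Ha HLL HG HMT) as E1.
pose proof (origin_dzbar alpha _ _ _ _ _ _ a L _ Halpha HT Ha HLL HG HMT) as E2.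
unfold transport, transport_dz, transport_dzbar, moebius', moebius in E0, E1, E2.
replace (1 + Cconj a * 0)%C with (RtoC 1) in E0, E1, E2 by ring.
replace ((0 + a) * / 1)%C with a in E0, E1, E2 by field.
rewrite cpow_1 in E0, E1, E2; fold x in E0, E1, E2.
replace (/ 1 * / 1)%C with (RtoC 1) in E1, E2 by field.
rewrite Cmult_1_l in E0.
replace (RtoC alpha * 1 * / 1 * Cconj a * f a + 1 * (p a * (RtoC (1 - x) * 1)))%C with
  (RtoC (1 - x) * p a + RtoC alpha * (Cconj a * f a))%C in E1 by field.
replace (1 * (q a * Cconj (RtoC (1 - x) * 1)))%C with (RtoC (1 - x) * q a)%C in E2
  by (rewrite Cmult_1_r, Cconj_RtoC; ring).
rewrite Cmod_mult, Cmod_RtoC_pos in E2 by lra.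
assert (E3 : (1 - x) * Cmod (p a) <= Cmod (RtoC (1 - x) * p a + RtoC alpha * (Cconj a * f a))%C +
    alpha * Cmod (f a)).
{ replace ((1 - x) * Cmod (p a)) with (Cmod (RtoC (1 - x) * p a)%C) by (rewrite Cmod_mult,
    Cmod_RtoC_pos; lra).
  replace (RtoC (1 - x) * p a)%C with ((RtoC (1 - x) * p a + RtoC alpha * (Cconj a * f a)) + -
      (RtoC alpha * (Cconj a * f a)))%C at 1 by ring.
  eapply Rle_trans; [apply Cmod_triangle|]; apply Rplus_le_compat_l.
  rewrite Cmod_opp, !Cmod_mult, Cmod_conj, Cmod_RtoC_pos by exact Halpha.
  apply Rmult_le_compat_l; [exact Halpha|].
  unfold disk in Ha; generalize (Cmod_ge_0 a) (Cmod_ge_0 (f a)); nra. }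
assert (EL : L / (1 - x) = Rpower 2 alpha * (1 - x) * Lg) by (unfold L; fold x; field; lra).
rewrite EL in E0, E1, E2.
assert (E4 : alpha * Cmod (f a) <= alpha * (Rpower 2 alpha * M + Rpower 2 alpha * (1 - x) * Lg))
  by (apply Rmult_le_compat_l; [exact Halpha|exact E0]).
rewrite (Rpower_plus alpha 1), Rpower_1 by lra.
assert (H0 : 0 <= Rpower 2 alpha * (1 - x) * Lg) by (repeat apply Rmult_le_pos; lra).
assert (H1 : 0 <= alpha * (Rpower 2 alpha * (1 - x) * Lg)) by (apply Rmult_le_pos; assumption).
apply (Rmult_le_reg_l (1 - x)); [exact Hx|].
replace ((1 - x) * ((alpha + 1) * (Rpower 2 alpha * 2) * M * (1 / (1 - x)) + (alpha + 4 / 3) *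
    (Rpower 2 alpha * 2) * Lg))
  with (2 * (alpha + 1) * (Rpower 2 alpha * M) + 2 * (alpha + 4 / 3) * (Rpower 2 alpha * (1 - x) *
      Lg)) by (field; lra).
lra.
Qed.

(** * From twice differentiable solutions to first-order systems *)

Lemma locally_2d_disk (x y : R) : disk (x, y) -> locally_2d (fun a b => disk (a, b)) x y.
Proof.
intros H; apply locally_2d_locally.
apply (filter_imp (fun w : C => disk w)).
- intros [a b] K; exact K.
- apply (proj2 (locally_C_iff (x, y) disk)).
  exists (1 - Cmod (x, y)); split; [unfold disk in H; lra|].
  intros w; apply disk_neighbourhood, H.
Qed.

Lemma ex_diff_1_differentiable (u : R -> R -> R) (x y : R) :
  (forall a b, disk (a, b) -> ex_diff_n u 1 a b) -> disk (x, y) ->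
  differentiable_pt_lim u x y (Derive (fun t => u t y) x) (Derive (fun t => u x t) y).
Proof.
intros H Hxy.
apply (differentiable_of_partials u (fun a b => Derive (fun t => u t b) a) (fun a b => Derive (fun
    t => u a t) b)).
- generalize (locally_2d_disk x y Hxy); apply locally_2d_impl, locally_2d_forall.
  intros a b Hab; destruct (H a b Hab) as (_ & K & _); apply Derive_correct, K.
- destruct (H x y Hxy) as (_ & _ & K & _); apply Derive_correct, K.
- destruct (H x y Hxy) as (_ & _ & _ & K & _); exact (proj1 K).
Qed.

Lemma continuous_of_2d (u : R -> R -> R) (z : C) :
  continuity_2d_pt u (Re z) (Im z) ->
  continuous (T := C_UniformSpace) (fun w : C => u (Re w) (Im w)) z.
Proof.
intros H; apply continuity_2d_pt_filterlim in H; destruct z as [x y]; exact H.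
Qed.

Lemma C1_wirtinger_of_Cm (F : C -> C) : Cm 1 disk F -> C1_wirtinger F (Dz F) (Dzbar F).
Proof.
intros HF z Hz.
assert (Hu : forall a b, disk (a, b) -> ex_diff_n (fun u v => Re (F (u, v))) 1 a b) by (intros;
    apply HF; assumption).
assert (Hv : forall a b, disk (a, b) -> ex_diff_n (fun u v => Im (F (u, v))) 1 a b) by (intros;
    apply HF; assumption).
assert (Hxy : disk (Re z, Im z)) by (destruct z; exact Hz).
destruct (Hu _ _ Hxy) as (_ & _ & _ & Hux & Huy), (Hv _ _ Hxy) as (_ & _ & _ & Hvx & Hvy).
assert (CX : ccont_at (Defs.Dx F) z).
{ apply continuous_pair_C; cbn [Re Im fst snd Defs.Dx].
  - apply (continuous_of_2d (fun a b => Derive (fun u => Re (F (u, b))) a) z), (proj1 Hux).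
  - apply (continuous_of_2d (fun a b => Derive (fun u => Im (F (u, b))) a) z), (proj1 Hvx). }
assert (CY : ccont_at (Dy F) z).
{ apply continuous_pair_C; cbn [Re Im fst snd Dy].
  - apply (continuous_of_2d (fun a b => Derive (fun u => Re (F (a, u))) b) z), (proj1 Huy).
  - apply (continuous_of_2d (fun a b => Derive (fun u => Im (F (a, u))) b) z), (proj1 Hvy). }
split; [|split; [unfold Dz|unfold Dzbar]; ccont].
pose proof (has_wirtinger_of_differentiable F z _ _ _ _
  (ex_diff_1_differentiable _ _ _ Hu Hxy) (ex_diff_1_differentiable _ _ _ Hv Hxy)) as K.
destruct (has_wirtinger_Dz _ _ _ _ K) as [-> ->]; exact K.
Qed.

Lemma C1_wirtinger_plus (F P Q F' P' Q' : C -> C) :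
  C1_wirtinger F P Q -> C1_wirtinger F' P' Q' ->
  C1_wirtinger (fun z => F z + F' z)%C (fun z => P z + P' z)%C (fun z => Q z + Q' z)%C.
Proof.
intros H H' z Hz; destruct (H z Hz) as (H1 & H2 & H3), (H' z Hz) as (H1' & H2' & H3').
split; [apply has_wirtinger_plus; assumption|split; ccont].
Qed.

Lemma C1_wirtinger_weight (s : R) : exists P Q, C1_wirtinger (fun z => RtoC (weight s z)) P Q.
Proof.
exists (fun z => RtoC (- s) * RtoC (weight s z) * / (1 - z * Cconj z) * Cconj z)%C,
  (fun z => RtoC (- s) * RtoC (weight s z) * / (1 - z * Cconj z) * z)%C.
intros z Hz.
pose proof (has_wirtinger_weight s z Hz) as K.
pose proof (has_wirtinger_continuous _ _ _ _ K).
pose proof (weight_arg_pos z Hz) as Hp.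
assert (E : (1 - z * Cconj z)%C = RtoC (1 - Cmod z ^ 2)) by (rewrite <- Cmod2_conj, <- RtoC_minus;
    reflexivity).
assert (N : (1 - z * Cconj z)%C <> 0) by (rewrite E; intro K'; apply RtoC_inj in K'; lra).
assert (ccont_at (fun z => / (1 - z * Cconj z))%C z) by (apply continuous_Cinv; [ccont|exact N]).
split; [|split; ccont].
assert (Ek : RtoC (- (s * weight s z / (1 - Cmod z ^ 2))) = (RtoC (- s) * RtoC (weight s z) * / (1
    - z * Cconj z))%C).
{ rewrite E, <- RtoC_inv, <- !RtoC_mult by lra; f_equal; field; lra. }
apply (has_wirtinger_eq _ _ _ _ _ _ K); rewrite Ek; reflexivity.
Qed.

(** [Dzbar f] is differentiated as a combination of [Dx f] and [Dy f], whose
    components are the first partial derivatives of those of [f]. *)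
Lemma Cm_2_system (alpha : R) (f g : C -> C) :
  Cm 2 disk f -> (forall z, disk z -> weighted_laplacian alpha f z = g z) ->
  exists h hb, weighted_system alpha f (Dz f) (Dzbar f) h g hb.
Proof.
intros Hf Heq.
assert (H1 : Cm 1 disk f).
{ intros x y Hxy; destruct (Hf x y Hxy) as [(A1 & A2 & A3 & A4 & A5) (B1 & B2 & B3 & B4 & B5)].
  split; (split; [assumption|split; [assumption|split; [assumption|split]]]);
    (split; [eapply proj1; eassumption|exact I]). }
assert (HX : Cm 1 disk (Defs.Dx f)).
{ intros x y Hxy; destruct (Hf x y Hxy) as [(_ & _ & _ & A & _) (_ & _ & _ & B & _)]; split;
    assumption. }
assert (HY : Cm 1 disk (Dy f)).
{ intros x y Hxy; destruct (Hf x y Hxy) as [(_ & _ & _ & _ & A) (_ & _ & _ & _ & B)]; split;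
    assumption. }
pose proof (C1_wirtinger_of_Cm f H1) as Cf.
pose proof (C1_wirtinger_mult _ _ _ _ _ _ (C1_wirtinger_const (/ 2)%C)
  (C1_wirtinger_plus _ _ _ _ _ _ (C1_wirtinger_of_Cm _ HX)
     (C1_wirtinger_mult _ _ _ _ _ _ (C1_wirtinger_const Ci) (C1_wirtinger_of_Cm _ HY)))) as Cq.
destruct (C1_wirtinger_weight (- alpha)) as (Pw & Qw & Cw).
pose proof (C1_wirtinger_mult _ _ _ _ _ _ Cw Cq) as Ch.
eexists; eexists; split.
- exact Cf.
- intros z Hz; destruct (Ch z Hz) as (K1 & K2 & K3).
  split; [|split; [|exact K3]].
  + apply (has_wirtinger_eq _ _ _ _ _ _ K1); [|reflexivity].
    rewrite <- (Heq z Hz), <- (proj1 (has_wirtinger_Dz _ _ _ _ K1)); reflexivity.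
  + eapply continuous_ext_loc; [|exact K2].
    apply locally_C_iff; exists (1 - Cmod z); split; [unfold disk in Hz; lra|].
    intros w Hw; pose proof (disk_neighbourhood z Hz w Hw) as Dw.
    destruct (Ch w Dw) as (K1' & _ & _).
    rewrite <- (Heq w Dw), <- (proj1 (has_wirtinger_Dz _ _ _ _ K1')); reflexivity.
- intros z Hz; cbv beta.
  change (/ 2 * (Defs.Dx f z + Ci * Dy f z))%C with (Dzbar f z).
  rewrite Cmult_assoc, <- RtoC_mult.
  replace (weight alpha z * weight (- alpha) z) with 1; [ring|].
  unfold weight; rewrite <- Rpower_plus, Rplus_opp_r, Rpower_O;
      [reflexivity|apply weight_arg_pos, Hz].
Qed.

(** * Smoothing by powers of [1 + cos t] *)

Definition peak (n : nat) (t : R) : R := (1 + cos t) ^ n.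

Definition peak_mass (n : nat) : R := / (2 * PI) * RInt (peak n) 0 (2 * PI).

Lemma peak_nonneg (n : nat) (t : R) : 0 <= peak n t.
Proof. apply pow_le; generalize (COS_bound t); lra. Qed.

Lemma ex_derive_peak (n : nat) (t : R) : ex_derive (peak n) t.
Proof. unfold peak; auto_derive; exact I. Qed.

Lemma continuous_peak (n : nat) (t : R) : continuous (peak n) t.
Proof. apply (ex_derive_continuous (peak n)), ex_derive_peak. Qed.

Lemma RInt_peak_lin (u : R -> R) (n : nat) (a b : R) :
  (forall t, continuous u t) ->
  RInt (fun t => a * peak n t + b * u t) 0 (2 * PI) =
  a * RInt (peak n) 0 (2 * PI) + b * RInt u 0 (2 * PI).
Proof. intros Hu; apply RInt_circle_lin; [apply continuous_peak|exact Hu]. Qed.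

(** Integration of the derivative of [sin t * (1 + cos t)^n]. *)
Lemma RInt_peak_succ (n : nat) :
  INR (S n) * RInt (peak (S n)) 0 (2 * PI) = (2 * INR n + 1) * RInt (peak n) 0 (2 * PI).
Proof.
assert (K : RInt (fun t => INR (S n) * peak (S n) t + - (2 * INR n + 1) * peak n t) 0 (2 * PI) = 0).
{ apply is_RInt_unique.
  replace 0 with (minus (sin (2 * PI) * peak n (2 * PI)) (sin 0 * peak n 0)) at 2.
  2:{ rewrite sin_2PI, sin_0; unfold minus, plus, opp; simpl; ring. }
  apply (is_RInt_derive (V := R_CompleteNormedModule) (fun t => sin t * peak n t)).
  - intros t _; unfold peak; auto_derive; [exact I|].
    destruct n as [|n].
    + simpl; ring.
    + rewrite S_INR; cbn [Nat.pred pow].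
      pose proof (sin2_cos2 t) as SC; unfold Rsqr in SC.
      transitivity (cos t * ((1 + cos t) * (1 + cos t) ^ n) - (INR n + 1) * (sin t * sin t) * (1 +
          cos t) ^ n); [ring|].
      replace (sin t * sin t) with (1 - cos t * cos t) by lra.
      rewrite !S_INR; ring.
  - intros t _; apply (continuous_plus (V := R_NormedModule));
      apply (continuous_scal_r (V := R_NormedModule)), continuous_peak. }
rewrite RInt_peak_lin in K by apply continuous_peak; lra.
Qed.

(** By [RInt_peak_succ] the mass doubles up to the factor
    [(2 n + 1) / (2 n + 2)], which is at least [(n + 1) / (n + 2)]. *)
Lemma peak_mass_lower (n : nat) : 2 ^ n / INR (S n) <= peak_mass n.
Proof.
induction n as [|n IH].
- unfold peak_mass; rewrite (RInt_ext _ (fun _ => 1)) by reflexivity.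
  rewrite RInt_const; unfold scal; simpl; unfold mult; simpl.
  right; field; apply PI_neq0.
- assert (E : peak_mass (S n) = (2 * INR n + 1) / INR (S n) * peak_mass n).
  { unfold peak_mass; generalize (RInt_peak_succ n) PI_RGT_0 (lt_0_INR (S n) (Nat.lt_0_succ n));
      intros H H1 H2.
    apply (Rmult_eq_reg_l (INR (S n))); [|lra].
    transitivity (/ (2 * PI) * (INR (S n) * RInt (peak (S n)) 0 (2 * PI))); [ring|rewrite H; field;
        lra]. }
  rewrite E; clear E; pose proof (pos_INR n) as Hn.
  assert (Hc : 0 <= (2 * INR n + 1) / INR (S n)).
  { rewrite S_INR; apply Rmult_le_pos; [lra|left; apply Rinv_0_lt_compat; lra]. }
  apply (Rmult_le_compat_l _ _ _ Hc) in IH; eapply Rle_trans; [|exact IH].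
  rewrite !S_INR; apply (Rmult_le_reg_r ((INR n + 1) * (INR n + 1) * (INR n + 1 + 1)));
      [repeat apply Rmult_lt_0_compat; lra|].
  replace (2 ^ S n / (INR n + 1 + 1) * ((INR n + 1) * (INR n + 1) * (INR n + 1 + 1))) with
    (2 ^ n * (2 * ((INR n + 1) * (INR n + 1)))) by (simpl; field; lra).
  replace ((2 * INR n + 1) / (INR n + 1) * (2 ^ n / (INR n + 1)) * ((INR n + 1) * (INR n + 1) *
      (INR n + 1 + 1)))
    with (2 ^ n * ((2 * INR n + 1) * (INR n + 1 + 1))) by (field; lra).
  apply Rmult_le_compat_l; [apply pow_le; lra|nra].
Qed.

Lemma peak_mass_pos (n : nat) : 0 < peak_mass n.
Proof.
eapply Rlt_le_trans; [|apply peak_mass_lower].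
apply Rdiv_lt_0_compat; [apply pow_lt; lra|apply lt_0_INR; lia].
Qed.

(** With [2 = rho (1 + s)] and [n = 2 k], Bernoulli's inequality gives
    [(1 + s)^n >= (1 + k s)^2], which is quadratic in [n]. *)

Lemma pow2_beats_geometric (rho K : R) : 0 < rho < 2 ->
  exists n : nat, K * rho ^ n < 2 ^ n / INR (S n).
Proof.
intros Hrho.
pose (s := 2 / rho - 1).
assert (Hs : 0 < s).
{ unfold s; apply Rlt_0_minus, (Rmult_lt_reg_r rho); [lra|].
  unfold Rdiv; rewrite Rmult_assoc, Rinv_l; lra. }
destruct (INR_archimed (s * s) (3 * Rabs K + 1)) as [m Hm]; [nra|].
pose (k := S m).
exists (2 * k)%nat.
assert (Hk : 1 <= INR k) by (unfold k; rewrite S_INR; generalize (pos_INR m); lra).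
assert (Hmk : INR m <= INR k) by (unfold k; rewrite S_INR; lra).
pose proof (poly k s Hs) as B.
assert (E : 2 ^ (2 * k) = rho ^ (2 * k) * ((1 + s) ^ k * (1 + s) ^ k)).
{ rewrite <- pow_add; replace (k + k)%nat with (2 * k)%nat by lia.
  rewrite <- Rpow_mult_distr; f_equal; unfold s; field; lra. }
assert (Hp : 0 < rho ^ (2 * k)) by (apply pow_lt; lra).
rewrite E, S_INR, mult_INR; simpl (INR 2).
apply (Rmult_lt_reg_r (2 * INR k + 1)); [lra|].
replace (rho ^ (2 * k) * ((1 + s) ^ k * (1 + s) ^ k) / ((1 + 1) * INR k + 1) * (2 * INR k + 1)) with
  (rho ^ (2 * k) * ((1 + s) ^ k * (1 + s) ^ k)) by (field; lra).
replace (K * rho ^ (2 * k) * (2 * INR k + 1)) with (rho ^ (2 * k) * (K * (2 * INR k + 1))) by ring.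
apply Rmult_lt_compat_l; [exact Hp|].
assert (Hks : 0 < INR k * s) by (apply Rmult_lt_0_compat; lra).
assert (K1 : (1 + INR k * s) * (1 + INR k * s) <= (1 + s) ^ k * (1 + s) ^ k)
  by (apply Rmult_le_compat; lra).
assert (K2 : K <= Rabs K) by apply Rle_abs.
assert (K3 : K * (2 * INR k + 1) <= Rabs K * (3 * INR k)).
{ apply Rle_trans with (Rabs K * (2 * INR k + 1)).
  - apply Rmult_le_compat_r; lra.
  - apply Rmult_le_compat_l; [apply Rabs_pos|lra]. }
assert (K4 : INR m * (s * s) <= INR k * (s * s)) by (apply Rmult_le_compat_r; nra).
assert (K5 : (3 * Rabs K) * INR k <= INR k * (s * s) * INR k) by (apply Rmult_le_compat_r; lra).
nra.
Qed.

(** If [c 0 > B], then [c > B + eps] near the multiples of [2 * PI], and elsewhere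
    on the circle [peak n] is at most [rho^n] with [rho < 2]. Hence the mean of
    [peak n * (c - B)] is at least [eps * peak_mass n] minus a multiple of [rho^n],
    and [peak_mass n] is eventually the larger of the two. *)
Lemma peak_concentration (c : R -> R) (B : R) :
  (forall t, continuous c t) -> (forall t, c (t + 2 * PI) = c t) ->
  (forall n, / (2 * PI) * RInt (fun t => peak n t * c t) 0 (2 * PI) <= B * peak_mass n) ->
  c 0 <= B.
Proof.
intros Hc Hper H.
destruct (Rle_lt_dec (c 0) B) as [K|K]; [exact K|exfalso].
set (eps := (c 0 - B) / 2).
assert (He : 0 < eps) by (unfold eps; lra).
assert (Hd : exists d, 0 < d < PI /\ forall t, Rabs t < d -> B + eps < c t).
{ destruct (Hc 0 _ (locally_ball _ (mkposreal _ He))) as [d Hd].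
  pose proof PI_RGT_0.
  exists (Rmin d (PI / 2)); split.
  - split; [apply Rmin_glb_lt; [apply cond_pos|lra]|].
    eapply Rle_lt_trans; [apply Rmin_r|lra].
  - intros t Ht; assert (Ht' : Rabs (t - 0) < d).
    { rewrite Rminus_0_r; eapply Rlt_le_trans; [exact Ht|apply Rmin_l]. }
    specialize (Hd t Ht').
    unfold ball in Hd; simpl in Hd; unfold AbsRing_ball, abs, minus, plus, opp in Hd; simpl in Hd.
    apply Rabs_def2 in Hd; unfold eps in *; lra. }
destruct Hd as (d & [Hd0 Hd1] & Hd).
assert (HK : exists K0, 0 < K0 /\ forall t, 0 <= t <= 2 * PI -> B - K0 <= c t).
{ destruct (continuous_interval_bounded (fun t => RtoC (c t - B))) as [K0 [HK0 HK]].
  - intro t; apply continuous_RtoC, (continuous_minus (V := R_NormedModule));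
      [apply Hc|apply continuous_const].
  - exists K0; split; [exact HK0|]; intros t Ht; specialize (HK t Ht).
    rewrite Cmod_R in HK; generalize (Rle_abs (- (c t - B))); rewrite Rabs_Ropp; lra. }
destruct HK as (K0 & HK0 & HK).
pose (rho := 1 + cos d).
assert (Hrho : 0 < rho < 2).
{ unfold rho; split.
  - generalize (cos_decreasing_1 d PI); rewrite cos_PI; lra.
  - generalize (cos_decreasing_1 0 d); rewrite cos_0; lra. }
destruct (pow2_beats_geometric rho ((K0 + eps) / eps) Hrho) as [n Hn].
assert (Hfar : forall t, d <= t <= 2 * PI - d -> 1 + cos t <= rho).
{ intros t Ht; unfold rho; apply Rplus_le_compat_l.
  destruct (Rle_lt_dec t PI).
  - apply cos_decr_1; lra.
  - replace (cos t) with (cos (2 * PI - t)).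
    + apply cos_decr_1; lra.
    + rewrite cos_minus, cos_2PI, sin_2PI; ring. }
assert (Hpt : forall t, 0 <= t <= 2 * PI ->
  (B + eps) * peak n t + - ((K0 + eps) * rho ^ n) * 1 <= peak n t * c t).
{ intros t Ht; pose proof (peak_nonneg n t) as Hp.
  assert (0 <= (K0 + eps) * rho ^ n) by (apply Rmult_le_pos; [lra|apply pow_le; lra]).
  destruct (Rlt_le_dec t d) as [Hn1|Hf1].
  - assert (B + eps < c t) by (apply Hd; rewrite Rabs_pos_eq; lra). nra.
  - destruct (Rlt_le_dec (2 * PI - d) t) as [Hn2|Hf2].
    + assert (B + eps < c t).
      { replace t with ((t - 2 * PI) + 2 * PI) by ring; rewrite Hper; apply Hd.
        rewrite Rabs_left1; lra. }
      nra.
    + assert (peak n t <= rho ^ n).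
      { apply pow_incr; split; [generalize (COS_bound t); lra|apply Hfar; lra]. }
      specialize (HK t Ht).
      assert ((B - K0) * peak n t <= c t * peak n t) by (apply Rmult_le_compat_r; lra).
      assert ((K0 + eps) * peak n t <= (K0 + eps) * rho ^ n) by (apply Rmult_le_compat_l; lra).
      lra. }
assert (HI : RInt (fun t => (B + eps) * peak n t + - ((K0 + eps) * rho ^ n) * 1) 0 (2 * PI)
   <= RInt (fun t => peak n t * c t) 0 (2 * PI)).
{ apply RInt_le.
  - generalize two_PI_pos; lra.
  - apply ex_RInt_R; intro t; apply (continuous_plus (V := R_NormedModule));
      [apply (continuous_scal_r (V := R_NormedModule)), continuous_peak|apply continuous_const].
  - apply ex_RInt_R; intro t; apply (continuous_mult (K := R_AbsRing));
      [apply continuous_peak|apply Hc].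
  - intros t Ht; apply Hpt; lra. }
rewrite (RInt_peak_lin (fun _ => 1)) in HI by (intro; apply continuous_const).
rewrite (RInt_const (V := R_CompleteNormedModule) 0 (2 * PI) 1) in HI.
change (scal (2 * PI - 0) 1) with ((2 * PI - 0) * 1) in HI.
pose proof two_PI_pos as HP.
apply (Rmult_le_compat_l (/ (2 * PI))) in HI; [|left; apply Rinv_0_lt_compat, HP].
specialize (H n).
assert (E : / (2 * PI) * ((B + eps) * RInt (peak n) 0 (2 * PI) + - ((K0 + eps) * rho ^ n) * ((2 *
    PI - 0) * 1)) =
  (B + eps) * peak_mass n - (K0 + eps) * rho ^ n) by (unfold peak_mass; field; lra).
rewrite E in HI.
pose proof (peak_mass_lower n) as HM.
assert (K1 : eps * ((K0 + eps) / eps * rho ^ n) < eps * peak_mass n) by (apply Rmult_lt_compat_l;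
    lra).
replace (eps * ((K0 + eps) / eps * rho ^ n)) with ((K0 + eps) * rho ^ n) in K1 by (field; lra).
lra.
Qed.

(** ** Averages with these weights *)

Lemma circle_mean_peak_le (n : nat) (B : R) (u : R -> C) :
  (forall t, ccontinuous u t) ->
  (forall t, Cmod (u t) <= peak n t * B) -> Cmod (circle_mean u) <= peak_mass n * B.
Proof.
intros Hu H.
assert (Hv : forall t, continuous (fun t => peak n t * B) t).
{ intro t; apply (continuous_ext (fun t => B * peak n t)); [intro; apply Rmult_comm|].
  apply (continuous_scal_r (V := R_NormedModule)), continuous_peak. }
eapply Rle_trans; [apply (circle_mean_le u _ Hu Hv); intros; apply H|].
rewrite circle_mean_RtoC by exact Hv; simpl; right; unfold peak_mass.
rewrite (RInt_ext _ (fun t => B * peak n t + 0 * peak n t)) by (intros; unfold peak; simpl; ring).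
rewrite RInt_peak_lin by apply continuous_peak; ring.
Qed.

(** Rotation multiplies each Wirtinger derivative by [cis t] or its conjugate;
    these factors are carried by the weights. *)
Lemma weighted_system_rot_avg (alpha : R) (psi : R -> C) (f p q h g hb : C -> C) :
  (forall t, ccontinuous psi t) ->
  weighted_system alpha f p q h g hb ->
  weighted_system alpha (rot_avg psi f) (rot_avg (fun t => psi t * cis t)%C p)
    (rot_avg (fun t => psi t * Cconj (cis t))%C q) (rot_avg (fun t => psi t * Cconj (cis t))%C h)
    (rot_avg (fun t => psi t * Cconj (cis t) * cis t)%C g)
    (rot_avg (fun t => psi t * Cconj (cis t) * Cconj (cis t))%C hb).
Proof.
intros Hpsi [Hf Hh Hw].
assert (Hpsi2 : forall t, ccontinuous (fun t : R => psi t * Cconj (cis t))%C t)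
  by (intro; ccont).
split.
- apply rot_avg_C1; assumption.
- apply (rot_avg_C1 (fun t => psi t * Cconj (cis t))%C); assumption.
- intros z Hz; apply rot_avg_radial; try assumption.
  apply (C1_wirtinger_continuous _ _ _ Hh).
Qed.

(** * Boundary values of the smoothed solution *)

Lemma Derive_n_trig (c : R) (n : nat) : forall A B, exists A' B', forall t,
  Derive_n (fun s => A * cos (c * s) + B * sin (c * s)) n t = A' * cos (c * t) + B' * sin (c * t).
Proof.
induction n as [|n IH]; intros A B.
- exists A, B; reflexivity.
- destruct (IH A B) as (A' & B' & E); exists (B' * c), (- (A' * c)); intro t; simpl.
  rewrite (Derive_ext _ (fun t => A' * cos (c * t) + B' * sin (c * t))) by exact E.
  apply is_derive_unique; auto_derive; [exact I|ring].
Qed.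

Lemma ex_derive_n_trig (c A B : R) (n : nat) (t : R) :
  ex_derive_n (fun s => A * cos (c * s) + B * sin (c * s)) n t.
Proof.
destruct n as [|n]; simpl; [exact I|].
destruct (Derive_n_trig c n A B) as (A' & B' & E).
apply (ex_derive_ext (fun t => A' * cos (c * t) + B' * sin (c * t))); [intro; symmetry; apply E|].
auto_derive; exact I.
Qed.

Lemma cis_pow (t : R) (n : nat) : (cis t ^ n)%C = cis (INR n * t).
Proof.
induction n as [|n IH].
- simpl; rewrite Rmult_0_l, cis_0; reflexivity.
- rewrite S_INR, Rmult_plus_distr_r, Rmult_1_l, cis_plus, <- IH; simpl; ring.
Qed.

(** The characters of the circle as test functions: powers of [z] or of its
    conjugate. *)
Lemma smooth_circle_character (k : Z) :
  exists phi, smooth_circle phi /\ forall t, phi (cis t) = cis (IZR k * t).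
Proof.
assert (H : exists phi : C -> C, forall t, phi (cis t) = cis (IZR k * t)).
{ destruct (Z_le_gt_dec 0 k) as [Hk|Hk].
  - exists (fun z => z ^ (Z.to_nat k))%C; intro t;
      rewrite cis_pow, INR_IZR_INZ, Z2Nat.id by exact Hk; reflexivity.
  - exists (fun z => Cconj (z ^ (Z.to_nat (- k))))%C; intro t.
    rewrite cis_pow, INR_IZR_INZ, Z2Nat.id, <- cis_opp by lia; f_equal; rewrite opp_IZR; ring. }
destruct H as [phi Hphi]; exists phi; split; [|exact Hphi].
intros n t; split.
- apply (ex_derive_n_ext (fun s => 1 * cos (IZR k * s) + 0 * sin (IZR k * s)));
    [|apply ex_derive_n_trig].
  intro s; rewrite Hphi; simpl; ring.
- apply (ex_derive_n_ext (fun s => 0 * cos (IZR k * s) + 1 * sin (IZR k * s)));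
    [|apply ex_derive_n_trig].
  intro s; rewrite Hphi; simpl; ring.
Qed.

(** The pairing of [u] with [cis (k t) * peak n (t - th)]. The frequency [k] is
    there for the induction on [n]: [1 + cos (t - th)] mixes [k] with [k - 1] and
    [k + 1]. *)
Definition peak_pairing (n : nat) (u : R -> C) (k : Z) (th : R) : C :=
  circle_mean (fun t => u t * cis (IZR k * t) * RtoC (peak n (t - th)))%C.

Lemma continuous_peak_integrand (n : nat) (u : R -> C) (k : Z) (th : R) :
  (forall t, ccontinuous u t) ->
  forall t, ccontinuous (fun t : R => u t * cis (IZR k * t) * RtoC (peak n (t - th)))%C t.
Proof.
intros Hu t; apply continuous_Cmult; [apply continuous_Cmult; [apply Hu|]|apply continuous_RtoC].
- apply (continuous_comp (fun t => IZR k * t) cis); [|apply continuous_cis].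
  apply (continuous_scal_r (V := R_NormedModule)), continuous_id.
- apply (continuous_comp (fun t => t - th) (peak n)); [|apply continuous_peak].
  apply (continuous_minus (V := R_NormedModule)); [apply continuous_id|apply continuous_const].
Qed.

Lemma RtoC_cos_minus (t th : R) :
  RtoC (cos (t - th)) = (/ 2 * (cis t * Cconj (cis th) + Cconj (cis t) * cis th))%C.
Proof.
rewrite cos_minus; apply injective_projections; simpl; field.
Qed.

Lemma peak_pairing_succ (n : nat) (u : R -> C) (k : Z) (th : R) :
  (forall t, ccontinuous u t) ->
  peak_pairing (S n) u k th =
  (peak_pairing n u k th + (/ 2 * Cconj (cis th) * peak_pairing n u (k + 1) th
     + / 2 * cis th * peak_pairing n u (k - 1) th))%C.
Proof.
intros Hu; unfold peak_pairing.
pose proof (continuous_peak_integrand n u k th Hu) as C0.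
pose proof (continuous_peak_integrand n u (k + 1) th Hu) as C1.
pose proof (continuous_peak_integrand n u (k - 1) th Hu) as C2.
rewrite <- (circle_mean_scal _ _ C1), <- (circle_mean_scal _ _ C2).
rewrite <- circle_mean_plus, <- circle_mean_plus.
- apply circle_mean_ext; intros t _; unfold peak; cbn [pow].
  rewrite RtoC_mult, RtoC_plus, RtoC_cos_minus, plus_IZR, minus_IZR.
  replace ((IZR k + 1) * t) with (IZR k * t + t) by ring.
  replace ((IZR k - 1) * t) with (IZR k * t + - t) by ring.
  rewrite !cis_plus, cis_opp; ring.
- exact C0.
- intro t; apply continuous_Cplus; (apply continuous_Cmult; [apply continuous_const|]);
    [apply C1|apply C2].
- intro t; apply continuous_Cmult; [apply continuous_const|apply C1].
- intro t; apply continuous_Cmult; [apply continuous_const|apply C2].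
Qed.

(** Since [peak n (t - th)] is a trigonometric polynomial in [t] whose
    coefficients are bounded in [th], convergence of the Fourier coefficients
    gives convergence uniformly in [th]. *)
Lemma peak_pairing_uniform (f fstar : C -> C) (n : nat) :
  (forall y, disk y -> ccont_at f y) ->
  (forall t, ccontinuous (fun t : R => fstar (cis t)) t) ->
  boundary_value f fstar ->
  forall (k : Z) eps, 0 < eps -> exists rho, 0 < rho < 1 /\ forall r th, rho < r < 1 ->
    Cmod (peak_pairing n (fun t => f (RtoC r * cis t)%C) k th
          - peak_pairing n (fun t => fstar (cis t)) k th)%C < eps.
Proof.
intros Cf Cs Hb.
assert (Cr : forall r, 0 < r < 1 -> forall t, ccontinuous (fun t : R => f (RtoC r * cis t)%C) t).
{ intros r Hr t; apply (ccontinuous_comp (fun t => RtoC r * cis t)%C f).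
  - apply continuous_Cmult; [apply continuous_const|apply continuous_cis].
  - apply Cf; unfold disk; rewrite Cmod_mult, Cmod_cis, Cmod_RtoC_pos; lra. }
induction n as [|n IH]; intros k eps He.
- destruct (smooth_circle_character k) as (phi & Hphi & Ephi).
  assert (E : forall u : C -> C, circle_pairing u phi = circle_mean (fun t => u (cis t) * cis (IZR
      k * t))%C).
  { intro u; unfold circle_pairing, circle_mean; f_equal; apply RInt_ext; intros; rewrite Ephi;
      reflexivity. }
  assert (E0 : forall u th, peak_pairing 0 u k th = circle_mean (fun t => u t * cis (IZR k * t))%C).
  { intros u th; unfold peak_pairing; apply circle_mean_ext; intros; unfold peak; simpl; ring. }
  assert (HL : locally (circle_pairing fstar phi) (fun w => Cmod (w - circle_pairing fstar phi)%C <
      eps)).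
  { apply (proj2 (locally_C_iff _ _)); exists eps; split; [exact He|trivial]. }
  destruct (Hb phi Hphi _ HL) as [d Hd].
  exists (Rmax (1 / 2) (1 - d)); split.
  + split; [eapply Rlt_le_trans; [|apply Rmax_l]; lra|apply Rmax_lub_lt;
      [lra|generalize (cond_pos d); lra]].
  + intros r th [Hr1 Hr2]; rewrite !E0.
    assert (Hrd : 1 - d < r) by (eapply Rle_lt_trans; [apply Rmax_r|exact Hr1]).
    assert (Hball : ball 1 d r).
    { unfold ball; simpl; unfold AbsRing_ball, abs, minus, plus, opp; simpl; apply Rabs_def1; lra. }
    specialize (Hd r Hball Hr2); rewrite !E in Hd; exact Hd.
- assert (He2 : 0 < eps / 2) by lra.
  destruct (IH k _ He2) as (r0 & H0 & K0), (IH (k + 1)%Z _ He2) as (r1 & H1 & K1),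
      (IH (k - 1)%Z _ He2) as (r2 & H2 & K2).
  exists (Rmax r0 (Rmax r1 r2)); split.
  + split; [eapply Rlt_le_trans; [|apply Rmax_l]; lra|repeat apply Rmax_lub_lt; lra].
  + intros r th [Hr1 Hr2].
    assert (A0 : r0 < r) by (eapply Rle_lt_trans; [apply Rmax_l|exact Hr1]).
    assert (A12 : Rmax r1 r2 < r) by (eapply Rle_lt_trans; [apply Rmax_r|exact Hr1]).
    assert (A1 : r1 < r) by (eapply Rle_lt_trans; [apply Rmax_l|exact A12]).
    assert (A2 : r2 < r) by (eapply Rle_lt_trans; [apply Rmax_r|exact A12]).
    rewrite (peak_pairing_succ n _ k th (Cr r (conj (Rlt_trans _ _ _ (proj1 H0) A0) Hr2))),
        (peak_pairing_succ n _ k th Cs).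
    specialize (K0 r th (conj A0 Hr2)); specialize (K1 r th (conj A1 Hr2));
        specialize (K2 r th (conj A2 Hr2)).
    match goal with |- Cmod (?a + (?c1 * ?b + ?c2 * ?d) - (?a' + (?c1 * ?b' + ?c2 * ?d')))%C < _ =>
      replace (a + (c1 * b + c2 * d) - (a' + (c1 * b' + c2 * d')))%C with ((a - a') + (c1 * (b -
          b') + c2 * (d - d')))%C by ring end.
    eapply Rle_lt_trans; [apply Cmod_triangle|].
    eapply Rle_lt_trans; [apply Rplus_le_compat_l, Cmod_triangle|].
    rewrite !Cmod_mult, Cmod_conj, Cmod_cis.
    replace (Cmod (/ 2)) with (/ 2); [lra|].
    rewrite <- RtoC_inv by lra; rewrite Cmod_RtoC_pos; lra.
Qed.

Lemma Cmod_cis_polar (z : C) : exists th, z = (RtoC (Cmod z) * cis th)%C.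
Proof.
destruct (Ceq_dec z 0) as [->|Hz].
- exists 0; rewrite Cmod_0; ring.
- pose proof (proj1 (Cmod_gt_0 z) Hz) as Hp.
  pose (c := fst z / Cmod z); pose (s := snd z / Cmod z).
  assert (E1 : c * c + s * s = 1).
  { generalize (Cmod_sqr z); intro E; unfold c, s.
    apply (Rmult_eq_reg_r (Cmod z ^ 2)); [|apply pow_nonzero; lra].
      replace ((fst z / Cmod z * (fst z / Cmod z) + snd z / Cmod z * (snd z / Cmod z)) * Cmod z ^ 2)
      with (fst z ^ 2 + snd z ^ 2) by (field; lra). lra. }
  assert (Hc : -1 <= c <= 1) by nra.
  assert (Es : sqrt (1 - c * c) = Rabs s) by (rewrite <- sqrt_Rsqr_abs; f_equal; unfold Rsqr; lra).
  assert (K : exists th, cos th = c /\ sin th = s).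
  { destruct (Rle_lt_dec 0 s) as [Hs|Hs].
    - exists (acos c); rewrite cos_acos, sin_acos by exact Hc; unfold Rsqr;
        rewrite Es, Rabs_pos_eq; auto.
    - exists (- acos c); rewrite cos_neg, sin_neg, cos_acos, sin_acos by exact Hc; unfold Rsqr.
      rewrite Es, Rabs_left by exact Hs; split; [reflexivity|ring]. }
  destruct K as (th & Ec & Esn); exists th.
  apply injective_projections; simpl; rewrite Ec, Esn; unfold c, s; field; lra.
Qed.

(** At [z = r cis th] the average of [f] is the pairing of [f(r cis t)] with
    [peak n (t - th)], by a shift of the angle; it is uniformly close to the same
    pairing for the boundary data, which is at most [peak_mass n * M]. *)
Lemma boundary_bound_smoothed (f fstar : C -> C) (n : nat) (M : R) :
  (forall y, disk y -> ccont_at f y) ->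
  (forall t, ccontinuous (fun t : R => fstar (cis t)) t) ->
  boundary_value f fstar -> (forall t, Cmod (fstar (cis t)) <= M) ->
  boundary_bound (rot_avg (fun t => RtoC (peak n t)) f) (peak_mass n * M).
Proof.
intros Cf Cs Hb HM eps He.
destruct (peak_pairing_uniform f fstar n Cf Cs Hb 0 eps He) as (rho & Hrho & K).
exists ((1 + rho) / 2); split; [lra|]; intros z Hz Hzr.
destruct (Cmod_cis_polar z) as [th Eth].
set (r := Cmod z) in *.
assert (Hr : rho < r < 1) by (unfold disk in Hz; fold r in Hz; lra).
assert (Hper : forall t, cis (t + 2 * PI) = cis t).
{ intro t; rewrite cis_plus; unfold cis at 2; rewrite cos_2PI, sin_2PI.
  change (1, 0) with (RtoC 1); ring. }
assert (Hperk : forall t, peak n (t + 2 * PI) = peak n t).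
{ intro t; unfold peak; rewrite cos_plus, cos_2PI, sin_2PI; f_equal; ring. }
assert (Cr : forall t, ccontinuous (fun t : R => f (RtoC r * cis t)%C) t).
{ intros t; apply (ccontinuous_comp (fun t => RtoC r * cis t)%C f).
  - apply continuous_Cmult; [apply continuous_const|apply continuous_cis].
  - apply Cf; unfold disk; rewrite Cmod_mult, Cmod_cis, Cmod_RtoC_pos; lra. }
assert (E1 : rot_avg (fun t => RtoC (peak n t)) f z = peak_pairing n (fun t => f (RtoC r * cis
    t)%C) 0 th).
{ unfold peak_pairing, rot_avg.
  rewrite <- (circle_mean_shift (fun t => f (RtoC r * cis t) * cis (IZR 0 * t) * RtoC (peak n (t -
      th)))%C th).
  - apply circle_mean_ext; intros t _.
    replace (t + th - th) with t by ring; rewrite Rmult_0_l, cis_0, cis_plus, Eth.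
    replace (RtoC r * (cis t * cis th))%C with (cis t * (RtoC r * cis th))%C by ring; ring.
  - apply (continuous_peak_integrand n (fun t => f (RtoC r * cis t)%C)), Cr.
  - intro t; rewrite !Rmult_0_l, Hper; replace (t + 2 * PI - th) with (t - th + 2 * PI) by ring.
    rewrite Hperk; reflexivity. }
assert (E2 : Cmod (peak_pairing n (fun t => fstar (cis t)) 0 th) <= peak_mass n * M).
{ unfold peak_pairing.
  rewrite <- (circle_mean_shift (fun t => fstar (cis t) * cis (IZR 0 * t) * RtoC (peak n (t -
      th)))%C th).
  - apply circle_mean_peak_le.
    + intro t; apply (continuous_comp (fun t => t + th)
        (fun t => fstar (cis t) * cis (IZR 0 * t) * RtoC (peak n (t - th)))%C).
      * apply (continuous_plus (V := R_NormedModule)); [apply continuous_id|apply continuous_const].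
      * apply (continuous_peak_integrand n (fun t => fstar (cis t))), Cs.
    + intro t; replace (t + th - th) with t by ring.
      rewrite !Cmod_mult, Cmod_cis, Cmod_RtoC_pos by apply peak_nonneg.
      generalize (HM (t + th)) (peak_nonneg n t); nra.
  - apply (continuous_peak_integrand n (fun t => fstar (cis t))), Cs.
  - intro t; rewrite !Rmult_0_l, Hper; replace (t + 2 * PI - th) with (t - th + 2 * PI) by ring.
    rewrite Hperk; reflexivity. }
rewrite E1; specialize (K r th Hr).
match type of K with Cmod (?a - ?b)%C < _ => replace a with ((a - b) + b)%C by ring end.
eapply Rle_trans; [apply Cmod_triangle|]; lra.
Qed.

(** * Suprema *)

Lemma sup_norm_le (A : C -> Prop) (u : C -> C) (B : R) :
  (exists z, A z) -> (forall z, A z -> Cmod (u z) <= B) -> sup_norm A u <= B.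
Proof.
intros [z0 Hz0] H; unfold sup_norm.
destruct (Lub_Rbar_correct (fun r => exists z, A z /\ r = Cmod (u z))) as [K1 K2].
set (l := Lub_Rbar _) in *.
assert (L1 : Rbar_le l B) by (apply K2; intros r (z & Hz & ->); apply H, Hz).
assert (L2 : Rbar_le (Cmod (u z0)) l) by (apply K1; exists z0; split; [exact Hz0|reflexivity]).
destruct l; simpl in *; [exact L1|contradiction|contradiction].
Qed.

Lemma le_sup_norm (A : C -> Prop) (u : C -> C) (K : R) (z : C) :
  (forall z, A z -> Cmod (u z) <= K) -> A z -> Cmod (u z) <= sup_norm A u.
Proof.
intros H Hz; unfold sup_norm.
destruct (Lub_Rbar_correct (fun r => exists z, A z /\ r = Cmod (u z))) as [K1 K2].
set (l := Lub_Rbar _) in *.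
assert (L1 : Rbar_le l K) by (apply K2; intros r (w & Hw & ->); apply H, Hw).
assert (L2 : Rbar_le (Cmod (u z)) l) by (apply K1; exists z; split; [exact Hz|reflexivity]).
destruct l; simpl in *; [exact L2|contradiction|contradiction].
Qed.

(** Finitely many neighbourhoods cover the square [-1, 1] x [-1, 1]: at points of
    [A] continuity bounds [u], and the neighbourhoods of the other points can be
    chosen disjoint from [A]. *)
Lemma continuous_on_bounded (A : C -> Prop) (u : C -> C) :
  (forall z, ~ A z -> locally (T := C_UniformSpace) z (fun w => ~ A w)) ->
  (forall z, A z -> Cmod z <= 1) ->
  continuous_on (T := C_UniformSpace) (U := C_UniformSpace) A u ->
  exists K, forall z, A z -> Cmod (u z) <= K.
Proof.
intros Hcl Hb Hu.
pose (T2 := (R * (R * unit))%type).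
assert (HL : forall t : T2, exists d : posreal, exists K, forall w : C,
  A w -> close_n 2 d (fst w, (snd w, tt)) t -> Cmod (u w) <= K).
{ intros (x & y & []).
  destruct (classic (A (x, y))) as [HA|HA].
  - assert (Hloc : locally (u (x, y)) (fun w => Cmod (w - u (x, y))%C < 1)).
    { apply (proj2 (locally_C_iff _ _)); exists 1; split; [lra|trivial]. }
    destruct (Hu _ HA _ Hloc) as [d Hd].
    exists d, (Cmod (u (x, y)) + 1); intros w Hw (H1 & H2 & _).
    assert (Hball : ball (x, y) d w) by (split; [exact H1|exact H2]).
    specialize (Hd w Hball Hw).
    replace (u w) with ((u w - u (x, y)) + u (x, y))%C by ring.
    eapply Rle_trans; [apply Cmod_triangle|]; lra.
  - destruct (Hcl _ HA) as [d Hd].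
    exists d, 0; intros w Hw (H1 & H2 & _); exfalso.
    apply (Hd w); [split; [exact H1|exact H2]|exact Hw]. }
destruct (functional_choice _ HL) as [delta Hdelta].
apply NNPP; intro Hneg.
apply (compactness_list 2 (-1, (-1, tt)) (1, (1, tt)) delta); intros [l Hl].
apply Hneg.
assert (HK : exists K, forall w t, A w -> List.In t l ->
    close_n 2 (delta t) (fst w, (snd w, tt)) t -> Cmod (u w) <= K).
{ clear Hl; induction l as [|t l [K HK]].
  - exists 0; intros w t _ [].
  - destruct (Hdelta t) as [K1 HK1]; exists (Rmax K K1); intros w t' Hw [<-|Ht'] Hcl'.
    + eapply Rle_trans; [apply HK1; assumption|apply Rmax_r].
    + eapply Rle_trans; [apply (HK w t'); assumption|apply Rmax_l]. }
destruct HK as [K HK]; exists K; intros w Hw.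
destruct (Hl (fst w, (snd w, tt))) as (t & Ht & _ & Hc).
- generalize (Rmax_Cmod w) (Hb w Hw) (Rmax_l (Rabs (fst w)) (Rabs (snd w))) (Rmax_r (Rabs (fst w))
    (Rabs (snd w))).
  intros H1 H2 H3 H4.
  assert (H5 : Rabs (fst w) <= 1) by lra; assert (H6 : Rabs (snd w) <= 1) by lra.
  apply Rabs_le_between in H5; apply Rabs_le_between in H6.
  simpl; repeat split; lra.
- apply (HK w t Hw Ht Hc).
Qed.

Lemma locally_Cmod (P : R -> Prop) (z : C) :
  locally (Cmod z) P -> locally (T := C_UniformSpace) z (fun w => P (Cmod w)).
Proof. intros H; exact (continuous_Cmod (fun w => w) z (continuous_id z) P H). Qed.

(** The Jacobian acts by [s -> f_z s + f_zbar conj s]. *)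
Lemma jacobian_norm_le (f : C -> C) (z : C) :
  jacobian_norm f z <= Cmod (Dz f z) + Cmod (Dzbar f z).
Proof.
apply sup_norm_le.
- exists 1; unfold circle; apply Cmod_1.
- intros s Hs; unfold circle in Hs.
  assert (E : jacobian f z s = (Dz f z * s + Dzbar f z * Cconj s)%C).
  { unfold jacobian, Dz, Dzbar; destruct (Defs.Dx f z), (Dy f z), s.
    apply injective_projections; simpl; field. }
  rewrite E; eapply Rle_trans; [apply Cmod_triangle|].
  rewrite !Cmod_mult, Cmod_conj, Hs; lra.
Qed.

(** * The gradient bound *)

(** The averaged derivatives are means of the derivatives of rotated copies of
    the solution, to which [peak_concentration] applies once the two moduli are
    written as real parts. *)
Lemma gradient_bound_of_smoothed (p q : C -> C) (z : C) (B : R) :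
  (forall y, disk y -> ccont_at p y) -> (forall y, disk y -> ccont_at q y) -> disk z ->
  (forall n, Cmod (rot_avg (fun t => RtoC (peak n t) * cis t)%C p z)
     + Cmod (rot_avg (fun t => RtoC (peak n t) * Cconj (cis t))%C q z) <= B * peak_mass n) ->
  Cmod (p z) + Cmod (q z) <= B.
Proof.
intros Cp Cq Hz H.
destruct (Cmod_dual (p z)) as (w1 & Hw1 & ->), (Cmod_dual (q z)) as (w2 & Hw2 & ->).
rewrite <- re_plus.
pose (v t := (w1 * (cis t * p (cis t * z)) + w2 * (Cconj (cis t) * q (cis t * z)))%C).
assert (Cv1 : forall t, ccontinuous (fun t : R => cis t * p (cis t * z))%C t)
  by (apply rot_avg_integrand_continuous; [apply continuous_cis|assumption|assumption]).
assert (Cv2 : forall t, ccontinuous (fun t : R => Cconj (cis t) * q (cis t * z))%C t).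
{ apply (rot_avg_integrand_continuous (fun t => Cconj (cis t))); [|assumption|assumption].
  intro; apply continuous_Cconj, continuous_cis. }
assert (Cv : forall t, ccontinuous v t).
{ intro t; apply continuous_Cplus; (apply continuous_Cmult; [apply continuous_const|]);
    [apply Cv1|apply Cv2]. }
replace (w1 * p z + w2 * q z)%C with (v 0).
2:{ unfold v; rewrite cis_0, Cconj_RtoC, !Cmult_1_l; reflexivity. }
apply (peak_concentration (fun t => Re (v t))).
- intro t; apply continuous_Re, Cv.
- intro t; unfold v; rewrite cis_plus.
  replace (cis (2 * PI)) with (RtoC 1) by (unfold cis; rewrite cos_2PI, sin_2PI; reflexivity).
  rewrite Cmult_1_r; reflexivity.
- intro n; eapply Rle_trans; [|apply (H n)].
  assert (Cn : forall t, ccontinuous (fun t : R => RtoC (peak n t) * v t)%C t)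
    by (intro; apply continuous_Cmult; [apply continuous_RtoC, continuous_peak|apply Cv]).
  assert (C1 : forall t, ccontinuous (fun t : R => RtoC (peak n t) * cis t * p (cis t * z))%C t).
  { apply (rot_avg_integrand_continuous (fun t => RtoC (peak n t) * cis t)%C);
      [|assumption|assumption].
    intro; apply continuous_Cmult; [apply continuous_RtoC, continuous_peak|apply continuous_cis]. }
  assert (C2 : forall t, ccontinuous (fun t : R => RtoC (peak n t) * Cconj (cis t) * q (cis t *
      z))%C t).
  { apply (rot_avg_integrand_continuous (fun t => RtoC (peak n t) * Cconj (cis t))%C);
      [|assumption|assumption].
    intro; apply continuous_Cmult; [apply continuous_RtoC, continuous_peak|apply continuous_Cconj,
        continuous_cis]. }
  assert (E : circle_mean (fun t => RtoC (peak n t) * v t)%C =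
    (w1 * rot_avg (fun t => RtoC (peak n t) * cis t)%C p z
     + w2 * rot_avg (fun t => RtoC (peak n t) * Cconj (cis t))%C q z)%C).
  { unfold rot_avg; rewrite <- (circle_mean_scal _ _ C1), <- (circle_mean_scal _ _ C2),
      <- circle_mean_plus.
    - apply circle_mean_ext; intros t _; unfold v; ring.
    - intro; apply continuous_Cmult; [apply continuous_const|apply C1].
    - intro; apply continuous_Cmult; [apply continuous_const|apply C2]. }
  assert (E2 : / (2 * PI) * RInt (fun t => peak n t * Re (v t)) 0 (2 * PI) = Re (circle_mean (fun t
      => RtoC (peak n t) * v t)%C)).
  { rewrite circle_mean_pair by exact Cn; cbn [Re fst]; f_equal; apply RInt_ext; intros t _.
    match goal with |- ?a = ?b => change (@eq R a b) end; rewrite re_scal_l; reflexivity. }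
  rewrite E2, E; eapply Rle_trans; [apply Re_le_Cmod|].
  eapply Rle_trans; [apply Cmod_triangle|]; rewrite !Cmod_mult, Hw1, Hw2; lra.
Qed.

Theorem theorem2p2 (alpha : R) (f fstar g : C -> C)
  (Halpha : 0 <= alpha)
  (Hg : continuous_on closed_disk g)
  (Hfstar : continuous_on circle fstar)
  (Hf : Cm 2 disk f)
  (Heq : forall z : C, disk z -> weighted_laplacian alpha f z = g z)
  (Hbd : boundary_value f fstar) :
  (forall z : C, disk z ->
     jacobian_norm f z <=
       (alpha + 1) * Rpower 2 (alpha + 1) * sup_norm circle fstar
         * (1 / (1 - Cmod z ^ 2))
       + (alpha + 4 / 3) * Rpower 2 (alpha + 1) * sup_norm disk g) /\
  ((forall z : C, disk z -> disk (f z)) ->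
   (forall z : C, closed_disk z -> g z = RtoC 0) ->
   forall z : C, disk z ->
     jacobian_norm f z <=
       (alpha + 1) * Rpower 2 (alpha + 1) * (1 / (1 - Cmod z ^ 2))).
Proof.
destruct (Cm_2_system alpha f g Hf Heq) as (h & hb & Hsys).
split.
- intros z Hz; eapply Rle_trans; [apply jacobian_norm_le|].
  destruct (continuous_on_bounded closed_disk g) as [Kg HKg].
  { intros w Hw; apply (locally_Cmod (fun r => ~ r <= 1)).
    apply (filter_imp (fun r => 1 < r)); [intros; lra|].
    apply (open_gt 1); unfold closed_disk in Hw; lra. }
  { trivial. }
  { exact Hg. }
  destruct (continuous_on_bounded circle fstar) as [Ks HKs].
  { intros w Hw; apply (locally_Cmod (fun r => ~ r = 1)).
    apply (open_neq 1), Hw. }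
  { intros w Hw; right; exact Hw. }
  { exact Hfstar. }
  assert (Bg : forall w, disk w -> Cmod (g w) <= sup_norm disk g).
  { intros w Hw; apply (le_sup_norm disk g Kg); [|exact Hw].
    intros y Hy; apply HKg; left; exact Hy. }
  assert (Bs : forall t, Cmod (fstar (cis t)) <= sup_norm circle fstar).
  { intro t; apply (le_sup_norm circle fstar Ks _ HKs), Cmod_cis. }
  assert (Cs : forall t, ccontinuous (fun t : R => fstar (cis t)) t).
  { intros t P HP; specialize (Hfstar (cis t) (Cmod_cis t) P HP).
    pose proof (continuous_cis t (fun w => circle w -> P (fstar w)) Hfstar) as K.
    revert K; unfold filtermap; apply filter_imp; intros s Hs; apply Hs, Cmod_cis. }
  pose proof (ws_F Hsys) as HF.
  pose proof (C1_wirtinger_continuous _ _ _ HF) as Cf.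
  apply gradient_bound_of_smoothed; [intros y Hy; exact (proj1 (proj2 (HF y Hy)))|intros y Hy;
      exact (proj2 (proj2 (HF y Hy)))|exact Hz|].
  intro n.
  assert (Cn : forall t, ccontinuous (fun t : R => RtoC (peak n t)) t)
    by (intro; apply continuous_RtoC, continuous_peak).
  pose proof (weighted_system_rot_avg alpha _ _ _ _ _ _ _ Cn Hsys) as Hsys'.
  pose proof (boundary_bound_smoothed f fstar n _ Cf Cs Hbd Bs) as HM.
  pose proof (peak_mass_pos n) as Hm.
  assert (Hg0 : 0 <= sup_norm disk g).
  { eapply Rle_trans; [apply Cmod_ge_0|apply (Bg z Hz)]. }
  assert (HL : forall w, disk w ->
    Cmod (rot_avg (fun t => RtoC (peak n t) * Cconj (cis t) * cis t)%C g w) <= peak_mass n *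
        sup_norm disk g).
  { intros w Hw; apply circle_mean_peak_le.
    - apply (rot_avg_integrand_continuous (fun t => RtoC (peak n t) * Cconj (cis t) * cis t)%C);
        [| |exact Hw].
      + intro t; apply continuous_Cmult; [apply continuous_Cmult;
          [apply Cn|apply continuous_Cconj]|]; apply continuous_cis.
      + intros y Hy; exact (proj1 (proj2 (ws_H Hsys y Hy))).
    - intro t; rewrite !Cmod_mult, Cmod_conj, Cmod_cis, Cmod_RtoC_pos by apply peak_nonneg.
      rewrite !Rmult_1_r; apply Rmult_le_compat_l; [apply peak_nonneg|apply Bg, disk_cis, Hw]. }
  eapply Rle_trans.
  + apply (gradient_estimate alpha (peak_mass n * sup_norm circle fstar) (peak_mass n * sup_norm
      disk g) _ _ _ _ _ _ z Halpha Hsys'); [|exact HL|exact HM|exact Hz].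
    apply Rmult_le_pos; lra.
  + right; ring.
- intros Hmap Hg0 z Hz; eapply Rle_trans; [apply jacobian_norm_le|].
  eapply Rle_trans.
  + apply (gradient_estimate alpha 1 0 _ _ _ _ _ _ z Halpha Hsys); [lra| | |exact Hz].
    * intros w Hw; rewrite (Hg0 w) by (left; exact Hw); rewrite Cmod_0; lra.
    * intros eps He; exists 0; split; [lra|]; intros w Hw _; specialize (Hmap w Hw);
        unfold disk in Hmap; lra.
  + right; ring.
Qed.
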